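(* Let $\varphi$ be a parabolic conformal automorphism of $\mathbb{D}$ with fixed point $1$. Then all the representations in $$\operatorname{IrrRep}=\{\pi_\theta,\ \pi_x : \theta\in[0,1),\ x\in\mathcal{D}_\varphi\}$$ are irreducible *-representations of $C(\mathbb{D})\rtimes_\varphi\mathbb{Z}$, and no two (distinct) representations in $\operatorname{IrrRep}$ are unitarily equivalent. Moreover, every irreducible representation $\pi$ of $C(\mathbb{D})\rtimes_\varphi\mathbb{Z}$ is unitarily equivalent to a representation in $\operatorname{IrrRep}$.
   Context: $\mathbb{D}=\{z\in\mathbb{C}:|z|\le 1\}$. Conformal automorphisms of $\mathbb{D}$ are the maps $z\mapsto e^{2i\pi\theta}\frac{z-z_0}{1-\overline{z_0}z}$ with $|z_0|<1$; such a map is parabolic if it has exactly one fixed point $\alpha$ in $\mathbb{D}$ with $|\alpha|=1$. For a homeomorphism $\varphi$ of $\mathbb{D}$, $C(\mathbb{D})\rtimes_\varphi\mathbb{Z}$ is the universal C*-algebra generated by $C(\mathbb{D})$ and a unitary $U_\varphi$ with $U_\varphi^*fU_\varphi=f\circ\varphi$ for all $f\in C(\mathbb{D})$; $A_\varphi$ denotes the function $z\mapsto z$ in $C(\mathbb{D})$. $\mathcal{D}_\varphi\subseteq\mathbb{D}\setminus\{1\}$ is a set such that for every $x\in\mathbb{D}\setminus\{1\}$ there is a unique $y\in\mathcal{D}_\varphi$ with $\mathcal{O}_\varphi(x)=\mathcal{O}_\varphi(y)$, where $\mathcal{O}_\varphi(x)=\{\varphi^n(x):n\in\mathbb{Z}\}$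 (for instance, the region between the diameter through $1$ and its image by $\varphi$, this image not included). For $\theta\in[0,1)$, $\pi_\theta$ is the representation on $\mathbb{C}$ with $\pi_\theta(A_\varphi)=1$ and $\pi_\theta(U_\varphi)=e^{2i\pi\theta}$. For $x\in\mathbb{D}\setminus\{1\}$, $\pi_x$ is the representation on $l^2(\mathbb{Z})$ with $\pi_x(A_\varphi)(\xi_n)_{n\in\mathbb{Z}}=(\varphi^n(x)\xi_n)_{n\in\mathbb{Z}}$ and $\pi_x(U_\varphi)(\xi_n)_{n\in\mathbb{Z}}=(\xi_{n-1})_{n\in\mathbb{Z}}$. *)

(* Defs.v *)
From HB Require Import structures.
From mathcomp Require Import all_boot all_order all_algebra.
From mathcomp Require Import all_classical all_reals all_analysis.
From mathcomp Require Import complex ring.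
Set Implicit Arguments. Unset Strict Implicit. Unset Printing Implicit Defensive.
Import Order.TTheory GRing.Theory Num.Theory.
Import numFieldNormedType.Exports.
Local Open Scope classical_set_scope.
Local Open Scope complex_scope.
Local Open Scope ring_scope.

(* The norm of a normedModType R[i] takes its values in R[i]; the norm of a
   complex number z is the complex number with real part |z|. *)
HB.instance Definition _ (R : realType) := NormedModule.copy R[i] (R[i]^o).

Section ComplexTopology.
Variable R : realType.
Implicit Types z : R[i].

Lemma gt0_Re (e : R[i]) : 0 < e -> 0 < complex.Re e /\ e = (complex.Re e)%:C.
Proof.
by case: e => a b; rewrite ltcE /= => /andP[/eqP -> ->].
Qed.

Lemma normr_Re z : `|complex.Re z|%:C <= `|z|.
Proof. exact: normc_ge_Re. Qed.

Lemma normr_Im z : `|complex.Im z|%:C <= `|z|.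
Proof.
case: z => a b; have := normc_ge_Re (b +i* a); rewrite /= !normc_def /=.
by rewrite addrC.
Qed.

Lemma normr_ReB z w : `|complex.Re z - complex.Re w|%:C <= `|z - w|.
Proof. by rewrite -raddfB; exact: normr_Re. Qed.

Lemma normr_ImB z w : `|complex.Im z - complex.Im w|%:C <= `|z - w|.
Proof. by rewrite -raddfB; exact: normr_Im. Qed.

Lemma normr_complex (a b : R) : `|a +i* b| <= (`|a| + `|b|)%:C.
Proof.
have -> : a +i* b = a%:C + b%:C * 'i%C.
  by simpc.
apply: (le_trans (ler_normD _ _)); rewrite normrM !normc_def /=.
by rewrite !expr0n /= !addr0 expr1n add0r sqrtr1 mulr1 !sqrtr_sqr rmorphD.
Qed.

Lemma cvg_complexP (T : Type) (F : set_system T) (FF : Filter F)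
    (f : T -> R[i]) z :
  f @ F --> z <->
  (complex.Re (f x) @[x --> F] --> complex.Re z) /\
  (complex.Im (f x) @[x --> F] --> complex.Im z).
Proof.
split=> [/cvgrPdist_lt fz | [/cvgrPdist_lt fr /cvgrPdist_lt fi]].
  split; apply/cvgrPdist_lt => e e0.
    have /fz : 0 < e%:C by rewrite ltcR.
    apply: filterS => x xe; by rewrite -ltcR; exact: le_lt_trans (normr_ReB _ _) xe.
  have /fz : 0 < e%:C by rewrite ltcR.
  apply: filterS => x xe; by rewrite -ltcR; exact: le_lt_trans (normr_ImB _ _) xe.
apply/cvgrPdist_lt => e /gt0_Re[e0 ->]; set d := complex.Re e in e0 *.
have d2 : 0 < d / 2 by rewrite divr_gt0.
apply: filterS2 (fr _ d2) (fi _ d2) => x xr xi.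
rewrite (_ : z - f x = (complex.Re z - complex.Re (f x)) +i* (complex.Im z - complex.Im (f x))); last first.
  by case: z (f x) {fr fi xr xi} => a b [c k].
apply: (le_lt_trans (normr_complex _ _)).
by rewrite ltcR [ltRHS](splitr d) ltrD.
Qed.

Lemma complex_complete (F : set_system R[i]) :
  ProperFilter F -> cauchy F -> cvg F.
Proof.
move=> FF /cauchyP Fc.
have Cr : cvg (complex.Re x @[x --> F]).
  apply: cauchy_cvg; apply/cauchyP => e e0.
  have /Fc[z Fz] : 0 < e%:C by rewrite ltcR.
  exists (complex.Re z).
  suff : F ((@complex.Re R) @^-1` ball (complex.Re z) e) by [].
  apply: filterS Fz => x xe.
  by rewrite /ball /= -ltcR; exact: le_lt_trans (normr_ReB _ _) xe.
have Ci : cvg (complex.Im x @[x --> F]).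
  apply: cauchy_cvg; apply/cauchyP => e e0.
  have /Fc[z Fz] : 0 < e%:C by rewrite ltcR.
  exists (complex.Im z).
  suff : F ((@complex.Im R) @^-1` ball (complex.Im z) e) by [].
  apply: filterS Fz => x xe.
  by rewrite /ball /= -ltcR; exact: le_lt_trans (normr_ImB _ _) xe.
apply/cvg_ex; exists (lim (complex.Re x @[x --> F]) +i* lim (complex.Im x @[x --> F])).
by apply/(@cvg_complexP _ F _ id); split.
Qed.

HB.instance Definition _ := Uniform_isComplete.Build R[i] complex_complete.

Lemma lim_ge_complex (u : nat -> R[i]) l c :
  u @ \oo --> l -> (\forall n \near \oo, c <= u n) -> c <= l.
Proof.
move=> /cvg_complexP[ur ui] cu; rewrite lecE; apply/andP; split.
  have -> : complex.Im l = complex.Im c; last exact: eqxx.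
  apply: (cvg_unique _ ui) => //.
  apply: (cvg_near_cst) => //.
  by apply: filterS cu => n; rewrite lecE => /andP[/eqP].
apply: (cvgr_to_ge ur).
by apply: filterS cu => n; rewrite lecE => /andP[].
Qed.

Lemma lim_le_complex (u : nat -> R[i]) l c :
  u @ \oo --> l -> (\forall n \near \oo, u n <= c) -> l <= c.
Proof.
move=> ul uc; rewrite -lerN2; apply: (@lim_ge_complex (fun n => - u n)).
  exact: cvgN.
by apply: filterS uc => n; rewrite lerN2.
Qed.

End ComplexTopology.

Section TwoSided.
Variable R : realType.
Implicit Types f g : int -> R[i].

(* The N-th term is the sum of f over the integers n with -N <= n < N. *)
Definition zseries (f : int -> R[i]) : nat -> R[i] :=
  series (fun n => f (Posz n) + f (Negz n)).

Lemma zseries_ge0 f : (forall n, 0 <= f n) ->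
  {homo zseries f : m n / (m <= n)%N >-> m <= n}.
Proof.
move=> f0 m n mn; rewrite /zseries /series /= [leRHS](big_cat_nat (n := m)) //=.
by rewrite lerDl sumr_ge0 // => i _; rewrite addr_ge0.
Qed.

Lemma zseries_le f g N : (forall n, f n <= g n) -> zseries f N <= zseries g N.
Proof. by move=> fg; rewrite /zseries /series /= ler_sum // => i _; rewrite lerD. Qed.

Lemma zseriesD f g : zseries (fun n => f n + g n) = zseries f + zseries g.
Proof.
apply/funext => N; rewrite -[RHS]/(zseries f N + zseries g N).
rewrite /zseries /series /= -big_split /=.
by apply: eq_bigr => i _; rewrite addrACA.
Qed.

Lemma zseriesZ (c : R[i]) f : zseries (fun n => c * f n) = (fun N => c * zseries f N).
Proof.
apply/funext => N; rewrite /zseries /series /= mulr_sumr.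
by apply: eq_bigr => i _; rewrite mulrDr.
Qed.

Lemma cvg_zseries_abs f (M : R) :
  (forall N, zseries (fun n => `|f n|) N <= M%:C) -> cvgn (zseries f).
Proof.
move=> fM.
pose gr n := complex.Re (f (Posz n) + f (Negz n)).
pose gi n := complex.Im (f (Posz n) + f (Negz n)).
have bnd (g : nat -> R) :
    (forall n, `|g n|%:C <= `|f (Posz n)| + `|f (Negz n)|) -> cvgn (series g).
  move=> gf; apply: normed_cvg; apply: nondecreasing_is_cvgn.
    by apply: nondecreasing_series => n _ _ /=.
  exists M => _ [N _ <-]; rewrite -lecR; apply: le_trans (fM N).
  by rewrite /zseries /series /= rmorph_sum /= ler_sum.
have cr : cvgn (series gr).
  by apply: bnd => n; apply: le_trans (normr_Re _) (ler_normD _ _).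
have ci : cvgn (series gi).
  by apply: bnd => n; apply: le_trans (normr_Im _) (ler_normD _ _).
apply/cvg_ex; exists (limn (series gr) +i* limn (series gi)).
apply/cvg_complexP; split => /=.
  rewrite (_ : (fun x => _) = series gr) //; apply/funext => N.
  by rewrite /zseries /series /= raddf_sum.
rewrite (_ : (fun x => _) = series gi) //; apply/funext => N.
by rewrite /zseries /series /= raddf_sum.
Qed.

Lemma cvg_zseries_ge0P f : (forall n, 0 <= f n) ->
  cvgn (zseries f) <-> exists M : R, forall N, zseries f N <= M%:C.
Proof.
move=> f0; split=> [/cvg_ex[l fl]|[M fM]].
  have lim_le N : zseries f N <= l.
    apply: (lim_ge_complex fl); exists N => // n /= Nn.
    exact: zseries_ge0.
  exists (complex.Re l) => N; have := lim_le N.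
  by rewrite !lecE /= => /andP[_ ->]; rewrite andbT eq_sym ger0_Im //
    /zseries /series /= sumr_ge0 // => i _; rewrite addr_ge0.
apply: (@cvg_zseries_abs _ M) => N.
by rewrite (_ : (fun n => _) = f) //; apply/funext => n; rewrite ger0_norm.
Qed.

Lemma zseries_term f N (n : int) : (forall n, 0 <= f n) -> (`|n| < N)%N ->
  f n <= zseries f N.
Proof.
move=> f0 nN; have [k kN fk] : exists2 k : 'I_N, (k < N)%N &
    f n <= f (Posz k) + f (Negz k).
  case: n nN => n nN; first by exists (Ordinal nN); rewrite //= lerDl.
  by exists (Ordinal (ltnW nN)); rewrite ?(ltnW nN) //= lerDr.
rewrite /zseries /series /= big_mkord (bigD1 k) //= -[leLHS]addr0 lerD //.
by rewrite sumr_ge0 // => i _; rewrite addr_ge0.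
Qed.
End TwoSided.

Section L2.
Variable R : realType.
Implicit Types x y : int -> R[i].

Definition square_summable (x : int -> R[i]) : Prop :=
  cvgn (zseries (fun n => `|x n| ^+ 2)).

Definition square_summable_pred : {pred int -> R[i]} :=
  [pred x | `[< square_summable x >]].

Lemma square_summableP x : square_summable x <->
  exists M : R, forall N, zseries (fun n => `|x n| ^+ 2) N <= M%:C.
Proof. by apply: cvg_zseries_ge0P => n; rewrite exprn_ge0. Qed.

Lemma square_summable_closed : submod_closed square_summable_pred.
Proof.
have sqD (a b : R[i]) : `|a + b| ^+ 2 <= (`|a| ^+ 2 + `|b| ^+ 2) *+ 2.
  have h : `|a + b| ^+ 2 <= (`|a| + `|b|) ^+ 2.
    by rewrite ler_pXn2r ?nnegrE ?addr_ge0 // ler_normD.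
  apply: (le_trans h); rewrite sqrrD mulr2n -subr_ge0.
  have -> : `|a| ^+ 2 + `|b| ^+ 2 + (`|a| ^+ 2 + `|b| ^+ 2) -
    (`|a| ^+ 2 + `|a| * `|b| *+ 2 + `|b| ^+ 2) = (`|a| - `|b|) ^+ 2 by ring.
  by rewrite real_exprn_even_ge0 // rpredB // normr_real.
split=> [|c x y].
  apply/asboolP/square_summableP; exists 0 => N.
  by rewrite /zseries /series /= big1 // => i _; rewrite normr0 expr0n addr0.
move=> /asboolP/square_summableP[Mx xM] /asboolP/square_summableP[My yM].
apply/asboolP/square_summableP.
have [_ ec] : 0 <= complex.Re (`|c| ^+ 2) /\ `|c| ^+ 2 = (complex.Re (`|c| ^+ 2))%:C.
  have := exprn_ge0 2 (normr_ge0 c); case: (`|c| ^+ 2) => a b.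
  by rewrite lecE /= => /andP[/eqP -> ->].
exists ((complex.Re (`|c| ^+ 2) * Mx + My) *+ 2) => N.
apply: (@le_trans _ _ (zseries (fun n => (`|c| ^+ 2 * `|x n| ^+ 2 + `|y n| ^+ 2) *+ 2) N)).
  apply: zseries_le => n; apply: (le_trans (sqD _ _)).
  by rewrite normrM exprMn.
rewrite (_ : (fun n => _) = (fun n => 2 * (`|c| ^+ 2 * `|x n| ^+ 2 + `|y n| ^+ 2))); last first.
  by apply/funext => n; rewrite mulr_natl.
rewrite zseriesZ zseriesD zseriesZ rmorphMn rmorphD rmorphM /= -ec.
rewrite -[leRHS]mulr_natl ler_pM2l ?ltr0n // -[leLHS]/(_ + _) lerD //.
by rewrite ler_wpM2l // exprn_ge0.
Qed.

HB.instance Definition _ :=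
  GRing.isSubmodClosed.Build R[i] (int -> R[i]) square_summable_pred square_summable_closed.

Record l2Z := L2Z { l2Z_val :> int -> R[i]; _ : l2Z_val \in square_summable_pred }.
HB.instance Definition _ := [isSub for l2Z_val].
HB.instance Definition _ := [Choice of l2Z by <:].
HB.instance Definition _ := [SubChoice_isSubLmodule of l2Z by <:].

Lemma l2Z_summable (x : l2Z) : square_summable x.
Proof. by case: x => x /= /asboolP. Qed.

Definition l2_inner (x y : l2Z) : R[i] := limn (zseries (fun n => x n * (y n)^*)).

Lemma l2_inner_cvg (x y : l2Z) : cvgn (zseries (fun n => x n * (y n)^*)).
Proof.
have /square_summableP[Mx xM] := @l2Z_summable x.
have /square_summableP[My yM] := @l2Z_summable y.
apply: (@cvg_zseries_abs _ _ (Mx + My)) => N.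
apply: (@le_trans _ _ (zseries (fun n => `|x n| ^+ 2 + `|y n| ^+ 2) N)); last first.
  by rewrite zseriesD rmorphD lerD.
apply: zseries_le => n; rewrite normrM norm_conjC.
have : 0 <= (`|x n| - `|y n|) ^+ 2.
  by rewrite real_exprn_even_ge0 // rpredB // normr_real.
have -> : (`|x n| - `|y n|) ^+ 2 =
  (`|x n| ^+ 2 + `|y n| ^+ 2) - `|x n| * `|y n| *+ 2 by ring.
rewrite subr_ge0; apply: le_trans.
by rewrite mulr2n lerDl mulr_ge0.
Qed.

Lemma l2_innerDl (x1 x2 y : l2Z) c :
  l2_inner (c *: x1 + x2) y = c * l2_inner x1 y + l2_inner x2 y.
Proof.
apply: cvg_lim => //.
rewrite (_ : (fun n => _) = (fun n => c * (x1 n * (y n)^*) + x2 n * (y n)^*)); last first.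
  by apply/funext => n /=; rewrite mulrDl mulrA.
rewrite zseriesD zseriesZ; apply: cvgD; last exact: l2_inner_cvg.
by apply: cvgMr; exact: l2_inner_cvg.
Qed.

Lemma l2_innerC (x y : l2Z) : l2_inner x y = (l2_inner y x)^*.
Proof.
apply: cvg_lim => //; apply/cvgrPdist_lt => e e0.
have /cvgrPdist_lt /(_ e e0) := @l2_inner_cvg y x.
apply: filterS => N; rewrite -norm_conjC rmorphB /=; apply: le_lt_trans.
rewrite (_ : (zseries (fun n => y n * (x n)^*) N)^* = zseries (fun n => x n * (y n)^*) N) //.
rewrite /zseries /series /= rmorph_sum; apply: eq_bigr => i _.
by rewrite rmorphD !rmorphM /= !conjCK ![_^* * _]mulrC.
Qed.

Lemma l2_inner_ge (x : l2Z) N : zseries (fun n => `|x n| ^+ 2) N <= l2_inner x x.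
Proof.
have := @l2_inner_cvg x x; rewrite -/(l2_inner x x).
rewrite (_ : (fun n => _) = (fun n => `|x n| ^+ 2)); last first.
  by apply/funext => n; rewrite normCK.
move=> cx; apply: (lim_ge_complex cx); exists N => // n /= Nn.
by apply: zseries_ge0 => // k; rewrite exprn_ge0.
Qed.

Lemma l2_inner_gt0 (x : l2Z) : x != 0 -> 0 < l2_inner x x.
Proof.
move=> x0; have [n xn] : exists n, x n != 0.
  apply/not_existsP => x0'; case/eqP: x0; apply/val_inj/funext => n /=.
  by have /negP/negPn/eqP := x0' n.
apply: lt_le_trans (l2_inner_ge x `|n|.+1).
apply: (@lt_le_trans _ _ (`|x n| ^+ 2)); first by rewrite exprn_gt0 // normr_gt0.
by apply: (@zseries_term _ (fun n => `|x n| ^+ 2)) => // k; rewrite exprn_ge0.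
Qed.

End L2.

Section L2Hilbert.
Variable R : realType.
Local Notation l2Z := (l2Z R).

Lemma l2_bilinear : bilinear_for ( *%R ) (Num.conj \; *%R) (@l2_inner R).
Proof.
split=> [y c x1 x2|x c y1 y2] /=; first exact: l2_innerDl.
by rewrite l2_innerC l2_innerDl rmorphD rmorphM /= -!l2_innerC.
Qed.

Lemma l2_hermitian (x y : l2Z) :
  l2_inner x y = (-1) ^+ false * Num.conj (l2_inner y x).
Proof. by rewrite expr0 mul1r -l2_innerC. Qed.

HB.instance Definition _ := bilinear_isBilinear.Build R[i] l2Z l2Z R[i]
  ( *%R ) (Num.conj \; *%R) (@l2_inner R) l2_bilinear.
HB.instance Definition _ := isHermitianSesquilinear.Build R[i] l2Z false Num.conj
  (@l2_inner R) l2_hermitian.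
HB.instance Definition _ := isDotProduct.Build R[i] l2Z (@l2_inner R)
  (@l2_inner_gt0 R).

Definition l2_dot : {dot l2Z for Num.conj} := @l2_inner R.

End L2Hilbert.


Section DotNorm.
Variables (C : numClosedFieldType) (U : lmodType C) (form : {dot U for Num.conj}).

Lemma dot_CauchySchwarz (u v : U) : `|form u v| ^+ 2 <= form u u * form v v.
Proof.
have [->|v0] := eqVneq v 0.
  by rewrite linear0r normr0 expr0n /= mulr_ge0 ?dnorm_ge0.
have vv : 0 < form v v by apply: neq0_dnorm_gt0.
have := dnorm_ge0 form (u - (form u v / form v v) *: v).
rewrite dnormB dnormZ linearZr_LR /=.
set d := form u v; set w := form v v in vv *.
have wr : w^* = w by apply: CrealP; rewrite ger0_real // ltW.
rewrite rmorphM fmorphV /= wr.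
have -> : d^* / w * d = `|d| ^+ 2 / w by rewrite normCK mulrAC [d^* * d]mulrC.
have -> : (`|d| ^+ 2 / w)^* = `|d| ^+ 2 / w.
  by apply: CrealP; rewrite ger0_real // divr_ge0 ?exprn_ge0 // ltW.
have -> : `|d / w| ^+ 2 * w = `|d| ^+ 2 / w.
  by rewrite normrM normfV (gtr0_norm vv); field; rewrite gt_eqF.
set X := _ / w; have -> : form u u + X - (X + X) = form u u - X by ring.
rewrite subr_ge0 /X.
by rewrite ler_pdivrMr.
Qed.

Lemma dot_triangle (u v : U) :
  sqrtC (form (u + v) (u + v)) <= sqrtC (form u u) + sqrtC (form v v).
Proof.
have s0 w : 0 <= sqrtC (form w w) by rewrite sqrtC_ge0 dnorm_ge0.
rewrite -ler_sqr ?nnegrE ?addr_ge0 // sqrrD !sqrtCK dnormD [leRHS]addrAC lerD2l.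
have dr : form u v + (form u v)^* \is Num.real.
  by apply/CrealP; rewrite rmorphD /= conjCK addrC.
apply: (le_trans (real_ler_norm dr)).
apply: (le_trans (ler_normD _ _)); rewrite norm_conjC -mulr2n lerMn2r /=.
rewrite -ler_sqr ?nnegrE ?mulr_ge0 // exprMn !sqrtCK.
exact: dot_CauchySchwarz.
Qed.

Lemma dot_normZ (c : C) (u : U) :
  sqrtC (form (c *: u) (c *: u)) = `|c| * sqrtC (form u u).
Proof.
by rewrite dnormZ sqrtCM ?nnegrE ?exprn_ge0 ?dnorm_ge0 // sqrCK.
Qed.

Lemma dot_norm_eq0 (u : U) : sqrtC (form u u) = 0 -> u = 0.
Proof. by move/eqP; rewrite sqrtC_eq0 dnorm_eq0 => /eqP. Qed.

End DotNorm.

Lemma seq_complete (R : realType) (V : normedModType R[i]) :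
  (forall s : nat -> V,
    (forall e : R, 0 < e ->
       exists N, forall m n, (N <= m)%N -> (N <= n)%N -> `|s m - s n| < e%:C) ->
    exists l, forall e : R, 0 < e ->
       exists N, forall n, (N <= n)%N -> `|s n - l| <= e%:C) ->
  forall F : set_system V, ProperFilter F -> cauchy F -> cvg F.
Proof.
move=> sc F FF /cauchyP Fc.
have e0 n : 0 < (n.+1%:R^-1 : R)%:C :> R[i] by rewrite ltcR.
pose s n := projT1 (cid (Fc _ (e0 n))).
have Fs n : F (ball (s n) (n.+1%:R^-1 : R)%:C) := projT2 (cid (Fc _ (e0 n))).
have small (e : R) : 0 < e -> exists N, forall n, (N <= n)%N -> (n.+1%:R^-1 : R) < e.
  move=> e_gt0; have [N _ Ne] := near_infty_natSinv_lt (PosNum e_gt0).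
  by exists N => n Nn; exact: Ne.
have [e e_gt0|l sl] := sc s.
  have e2 : 0 < e / 2 by rewrite divr_gt0.
  have [N Ne] := small _ e2; exists N => m n mN nN.
  have [x [xm xn]] := filter_ex (filterI (Fs m) (Fs n)).
  rewrite (_ : s m - s n = (s m - x) - (s n - x)); last by rewrite opprB addrA subrK.
  apply: (le_lt_trans (ler_normB _ _)); rewrite (splitr e) rmorphD ltrD //.
    by move: xm; rewrite -ball_normE /= => /lt_le_trans; apply; rewrite lecR ltW // Ne.
  by move: xn; rewrite -ball_normE /= => /lt_le_trans; apply; rewrite lecR ltW // Ne.
apply/cvg_ex; exists l; apply/cvgrPdist_lt => e /gt0_Re[e_gt0 ->].
set d := complex.Re e in e_gt0 *.
have d2 : 0 < d / 2 by rewrite divr_gt0.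
have [N Ne] := small _ d2; have [M Me] := sl _ d2; pose n := maxn N M.
apply: filterS (Fs n) => x; rewrite -ball_normE /= => xn.
rewrite (_ : l - x = (l - s n) + (s n - x)); last by rewrite addrA subrK.
apply: (le_lt_trans (ler_normD _ _)); rewrite (splitr d) rmorphD ler_ltD //.
  by rewrite distrC Me // leq_maxr.
by apply: (lt_le_trans xn); rewrite lecR ltW // Ne // leq_maxl.
Qed.

Section L2Complete.
Variable R : realType.
Local Notation l2Z := (l2Z R).

HB.instance Definition _ := Lmodule_isNormed.Build R[i] l2Z
  (@dot_triangle _ _ (@l2_dot R)) (@dot_normZ _ _ (@l2_dot R))
  (@dot_norm_eq0 _ _ (@l2_dot R)).

Lemma l2_norm (x : l2Z) : `|x| ^+ 2 = l2_inner x x.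
Proof. exact: sqrtCK. Qed.

Lemma l2_inner_le (x : l2Z) (c : R[i]) :
  (forall N, zseries (fun n => `|x n| ^+ 2) N <= c) -> l2_inner x x <= c.
Proof.
move=> xc; apply: (lim_le_complex (@l2_inner_cvg _ x x)).
exists 0 => // N _ /=.
by rewrite (_ : (fun n => _) = (fun n => `|x n| ^+ 2)) //; apply/funext => n; rewrite normCK.
Qed.

Lemma l2_coord_le (x : l2Z) n : `|x n| <= `|x|.
Proof.
rewrite -ler_sqr ?nnegrE // l2_norm; apply: le_trans (l2_inner_ge x `|n|.+1).
by apply: (@zseries_term _ (fun n => `|x n| ^+ 2)) => // k; rewrite exprn_ge0.
Qed.

Lemma l2_seq_complete (s : nat -> l2Z) :
    (forall e : R, 0 < e ->
       exists N, forall m n, (N <= m)%N -> (N <= n)%N -> `|s m - s n| < e%:C) ->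
    exists l, forall e : R, 0 < e ->
       exists N, forall n, (N <= n)%N -> `|s n - l| <= e%:C.
Proof.
move=> sC.
have coord_cvg k : cvgn (fun n => s n k).
  apply: cauchy_cvg; apply/cauchyP => e /gt0_Re[e0 ->].
  have [N Ne] := sC _ e0; exists (s N k).
  suff : \forall n \near \oo, `|s N k - s n k| < (complex.Re e)%:C by [].
  exists N => // n /= Nn; apply: le_lt_trans (Ne N n (leqnn _) Nn).
  exact: (l2_coord_le (s N - s n) k).
pose l k := limn (fun n => s n k).
have bound (e : R) : 0 < e -> exists N, forall n, (N <= n)%N ->
    forall M, zseries (fun k => `|s n k - l k| ^+ 2) M <= (e ^+ 2)%:C.
  move=> e0; have [N Ne] := sC _ e0; exists N => n Nn M.
  apply: (@lim_le_complex _
    (fun m => zseries (fun k => `|s n k - s m k| ^+ 2) M)); last first.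
    exists N => // m /= Nm.
    apply: (le_trans (l2_inner_ge (s n - s m) M)).
    have e0' : 0 <= e%:C by rewrite ler0c ltW.
    by rewrite -l2_norm rmorphXn /= ler_sqr ?nnegrE //; apply/ltW/Ne.
  have cc k : `|s n k - s m k| ^+ 2 @[m --> \oo] --> `|s n k - l k| ^+ 2.
    have c1 : `|s n k - s m k| @[m --> \oo] --> `|s n k - l k|.
      by apply: cvg_norm; apply: cvgB; [exact: cvg_cst|exact: coord_cvg].
    exact: (cvgM c1 c1).
  rewrite /zseries /series /=; apply: cvg_big => [|i _]; first exact: add_continuous.
  exact: cvgD.
have dl2 (e : R) : 0 < e -> exists N, forall n, (N <= n)%N ->
    (fun k => s n k - l k) \in @square_summable_pred R.
  move=> /bound[N Ne]; exists N => n /Ne h; apply/asboolP/square_summableP.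
  by exists (e ^+ 2).
have ll2 : l \in @square_summable_pred R.
  have [N /(_ N (leqnn _)) dl] := dl2 _ (@ltr01 R).
  pose d : l2Z := L2Z dl.
  rewrite (_ : l = s N - d :> (int -> R[i])); first exact: valP.
  by apply/funext => k; rewrite -[RHS]/(s N k - (s N k - l k)) opprB addrC subrK.
exists (L2Z ll2) => e e0; have [N Ne] := bound _ e0; exists N => n Nn.
have e0' : 0 <= e%:C by rewrite ler0c ltW.
rewrite -ler_sqr ?nnegrE // l2_norm.
rewrite -rmorphXn; apply: l2_inner_le => M; exact: Ne.
Qed.

HB.instance Definition _ := Uniform_isComplete.Build l2Z
  (@seq_complete R l2Z l2_seq_complete).

End L2Complete.

(* {dot H for conj} is a positive definite form, linear in its first argument
   and conjugate-linear in its second one. *)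
HB.mixin Record isHilbert (R : realType) H of CompleteNormedModule R[i] H := {
  inner : {dot H for @Num.conj R[i]};
  inner_norm : forall x : H, `|x| ^+ 2 = inner x x }.

#[short(type="hilbertType")]
HB.structure Definition Hilbert (R : realType) :=
  {H of CompleteNormedModule R[i] H & isHilbert R H}.

HB.instance Definition _ (R : realType) := isHilbert.Build R (l2Z R) (@l2_norm R).

Section ComplexHilbert.
Variable R : realType.

Definition complex_inner (z w : R[i]) : R[i] := z * w^*.

Lemma complex_bilinear : bilinear_for ( *%R ) (Num.conj \; *%R) complex_inner.
Proof.
split=> [y c x1 x2|x c y1 y2] /=; rewrite /complex_inner.
  by rewrite mulrDl /GRing.scale /= mulrA.
by rewrite rmorphD mulrDr /GRing.scale /= rmorphM mulrCA.
Qed.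

Lemma complex_hermitian (z w : R[i]) :
  complex_inner z w = (-1) ^+ false * Num.conj (complex_inner w z).
Proof. by rewrite expr0 mul1r /complex_inner rmorphM /= conjCK mulrC. Qed.

Lemma complex_inner_gt0 (z : R[i]) : z != 0 -> 0 < complex_inner z z.
Proof. by move=> z0; rewrite /complex_inner -normCK exprn_gt0 // normr_gt0. Qed.

HB.instance Definition _ := bilinear_isBilinear.Build R[i] R[i] R[i] R[i]
  ( *%R ) (Num.conj \; *%R) complex_inner complex_bilinear.
HB.instance Definition _ := isHermitianSesquilinear.Build R[i] R[i] false
  Num.conj complex_inner complex_hermitian.
HB.instance Definition _ := isDotProduct.Build R[i] R[i] complex_inner
  complex_inner_gt0.

Lemma complex_inner_norm (z : R[i]) : `|z| ^+ 2 = complex_inner z z.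
Proof. by rewrite normCK. Qed.

HB.instance Definition _ := isHilbert.Build R R[i] complex_inner_norm.

End ComplexHilbert.

HB.mixin Record isStarAlgebra (R : realType) A of GRing.Algebra R[i] A := {
  star : A -> A;
  starK : involutive star;
  starD : forall a b, star (a + b) = star a + star b;
  starZ : forall (c : R[i]) a, star (c *: a) = c^* *: star a;
  starM : forall a b, star (a * b) = star b * star a }.

#[short(type="starAlgType")]
HB.structure Definition StarAlgebra (R : realType) :=
  {A of GRing.Algebra R[i] A & isStarAlgebra R A}.

(* Unital C*-algebras. The norm is not the library's `|a|: a type that is both
   a ring and a completeNormedModType has no common join in the hierarchy. *)
HB.mixin Record StarAlgebra_isCStarAlgebra (R : realType) A
    of StarAlgebra R A := {
  cnorm : A -> R;
  cnorm_eq0 : forall a, cnorm a = 0 -> a = 0;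
  cnormD : forall a b, cnorm (a + b) <= cnorm a + cnorm b;
  cnormZ : forall (c : R[i]) a, (cnorm (c *: a))%:C = `|c| * (cnorm a)%:C;
  cnormM : forall a b, cnorm (a * b) <= cnorm a * cnorm b;
  cnorm_star : forall a, cnorm (star a * a) = cnorm a ^+ 2;
  cnorm_complete : forall s : nat -> A,
    (forall e, 0 < e -> exists N, forall m n,
       (N <= m)%N -> (N <= n)%N -> cnorm (s m - s n) < e) ->
    exists l, cnorm (s n - l) @[n --> \oo] --> (0 : R) }.

#[short(type="cstarAlgType")]
HB.structure Definition CStarAlgebra (R : realType) :=
  {A of StarAlgebra R A & StarAlgebra_isCStarAlgebra R A}.

(* Unital, since {lrmorphism _ -> _} preserves 1. *)
Record starHom (R : realType) (A B : starAlgType R) := StarHom {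
  star_hom :> {lrmorphism A -> B};
  star_homS : forall a, star_hom (star a) = star (star_hom a) }.

(* The closed unit disk; it is used as a type with the subspace topology. *)
Definition disk (R : realType) : set R[i] := [set z | `|z| <= 1].
Arguments disk : clear implicits.

Lemma one_in_disk (R : realType) : (1 : R[i]) \in disk R.
Proof. by rewrite inE /disk /= normr1. Qed.

Definition disk1 (R : realType) : disk R := exist _ 1 (@one_in_disk R).
Arguments disk1 : clear implicits.

Definition Cdisk (R : realType) := continuousType (disk R) R[i].
Arguments Cdisk : clear implicits.

Section Cdisk.
Variable R : realType.
Local Notation CD := (Cdisk R).
Implicit Types f g h : CD.

HB.instance Definition _ := Choice.on CD.

Lemma Cdisk_eq f g : (forall z, f z = g z) -> f = g.
Proof. by move=> fg; apply/continuousEP. Qed.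

Lemma Cdisk_addP f g : continuous (fun z => f z + g z).
Proof. by move=> z; exact: (cvgD (@cts_fun _ _ f z) (@cts_fun _ _ g z)). Qed.
Lemma Cdisk_oppP f : continuous (fun z => - f z).
Proof. by move=> z; exact: (cvgN (@cts_fun _ _ f z)). Qed.
Lemma Cdisk_mulP f g : continuous (fun z => f z * g z).
Proof. by move=> z; exact: (cvgM (@cts_fun _ _ f z) (@cts_fun _ _ g z)). Qed.
Lemma conj_continuous : continuous (Num.conj : R[i] -> R[i]).
Proof.
move=> z; apply/(@cvgrPdist_lt _ _ _ (nbhs z) (nbhs_filter z)) => e e0.
have := @cvgr_dist_lt _ _ _ (nbhs z) (nbhs_filter z) id z (@cvg_id _ (nbhs z)) e e0.
suff : nbhs z (fun w : R[i] => `|z - w| < e) ->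
  nbhs z (fun w : R[i] => `|z^* - w^*| < e) by [].
apply: (@filterS _ _ (nbhs_filter z)) => w /= zw.
by rewrite -rmorphB norm_conjC; exact: zw.
Qed.
Lemma Cdisk_starP f : continuous (fun z => (f z)^*).
Proof.
by move=> z; exact: continuous_comp (@cts_fun _ _ f z) (@conj_continuous (f z)).
Qed.
Lemma Cdisk_idP : continuous (fun z : disk R => set_val z : R[i]).
Proof. exact: initial_continuous. Qed.

Definition Cdisk_add f g : CD := mkcts (@Cdisk_addP f g).
Definition Cdisk_opp f : CD := mkcts (@Cdisk_oppP f).
Definition Cdisk_mul f g : CD := mkcts (@Cdisk_mulP f g).
Definition Cdisk_cst (c : R[i]) : CD := cst c.
Definition Cdisk_scale c f : CD := Cdisk_mul (Cdisk_cst c) f.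
Definition Cdisk_star f : CD := mkcts (@Cdisk_starP f).
Definition Cdisk_id : CD := mkcts Cdisk_idP.

Lemma Cdisk_addA : associative Cdisk_add.
Proof. by move=> f g h; apply: Cdisk_eq => z; exact: addrA. Qed.
Lemma Cdisk_addC : commutative Cdisk_add.
Proof. by move=> f g; apply: Cdisk_eq => z; exact: addrC. Qed.
Lemma Cdisk_add0 : left_id (Cdisk_cst 0) Cdisk_add.
Proof. by move=> f; apply: Cdisk_eq => z; exact: add0r. Qed.
Lemma Cdisk_addN : left_inverse (Cdisk_cst 0) Cdisk_opp Cdisk_add.
Proof. by move=> f; apply: Cdisk_eq => z; exact: addNr. Qed.

HB.instance Definition _ :=
  GRing.isZmodule.Build CD Cdisk_addA Cdisk_addC Cdisk_add0 Cdisk_addN.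

Lemma Cdisk_mulA : associative Cdisk_mul.
Proof. by move=> f g h; apply: Cdisk_eq => z; exact: mulrA. Qed.
Lemma Cdisk_mulC : commutative Cdisk_mul.
Proof. by move=> f g; apply: Cdisk_eq => z; exact: mulrC. Qed.
Lemma Cdisk_mul1 : left_id (Cdisk_cst 1) Cdisk_mul.
Proof. by move=> f; apply: Cdisk_eq => z; exact: mul1r. Qed.
Lemma Cdisk_mulDl : left_distributive Cdisk_mul +%R.
Proof. by move=> f g h; apply: Cdisk_eq => z; exact: mulrDl. Qed.
Lemma Cdisk_1neq0 : Cdisk_cst 1 != 0.
Proof.
apply/eqP => /continuousEP /(_ (disk1 R)) /eqP.
by rewrite /= (oner_eq0 R[i]).
Qed.

HB.instance Definition _ := GRing.Zmodule_isComNzRing.Build CD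
  Cdisk_mulA Cdisk_mulC Cdisk_mul1 Cdisk_mulDl Cdisk_1neq0.

Lemma Cdisk_scaleA a b f : Cdisk_scale a (Cdisk_scale b f) = Cdisk_scale (a * b) f.
Proof. by apply: Cdisk_eq => z; exact: mulrA. Qed.
Lemma Cdisk_scale1 : left_id 1 Cdisk_scale.
Proof. by move=> f; apply: Cdisk_eq => z; exact: mul1r. Qed.
Lemma Cdisk_scaleDr : right_distributive Cdisk_scale +%R.
Proof. by move=> c f g; apply: Cdisk_eq => z; exact: mulrDr. Qed.
Lemma Cdisk_scaleDl f : {morph Cdisk_scale^~ f : a b / a + b}.
Proof. by move=> a b; apply: Cdisk_eq => z; exact: mulrDl. Qed.

HB.instance Definition _ := GRing.Zmodule_isLmodule.Build R[i] CD
  Cdisk_scaleA Cdisk_scale1 Cdisk_scaleDr Cdisk_scaleDl.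

Lemma Cdisk_scaleAl (c : R[i]) f g : c *: (f * g) = (c *: f) * g.
Proof. by apply: Cdisk_eq => z; exact: mulrA. Qed.
HB.instance Definition _ := GRing.Lmodule_isLalgebra.Build R[i] CD Cdisk_scaleAl.
Lemma Cdisk_scaleAr (c : R[i]) f g : c *: (f * g) = f * (c *: g).
Proof. by apply: Cdisk_eq => z; exact: mulrCA. Qed.
HB.instance Definition _ := GRing.Lalgebra_isAlgebra.Build R[i] CD Cdisk_scaleAr.

Lemma Cdisk_starK : involutive Cdisk_star.
Proof. by move=> f; apply: Cdisk_eq => z; exact: conjCK. Qed.
Lemma Cdisk_starD f g : Cdisk_star (f + g) = Cdisk_star f + Cdisk_star g.
Proof. by apply: Cdisk_eq => z; exact: rmorphD. Qed.
Lemma Cdisk_starZ (c : R[i]) f : Cdisk_star (c *: f) = c^* *: Cdisk_star f.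
Proof. by apply: Cdisk_eq => z; exact: rmorphM. Qed.
Lemma Cdisk_starM f g : Cdisk_star (f * g) = Cdisk_star g * Cdisk_star f.
Proof. by rewrite [RHS]mulrC; apply: Cdisk_eq => z; exact: rmorphM. Qed.
HB.instance Definition _ := isStarAlgebra.Build R CD
  Cdisk_starK Cdisk_starD Cdisk_starZ Cdisk_starM.

End Cdisk.
Arguments Cdisk_id : clear implicits.

Record homeomorphism (X : topologicalType) := Homeomorphism {
  homeo_fun :> continuousType X X;
  homeo_inv : continuousType X X;
  homeo_funK : cancel homeo_fun homeo_inv;
  homeo_invK : cancel homeo_inv homeo_fun }.

Definition homeo_iter (X : topologicalType) (phi : homeomorphism X) (n : int) :
    X -> X :=
  match n with
  | Posz k => iter k phi
  | Negz k => iter k.+1 (homeo_inv phi)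
  end.

Definition orbit_of (X : topologicalType) (phi : homeomorphism X) (x : X) : set X :=
  range (fun n : int => homeo_iter phi n x).

Section Automorphisms.
Variable R : realType.
Implicit Type phi : homeomorphism (disk R).

(* e^(2 i pi t) *)
Definition expi (t : R) : R[i] := cos (2 * pi * t) +i* sin (2 * pi * t).

Definition conformal_automorphism phi : Prop :=
  exists (t : R) (z0 : R[i]), `|z0| < 1 /\ forall z : disk R,
    set_val (phi z) = expi t * ((set_val z - z0) / (1 - z0^* * set_val z)).

Definition parabolic_with_fixed_point phi (alpha : disk R) : Prop :=
  [/\ conformal_automorphism phi, `|set_val alpha| = 1 &
      forall z : disk R, phi z = z <-> z = alpha].

Definition orbit_transversal phi (D : set (disk R)) : Prop :=
  ~ D (disk1 R) /\
  forall x, x <> disk1 R ->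
    exists! y, D y /\ orbit_of phi x = orbit_of phi y.

End Automorphisms.

Section CrossedProduct.
Variables (R : realType) (phi : homeomorphism (disk R)).

Definition covariant (B : starAlgType R) (iota : starHom (Cdisk R) B) (u : B) :=
  [/\ star u * u = 1, u * star u = 1 &
      forall f : Cdisk R, star u * iota f * u = iota (f \o phi : Cdisk R)].

Definition cstar_generates (B : cstarAlgType R) (G : set B) : Prop :=
  forall S : set B, G `<=` S ->
    S 1 -> (forall a b, S a -> S b -> S (a + b)) ->
    (forall (c : R[i]) a, S a -> S (c *: a)) ->
    (forall a b, S a -> S b -> S (a * b)) -> (forall a, S a -> S (star a)) ->
    (forall (s : nat -> B) l, (forall n, S (s n)) ->
       cnorm (s n - l) @[n --> \oo] --> (0 : R) -> S l) ->
  S = setT.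

(* (B, iota, u) is the universal C*-algebra generated by C(D) and a unitary u
   with u^* f u = f o phi; it is determined up to isomorphism. *)
Definition is_crossed_product (B : cstarAlgType R)
    (iota : starHom (Cdisk R) B) (u : B) : Prop :=
  [/\ covariant iota u,
      cstar_generates (range iota `|` [set u]) &
      forall (B' : cstarAlgType R) (iota' : starHom (Cdisk R) B') (u' : B'),
        covariant iota' u' ->
        exists Phi : starHom B B',
          (forall f, Phi (iota f) = iota' f) /\ Phi u = u'].

End CrossedProduct.

Section Representations.
Variables (R : realType) (B : starAlgType R).

(* *-homomorphisms from B to the bounded operators on H. They need not be
   unital, but irreducible ones are, as they are required to be nonzero. *)
Record starRep (H : hilbertType R) := StarRep {
  rep :> B -> {linear H -> H};
  rep_continuous : forall a, continuous (rep a);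
  repD : forall a b v, rep (a + b) v = rep a v + rep b v;
  repZ : forall (c : R[i]) a v, rep (c *: a) v = c *: rep a v;
  repM : forall a b v, rep (a * b) v = rep a (rep b v);
  rep_star : forall a v w, inner (rep (star a) v) w = inner v (rep a w) }.

Definition closed_invariant (H : hilbertType R) (rho : starRep H) (K : set H) :=
  [/\ closed K, K 0, (forall (c : R[i]) v w, K v -> K w -> K (c *: v + w)) &
      forall a v, K v -> K (rho a v)].

Definition irreducible (H : hilbertType R) (rho : starRep H) : Prop :=
  (exists a v, rho a v <> 0) /\
  forall K, closed_invariant rho K -> K = [set 0] \/ K = setT.

Definition unitarily_equivalent (H1 H2 : hilbertType R)
    (rho1 : starRep H1) (rho2 : starRep H2) : Prop :=
  exists V : {linear H1 -> H2},
    [/\ bijective V, (forall v w, inner (V v) (V w) = inner v w) &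
        forall a v, V (rho1 a v) = rho2 a (V v)].

End Representations.

Section IrrRep.
Variables (R : realType) (phi : homeomorphism (disk R)) (B : cstarAlgType R).
Variables (iota : starHom (Cdisk R) B) (u : B).

(* A representation is determined by the images of the function z |-> z and of
   u, because these generate the crossed product. *)
Definition is_pi_theta (t : R) (rho : starRep B R[i]) : Prop :=
  forall z, rho (iota (Cdisk_id R)) z = z /\ rho u z = expi t * z.

Definition is_pi_point (x : disk R) (rho : starRep B (l2Z R)) : Prop :=
  forall (xi : l2Z R) (n : int),
    rho (iota (Cdisk_id R)) xi n = set_val (homeo_iter phi n x) * xi n /\
    rho u xi n = xi (n - 1).

End IrrRep.

(* Main.v *)
Require Import Defs.
From HB Require Import structures.
From mathcomp Require Import all_boot all_order all_algebra.
From mathcomp Require Import all_classical all_reals all_analysis.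
From mathcomp Require Import complex ring lra zify.
Set Implicit Arguments. Unset Strict Implicit. Unset Printing Implicit Defensive.
Import Order.TTheory GRing.Theory Num.Theory.
Import numFieldNormedType.Exports.
Local Open Scope classical_set_scope.
Local Open Scope complex_scope.
Local Open Scope ring_scope.

(** Write [T f] for the operator of a function [f] and [U] for that of [u] in an
    irreducible representation.

    The dynamics is simple: in the coordinate [1 / (1 - z)] a parabolic map that
    fixes 1 is a nontrivial translation ([parabolic_translation]). Hence orbits
    outside 1 are free and accumulate only at 1, locally uniformly
    ([parabolic_attracts]).

    Two general principles about representations do the work. The first one is
    positivity: [f <= g] implies [T f <= T g], since a nonnegative function has a
    square root in C(D). With the estimate [Cdisk_gram_le] it shows that an
    eigenvector of the coordinate function is a common eigenvector of all
    functions ([fun_eigenvector]); so a representation is determined by the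
    coordinate function and [u]. The second one is that closed invariant subspaces
    are trivial. It shows that two functions with disjoint orbits of supports
    cannot both act nontrivially ([disjoint_orbits]).

    If the coordinate function does not act as the identity, compactness gives a
    point [x] other than 1 in the support of [T] ([support_exists]). By the second
    principle [T] kills the functions that vanish at 1 and on the orbit of [x]
    ([vanish_on_orbit]), so a function isolating [x] in its orbit gives an
    eigenvector with eigenvalue [x] ([support_eigenvector]). Its translates by [U]
    are eigenvectors for the distinct points of the orbit, hence orthogonal, and
    they are total by irreducibility: in this basis the representation is the one
    attached to [x] ([equivalent_pi_point]).

    If the coordinate function acts as the identity, functions act by scalars and
    [U] commutes with everything. A self-adjoint operator with this property is a
    scalar, by an argument with absolute values and kernels
    ([selfadjoint_scalar]), which leads to dimension one.

    Conversely, the representations in the list exist because the bounded operators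
    on a Hilbert space form a C*-algebra, to which the universal property applies
    ([rep_of_covariant]); the eigenvalues of the coordinate function and of [U]
    tell them apart. The passage from generators to the whole algebra needs
    *-representations to be contractive ([rep_le]); like the absolute value, this
    rests on square roots of [1 - b] for self-adjoint [b] in the unit ball of a
    C*-algebra ([cstar_sqrt]). *)

(** * C*-algebras: convergence and square roots *)

Lemma Re_normr (R : realType) (V : normedModType R[i]) (x : V) :
  (complex.Re `|x|)%:C = `|x|.
Proof. by have := normr_ge0 x; case: `|x| => a b; rewrite lecE /= => /andP[/eqP ->]. Qed.

Lemma Re_normc (R : realType) (z : R[i]) : (complex.Re `|z|)%:C = `|z|.
Proof. by []. Qed.

Lemma Re_normcM (R : realType) (z : R[i]) (x : R) :
  (complex.Re `|z| * x)%:C = `|z| * x%:C.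
Proof. by rewrite rmorphM. Qed.

Section StarAlgebras.
Variables (R : realType) (A : starAlgType R).
Implicit Types a b : A.

Lemma star0 : star (0 : A) = 0.
Proof. by apply: (addrI (star 0)); rewrite -starD !addr0. Qed.

Lemma starN a : star (- a) = - star a.
Proof. by apply: (addrI (star a)); rewrite -starD !subrr star0. Qed.

Lemma starB a b : star (a - b) = star a - star b.
Proof. by rewrite starD starN. Qed.

Lemma star1 : star (1 : A) = 1.
Proof. by rewrite -[LHS]mul1r -{1}[1]starK -starM mul1r starK. Qed.

End StarAlgebras.

Section CStarNorm.
Variables (R : realType) (A : cstarAlgType R).
Implicit Types a b : A.

Lemma cnormZr (k : R) a : cnorm (k%:C *: a) = `|k| * cnorm a.
Proof. by apply: complexI; rewrite rmorphM /= cnormZ normc_def /= expr0n addr0 sqrtr_sqr. Qed.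

Lemma cnorm0 : cnorm (0 : A) = 0.
Proof. by rewrite -(scale0r 0) -[0](rmorph0 (real_complex R)) cnormZr normr0 mul0r. Qed.

Lemma cnormN a : cnorm (- a) = cnorm a.
Proof.
by rewrite -scaleN1r -[-1](rmorphN1 (real_complex R)) cnormZr normrN1 mul1r.
Qed.

Lemma cnorm_ge0 a : 0 <= cnorm a.
Proof.
by rewrite -(@pmulrn_lge0 _ _ 2) // mulr2n -{2}cnormN -cnorm0 -(subrr a) cnormD.
Qed.

Lemma cnorm_dist a b c : cnorm (a - c) <= cnorm (a - b) + cnorm (b - c).
Proof. by rewrite -[a - c](subrKA b) cnormD. Qed.

Lemma cnorm_distC a b : cnorm (a - b) = cnorm (b - a).
Proof. by rewrite -cnormN opprB. Qed.

Lemma cnorm1 : cnorm (1 : A) = 1.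
Proof.
have h := cnorm_star (1 : A); rewrite star1 mul1r expr2 in h.
have n0 : cnorm (1 : A) != 0.
  by apply/eqP => /cnorm_eq0/eqP; rewrite oner_eq0.
by apply: (mulfI n0); rewrite mulr1 -h.
Qed.

Lemma cnorm_starE a : cnorm (star a) = cnorm a.
Proof.
suff le b : cnorm b <= cnorm (star b) by apply/eqP; rewrite eq_le -{2}[a]starK !le.
have [b0|b0] := eqVneq (cnorm b) 0; first by rewrite b0 cnorm_ge0.
have bp : 0 < cnorm b by rewrite lt_neqAle eq_sym b0 cnorm_ge0.
by rewrite -(ler_pM2r bp) -expr2 -cnorm_star cnormM.
Qed.

Definition ccvg (s : nat -> A) (l : A) := cnorm (s n - l) @[n --> \oo] --> (0 : R).

Lemma ccvgP s l : ccvg s l <->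
  forall e : R, 0 < e -> exists N, forall n, (N <= n)%N -> cnorm (s n - l) < e.
Proof.
split=> [/cvgrPdist_lt sl e /sl[N _ Ne]|sl].
  by exists N => n /Ne; rewrite sub0r normrN ger0_norm // cnorm_ge0.
apply/cvgrPdist_lt => e /sl[N Ne]; exists N => // n /= /Ne.
by rewrite sub0r normrN ger0_norm // cnorm_ge0.
Qed.

Lemma ccvg_cst a : ccvg (fun=> a) a.
Proof. by apply/ccvgP => e e0; exists 0%N; rewrite subrr cnorm0. Qed.

Lemma ccvg_unique s l l' : ccvg s l -> ccvg s l' -> l = l'.
Proof.
move=> /ccvgP sl /ccvgP sl'; apply/eqP; rewrite -subr_eq0; apply/eqP/cnorm_eq0/eqP.
rewrite eq_le cnorm_ge0 andbT; apply/ler_addgt0Pr => e e0; rewrite add0r.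
have e2 : 0 < e / 2 by rewrite divr_gt0.
have [N Ne] := sl _ e2; have [M Me] := sl' _ e2; pose n := maxn N M.
apply: (le_trans (cnorm_dist _ (s n) _)); rewrite (splitr e) lerD //.
  by rewrite cnorm_distC ltW // Ne // leq_maxl.
by rewrite ltW // Me // leq_maxr.
Qed.

Lemma ccvg_shift s l : ccvg s l -> ccvg (fun n => s n.+1) l.
Proof.
move=> /ccvgP sl; apply/ccvgP => e /sl[N Ne]; exists N => n Nn.
exact/Ne/leqW.
Qed.

Lemma ccvgD s t l m : ccvg s l -> ccvg t m -> ccvg (fun n => s n + t n) (l + m).
Proof.
move=> /ccvgP sl /ccvgP tm; apply/ccvgP => e e0.
have e2 : 0 < e / 2 by rewrite divr_gt0.
have [N Ne] := sl _ e2; have [M Me] := tm _ e2; exists (maxn N M) => n.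
rewrite geq_max => /andP[Nn Mn]; rewrite opprD addrACA.
apply: (le_lt_trans (cnormD _ _)); rewrite (splitr e) ltrD //; [exact: Ne|exact: Me].
Qed.

Lemma ccvg_squeeze s l (h : nat -> R) : (forall n, cnorm (s n - l) <= h n) ->
  h @ \oo --> (0 : R) -> ccvg s l.
Proof.
move=> sh h0; apply: (@squeeze_cvgr _ _ _ _ (fun=> 0) h) => //; last exact: cvg_cst.
by apply: nearW => n; rewrite cnorm_ge0 sh.
Qed.

Lemma ccvg_le s l t m (k : R) : ccvg s l ->
  (forall n, cnorm (t n - m) <= k * cnorm (s n - l)) -> ccvg t m.
Proof.
move=> sl tk; apply: (ccvg_squeeze tk).
by rewrite -(mulr0 k); exact: cvgM (@cvg_cst _ k _ _ _) sl.
Qed.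

Lemma ccvg_star s l : ccvg s l -> ccvg (fun n => star (s n)) (star l).
Proof. by move=> sl; apply: (ccvg_le (k := 1) sl) => n; rewrite mul1r -starB cnorm_starE. Qed.

Lemma ccvgMl s l a : ccvg s l -> ccvg (fun n => a * s n) (a * l).
Proof. by move=> sl; apply: (ccvg_le (k := cnorm a) sl) => n; rewrite -mulrBr cnormM. Qed.

Lemma ccvgMr s l a : ccvg s l -> ccvg (fun n => s n * a) (l * a).
Proof.
by move=> sl; apply: (ccvg_le (k := cnorm a) sl) => n; rewrite -mulrBl mulrC cnormM.
Qed.

Lemma ccvgZ s l (c : R[i]) : ccvg s l -> ccvg (fun n => c *: s n) (c *: l).
Proof.
move=> sl; apply: (ccvg_le (k := complex.Re `|c|) sl) => n.
by rewrite -scalerBr -lecR rmorphM /= cnormZ.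
Qed.

Lemma ccvg_bound s l (M : R) : ccvg s l -> (forall n, cnorm (s n) <= M) -> cnorm l <= M.
Proof.
move=> /ccvgP sl sM; apply/ler_addgt0Pr => e /sl[N Ne].
rewrite -[l]subr0; apply: (le_trans (cnorm_dist _ (s N) _)); rewrite addrC subr0.
by rewrite lerD // cnorm_distC ltW // Ne.
Qed.

Lemma ccvg_mul s t l m (M : R) : ccvg s l -> ccvg t m -> (forall n, cnorm (t n) <= M) ->
  ccvg (fun n => s n * t n) (l * m).
Proof.
move=> sl tm tM.
pose h n := cnorm (s n - l) * M + cnorm l * cnorm (t n - m).
apply: (@ccvg_squeeze _ _ h) => [n|]; last first.
  rewrite (_ : 0 = 0 * M + cnorm l * 0); last by rewrite mul0r mulr0 addr0.
  exact: cvgD (cvgM sl (@cvg_cst _ M _ _ _)) (cvgM (@cvg_cst _ (cnorm l) _ _ _) tm).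
rewrite /h.
have -> : s n * t n - l * m = (s n - l) * t n + l * (t n - m).
  by rewrite mulrBl mulrBr addrA subrK.
apply: (le_trans (cnormD _ _)); rewrite lerD ?cnormM //.
by apply: (le_trans (cnormM _ _)); rewrite ler_wpM2l // cnorm_ge0.
Qed.

End CStarNorm.

Section SquareRoot.
Variable R : realType.

(** Successive approximations of a solution of [y = (b + y * y) / 2]; for such a
    [y], the square of [1 - y] is [1 - b]. *)
Fixpoint sqrt_iter (A : algType R[i]) (b : A) (n : nat) : A :=
  if n is k.+1 then (2^-1 : R)%:C *: (b + sqrt_iter b k * sqrt_iter b k) else 0.

(** The same recursion in the scalars, with [b = 1]. It increases to 1 and
    majorizes both the norms and the increments of [sqrt_iter b] as soon as
    [cnorm b <= 1]: convergence holds up to the boundary of the unit ball,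
    where the recursion is no longer a strict contraction. *)
Fixpoint sqrt_major (n : nat) : R :=
  if n is k.+1 then 2^-1 * (1 + sqrt_major k * sqrt_major k) else 0.

Lemma sqrt_major_itv n : 0 <= sqrt_major n <= 1.
Proof. by elim: n => [|n /andP[r0 r1]] /=; [rewrite lexx ler01|apply/andP; split; nra]. Qed.

Lemma sqrt_major_incr n : sqrt_major n <= sqrt_major n.+1.
Proof.
elim: n => [|n IH]; first by have /andP[] := sqrt_major_itv 1.
rewrite [leLHS]/= [leRHS]/=; have /andP[r0 r1] := sqrt_major_itv n.
rewrite ler_pM2l ?invr_gt0 // lerD2l; apply: ler_pM => //.
Qed.

Variables (A : cstarAlgType R) (b : A).
Hypotheses (bstar : star b = b) (b1 : cnorm b <= 1).
Let y := sqrt_iter b.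

Let y_norm n : cnorm (y n) <= sqrt_major n.
Proof.
elim: n => [|n IH] /=; first by rewrite /y /= cnorm0.
rewrite cnormZr ger0_norm ?invr_ge0 // ler_pM2l ?invr_gt0 //.
apply: (le_trans (cnormD _ _)); rewrite lerD //.
apply: (le_trans (cnormM _ _)); apply: ler_pM => //; exact: cnorm_ge0.
Qed.

Let y_step n : cnorm (y n.+1 - y n) <= sqrt_major n.+1 - sqrt_major n.
Proof.
elim: n => [|n IH]; first by rewrite /= !subr0; exact: y_norm 1%N.
have -> : y n.+2 - y n.+1 = (2^-1)%:C *: (y n.+1 * (y n.+1 - y n) + (y n.+1 - y n) * y n).
  rewrite /y [in LHS]/= -/y -scalerBr; congr (_ *: _).
  rewrite [b + _]addrC addrKA mulrBr mulrBl addrA subrK.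
  by rewrite -/(y n.+1).
(* The decomposition above holds without commutation and has a scalar analogue. *)
rewrite cnormZr ger0_norm ?invr_ge0 //.
have -> : sqrt_major n.+2 - sqrt_major n.+1 =
   2^-1 * (sqrt_major n.+1 * (sqrt_major n.+1 - sqrt_major n)
    + (sqrt_major n.+1 - sqrt_major n) * sqrt_major n) by rewrite /=; ring.
rewrite ler_pM2l ?invr_gt0 //; apply: (le_trans (cnormD _ _)).
rewrite lerD //; apply: (le_trans (cnormM _ _)); apply: ler_pM => //; exact: cnorm_ge0.
Qed.

Let y_dist m n : (m <= n)%N -> cnorm (y n - y m) <= sqrt_major n - sqrt_major m.
Proof.
elim: n => [|n IH]; first by rewrite leqn0 => /eqP ->; rewrite !subrr cnorm0.
rewrite leq_eqVlt => /predU1P[->|/IH h]; first by rewrite !subrr cnorm0.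
apply: (le_trans (cnorm_dist _ (y n) _)).
by rewrite -[leRHS](subrKA (sqrt_major n)); apply: lerD => //; exact: y_step.
Qed.

Let y_cvg : exists l, ccvg y l.
Proof.
have r_cvg : cvgn sqrt_major.
  apply: nondecreasing_is_cvgn; first exact/nondecreasing_seqP/sqrt_major_incr.
  by exists 1 => _ [n _ <-]; have /andP[] := sqrt_major_itv n.
apply: cnorm_complete => e e0.
have e2 : 0 < e / 2 by rewrite divr_gt0.
have /cvgrPdist_lt/(_ _ e2)[N _ Ne] := r_cvg; exists N => m n Nm Nn.
wlog mn : m n Nm Nn / (m <= n)%N.
  by move=> h; case/orP: (leq_total m n) => ?; [|rewrite cnorm_distC]; exact: h.
rewrite cnorm_distC; apply: (le_lt_trans (y_dist mn)).
have := Ne _ Nm; have := Ne _ Nn; rewrite /= !ltr_norml.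
by move=> /andP[? ?] /andP[? ?]; lra.
Qed.

(** The approximations are polynomials in [b], so their limit is self-adjoint and
    commutes with everything that commutes with [b]. *)
Lemma cstar_sqrt : exists c : A, [/\ star c = c, c * c = 1 - b, cnorm (1 - c) <= 1 &
  forall a, a * b = b * a -> a * c = c * a].
Proof.
have [l ycl] := y_cvg; exists (1 - l).
have ny n : cnorm (y n) <= 1.
  by apply: (le_trans (y_norm n)); have /andP[] := sqrt_major_itv n.
have ls : star l = l.
  apply: (ccvg_unique _ ycl).
  rewrite (_ : y = fun n => star (y n)); first exact: ccvg_star.
  apply/funext; elim=> [|n IH]; rewrite /y /= -/y; first by rewrite star0.
  rewrite starZ starD starM bstar -IH; congr (_ *: _).
  by rewrite /Num.conj /= oppr0.
have fix_l : l = (2^-1)%:C *: (b + l * l).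
  apply: (ccvg_unique (ccvg_shift ycl)); apply: ccvgZ; apply: ccvgD; first exact: ccvg_cst.
  exact: (ccvg_mul ycl ycl ny).
split.
- by rewrite starB star1 ls.
- have -> : b = l + l - l * l.
    rewrite {1 2}fix_l -scalerDl -rmorphD /= (_ : 2^-1 + 2^-1 = 1); last by lra.
    by rewrite scale1r addrK.
  by rewrite mulrBr mulr1 mulrBl mul1r -[LHS]addrA -opprD addrA.
- by rewrite opprB addrC subrK; exact: (ccvg_bound ycl ny).
- move=> a ab; rewrite mulrBr mulrBl mulr1 mul1r; congr (_ - _).
  apply: (ccvg_unique (ccvgMl a ycl)).
  rewrite (_ : (fun n => _) = (fun n => y n * a)); first exact: ccvgMr.
  apply/funext; elim=> [|n IH]; rewrite /y /= -/y; first by rewrite mul0r mulr0.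
  rewrite -scalerAl -scalerAr mulrDl mulrDr ab; congr (_ *: (_ + _)).
  by rewrite mulrA IH -mulrA IH mulrA.
Qed.

End SquareRoot.

(** Here [s * s] is the absolute value of [a], and [s] witnesses its positivity.
    With [d] a square root of [1 - a * a], the absolute value is a square root of
    [1 - d * d]; this requires [cnorm d <= 1], which holds because [d] is, up to a
    factor i, half the difference of the unitary [a + i d] and its adjoint. *)
Lemma cstar_abs (R : realType) (A : cstarAlgType R) (a : A) :
  star a = a -> cnorm a <= 1 ->
  exists s : A, [/\ star s = s, (s * s) * (s * s) = a * a &
    forall x, x * a = a * x -> x * s = s * x].
Proof.
have nsq (x : A) : star x = x -> cnorm x <= 1 -> cnorm (x * x) <= 1.
  by move=> xs x1; rewrite -{1}xs cnorm_star expr_le1 // cnorm_ge0.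
have ssq (z : A) : star z = z -> star (z * z) = z * z.
  by move=> zs; rewrite starM zs.
have csq : forall x y : A, x * y = y * x -> x * (y * y) = (y * y) * x.
  by move=> x y xy; rewrite mulrA xy -mulrA xy mulrA.
move=> as_ a1.
have [d [ds dd _ dC]] := cstar_sqrt (ssq _ as_) (nsq _ as_ a1).
have ad : a * d = d * a by apply: dC; rewrite mulrA.
have d1 : cnorm d <= 1.
  have ii : 'i%C * 'i%C = -1 :> R[i] by rewrite -expr2 sqr_i.
  pose u := a + 'i%C *: d.
  have us : star u = a - 'i%C *: d.
    have ic : ('i%C : R[i])^* = - 'i%C by apply/eqP; rewrite eq_complex /= oppr0 !eqxx.
    by rewrite starD starZ as_ ds ic scaleNr.
  have uu : star u * u = 1.
    rewrite us /u mulrDl !mulrDr !mulNr -!scalerAl -!scalerAr scalerA ii.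
    rewrite scaleN1r opprK ad addrA addrK dd.
    by rewrite addrC subrK.
  have u1 : cnorm u = 1.
    apply/eqP; rewrite -(@eqrXn2 _ 2) ?cnorm_ge0 //.
    by rewrite -cnorm_star uu cnorm1 expr1n.
  have dE : 'i%C *: d = (2^-1)%:C *: (u - star u).
    rewrite us /u opprD opprK addrACA subrr add0r -scalerDl scalerA mulrDr -mulrDl.
    by rewrite -rmorphD (_ : 2^-1 + 2^-1 = 1 :> R) ?mul1r //; lra.
  have ni : cnorm d = cnorm ('i%C *: d).
    apply: complexI; rewrite cnormZ; have -> : `|'i%C : R[i]| = 1; last by rewrite mul1r.
    by rewrite normc_def /= expr0n expr1n add0r sqrtr1.
  rewrite {}ni dE cnormZr ger0_norm ?invr_ge0 //.
  have := cnormD u (- star u); rewrite cnormN cnorm_starE u1; lra.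
have [c [cs cc c1 cC]] := cstar_sqrt (ssq _ ds) (nsq _ ds d1).
have [|s [ss sS _ sC]] := @cstar_sqrt _ _ (1 - c) _ c1.
  by rewrite starB star1 cs.
rewrite opprB addrC subrK in sS.
exists s; split=> //; first by rewrite sS cc dd opprB addrC subrK.
move=> x xa; apply: sC; rewrite mulrBl mulrBr mul1r mulr1; congr (_ - _).
exact/cC/csq/dC/csq.
Qed.

(** * Hilbert spaces and *-representations *)

Section HilbertSpace.
Variables (R : realType) (H : hilbertType R).
Implicit Types u v w : H.

Lemma innerDl u v w : inner (u + v) w = inner u w + inner v w.
Proof. exact: linearDl. Qed.
Lemma innerDr u v w : inner u (v + w) = inner u v + inner u w.
Proof. exact: linearDr. Qed.
Lemma innerBl u v w : inner (u - v) w = inner u w - inner v w.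
Proof. exact: linearBl. Qed.
Lemma innerBr u v w : inner u (v - w) = inner u v - inner u w.
Proof. exact: linearBr. Qed.
Lemma innerZl c v w : inner (c *: v) w = c * inner v w.
Proof. exact: linearZl_LR. Qed.
Lemma innerZr c v w : inner v (c *: w) = c^* * inner v w.
Proof. exact: linearZr_LR. Qed.
Lemma inner0l w : inner 0 w = 0.
Proof. exact: linear0l. Qed.
Lemma inner0r w : inner w 0 = 0.
Proof. exact: linear0r. Qed.
Lemma innerC v w : inner v w = Num.conj (inner w v).
Proof. by rewrite [LHS]hermC /= expr0 mul1r. Qed.
Lemma inner_ge0 v : 0 <= inner v v.
Proof. by rewrite -inner_norm exprn_ge0. Qed.
Lemma inner_eq0 v : inner v v = 0 -> v = 0.
Proof. by move/eqP; rewrite -inner_norm expf_eq0 /= => /eqP/normr0_eq0. Qed.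
Lemma inner_suml (I : Type) (r : seq I) (F : I -> H) w :
  inner (\sum_(i <- r) F i) w = \sum_(i <- r) inner (F i) w.
Proof. by elim/big_rec2: _ => [|i y x _ <-]; rewrite ?inner0l ?innerDl. Qed.
Lemma inner_CS v w : `|inner v w| <= `|v| * `|w|.
Proof.
rewrite -ler_sqr ?nnegrE ?mulr_ge0 // exprMn (inner_norm v) (inner_norm w).
exact: dot_CauchySchwarz.
Qed.

Lemma inner_inj v w : (forall x, inner v x = inner w x) -> v = w.
Proof.
move=> vw; apply/eqP; rewrite -subr_eq0; apply/eqP/inner_eq0.
by rewrite innerBl vw subrr.
Qed.

End HilbertSpace.

Lemma bounded_continuous (R : realType) (V W : normedModType R[i]) (f : V -> W) (M : R) :
  (forall v w, `|f v - f w| <= M%:C * `|v - w|) -> continuous f.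
Proof.
move=> fM v; apply/cvgrPdist_lt => e /gt0_Re[]; set d := complex.Re e => d0 ->.
have M1 : 0 < `|M| + 1 by rewrite ltr_wpDl.
have e0 : 0 < (d / (`|M| + 1))%:C :> R[i] by rewrite ltcR divr_gt0.
near=> w; have vw : `|v - w| < (d / (`|M| + 1))%:C.
  by near: w; exact: (@cvgr_dist_lt _ _ _ (nbhs v) _ id v).
apply: (le_lt_trans (fM v w)).
apply: (@le_lt_trans _ _ ((`|M| + 1)%:C * `|v - w|)).
  by rewrite ler_wpM2r // lecR (le_trans (ler_norm M)) // lerDl.
rewrite -ltr_pdivlMl ?ltcR //; apply: (lt_le_trans vw).
by rewrite -fmorphV -rmorphM lecR /= mulrC.
Unshelve. all: by end_near. Qed.

Lemma closed_zero (R : realType) (V W : normedModType R[i]) (f : V -> W) :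
  continuous f -> closed [set v | f v = 0].
Proof.
move=> fc; apply: (@closed_comp _ _ f [set 0]) => [v _|]; first exact: fc.
exact: (accessible_closed_set1 (hausdorff_accessible (@norm_hausdorff _ W))).
Qed.

Lemma inner_continuous (R : realType) (H : hilbertType R) (w : H) :
  continuous (fun v : H => inner v w : R[i]).
Proof.
apply: (@bounded_continuous _ _ _ _ (complex.Re `|w|)) => v v'.
by rewrite -innerBl Re_normr mulrC inner_CS.
Qed.

Lemma seq_limit_unique (R : realType) (V : normedModType R[i]) (s t : nat -> V) (l m : V) :
  (forall n, s n = t n) -> s n @[n --> \oo] --> l -> t n @[n --> \oo] --> m -> l = m.
Proof. by move=> /funext -> sl sm; exact: (cvg_unique _ sl sm). Qed.

Lemma cvg_conj (R : realType) (s : nat -> R[i]) (z : R[i]) :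
  s n @[n --> \oo] --> z -> Num.conj (s n) @[n --> \oo] --> Num.conj z.
Proof. exact: (@continuous_cvg _ _ _ _ _ _ Num.conj _ (@conj_continuous R _)). Qed.

Lemma cvg_inner (R : realType) (H : hilbertType R) (s : nat -> H) (v w : H) :
  s n @[n --> \oo] --> v -> inner (s n) w @[n --> \oo] --> (inner v w : R[i]).
Proof. exact: (continuous_cvg _ (@inner_continuous _ _ w v)). Qed.

Section StarReps.
Variables (R : realType) (B : starAlgType R) (H : hilbertType R) (rho : starRep B H).
Implicit Types (a b : B) (v w : H).

Lemma rep0 v : rho 0 v = 0.
Proof. by rewrite -(scale0r (0 : B)) repZ scale0r. Qed.
Lemma repN a v : rho (- a) v = - rho a v.
Proof. by rewrite -scaleN1r repZ scaleN1r. Qed.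
Lemma repB a b v : rho (a - b) v = rho a v - rho b v.
Proof. by rewrite repD repN. Qed.

Lemma rep_starr a v w : inner (rho a v) w = inner v (rho (star a) w).
Proof. by rewrite -{1}[a]starK rep_star. Qed.

Lemma rep_gram a v : inner (rho (star a * a) v) v = inner (rho a v) (rho a v).
Proof. by rewrite repM rep_star. Qed.

Lemma rep_kernel_closed a : closed [set v | rho a v = 0].
Proof. exact/closed_zero/rep_continuous. Qed.

Hypothesis irr : irreducible rho.

Lemma irreducible_cases (K : set H) : closed_invariant rho K -> K = [set 0] \/ K = setT.
Proof. exact: irr.2. Qed.

(** The kernel of [rho 1] is invariant and contains every [v - rho 1 v]. *)
Lemma irreducible_rep1 v : rho 1 v = v.
Proof.
have [[a [w aw]] cases] := irr.
have [|K0|KT] := cases [set v | rho 1 v = 0].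
- split=> [||c x y /= x0 y0|b x /= x0]; first exact: rep_kernel_closed.
  + exact: raddf0.
  + by rewrite linearP x0 y0 scaler0 addr0.
  + by rewrite -repM mul1r -[b]mulr1 repM x0 linear0.
- have : [set v | rho 1 v = 0] (v - rho 1 v) by rewrite /= raddfB /= -repM mulr1 subrr.
  by rewrite K0 => /eqP; rewrite subr_eq0 => /eqP.
- case: aw; have : [set v | rho 1 v = 0] w by rewrite KT.
  by rewrite -[a]mulr1 repM => /= ->; rewrite linear0.
Qed.

(** The kernel of an operator that commutes with [rho] is closed and invariant. *)
Lemma irreducible_kernel b : (forall a v, rho a (rho b v) = rho b (rho a v)) ->
  (exists2 v, v != 0 & rho b v = 0) -> forall v, rho b v = 0.
Proof.
move=> bC [v v0 bv] w.
have [|K0|KT] := irreducible_cases (K := [set v | rho b v = 0]).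
- split=> [||c x y /= x0 y0|a x /= x0]; first exact: rep_kernel_closed.
  + exact: raddf0.
  + by rewrite linearP x0 y0 scaler0 addr0.
  + by rewrite -bC x0 linear0.
- have : [set v | rho b v = 0] v by [].
  by rewrite K0 => /= v00; rewrite v00 eqxx in v0.
- by have : [set v | rho b v = 0] w by rewrite KT.
Qed.

End StarReps.

Section CStarReps.
Variables (R : realType) (B : cstarAlgType R) (H : hilbertType R) (rho : starRep B H).
Implicit Types (a b : B) (v w : H).

(** [rho 1] is an orthogonal projection. *)
Lemma rep1_le v : inner (rho 1 v) v <= inner v v.
Proof.
rewrite -subr_ge0; have := inner_ge0 (v - rho 1 v).
rewrite innerBl !innerBr -[inner v (rho 1 v)]rep_star star1.
by rewrite -[inner (rho 1 v) (rho 1 v)]rep_gram star1 mul1r subrr subr0.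
Qed.

(** A *-representation is automatically contractive: with [k] the inverse of the
    squared norm of [a], the element [1 - k * star a * a] is the square of a
    self-adjoint element, and [rho] maps it to a positive operator. This is what
    carries properties of generators over to norm limits. *)
Lemma rep_le a v : `|rho a v| <= (cnorm a)%:C * `|v|.
Proof.
have [a0|a0] := eqVneq (cnorm a) 0.
  by rewrite (cnorm_eq0 _ a0) rep0 normr0 cnorm0 mul0r.
have ap : 0 < cnorm a by rewrite lt_neqAle eq_sym a0 cnorm_ge0.
pose k := (cnorm a ^+ 2)^-1.
have [||c [cs cc _ _]] := @cstar_sqrt _ _ (k%:C *: (star a * a)).
- by rewrite starZ starM starK /Num.conj /= oppr0.
- rewrite cnormZr cnorm_star ger0_norm ?mulVf ?expf_neq0 //.
  by rewrite invr_ge0 exprn_ge0 // ltW.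
have := inner_ge0 (rho c v); rewrite -rep_gram cs cc repB repZ innerBl innerZl rep_gram.
rewrite subr_ge0 => le1; rewrite -ler_sqr ?nnegrE ?mulr_ge0 //; last first.
  by rewrite ler0c ltW.
rewrite exprMn (inner_norm v) (inner_norm (rho a v)) mulrC -ler_pdivrMr;
  last by rewrite exprn_gt0 // ltcR.
apply: le_trans (rep1_le v); apply: le_trans le1.
by rewrite /k fmorphV rmorphXn /= mulrC.
Qed.

Lemma ccvg_rep (s : nat -> B) l v : ccvg s l -> rho (s n) v @[n --> \oo] --> rho l v.
Proof.
move=> /ccvgP sl; apply/cvgrPdist_le => e /gt0_Re[]; set d := complex.Re e => d0 ->.
have v1 : 0 < complex.Re `|v| + 1.
  by rewrite ltr_wpDl // -ler0c Re_normr.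
have [|N Ne] := sl (d / (complex.Re `|v| + 1)); first by rewrite divr_gt0.
exists N => // n /Ne /ltW le1; rewrite distrC -repB; apply: (le_trans (rep_le _ _)).
rewrite -Re_normr -rmorphM lecR /=.
apply: (@le_trans _ _ (cnorm (s n - l) * (complex.Re `|v| + 1))).
  by rewrite ler_wpM2l ?cnorm_ge0 // lerDl.
by rewrite -ler_pdivlMr.
Qed.

(** Closure under [star] comes for free once the generators and their adjoints
    have the property. *)
Lemma generated_ind (G P : set B) : cstar_generates G ->
    (forall a, G a -> P a /\ P (star a)) ->
    P 1 -> (forall a b, P a -> P b -> P (a + b)) ->
    (forall (c : R[i]) a, P a -> P (c *: a)) ->
    (forall a b, P a -> P b -> P (a * b)) ->
    (forall (s : nat -> B) l, (forall n, P (s n)) -> ccvg s l -> P l) ->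
  forall a, P a.
Proof.
move=> gen GP P1 PD PZ PM Pl a.
have /seteqP[_ /(_ a I) []] // : (fun a => P a /\ P (star a)) = setT :> set B.
apply: gen => //.
- by rewrite star1.
- by move=> x y [? ?] [? ?]; rewrite starD; split; exact: PD.
- by move=> c x [? ?]; rewrite starZ; split; exact: PZ.
- by move=> x y [? ?] [? ?]; rewrite starM; split; exact: PM.
- by move=> x [? ?]; rewrite starK.
- move=> s l sP sl; split; first by apply: (Pl s) => // n; have [] := sP n.
  by apply: (Pl (fun n => star (s n))) => [n|]; [have [] := sP n|exact: ccvg_star].
Qed.

Lemma rep_invariant_generated (G : set B) (K : set H) : cstar_generates G ->
  closed K -> (forall (c : R[i]) v w, K v -> K w -> K (c *: v + w)) -> K 0 ->
  (forall v, K v -> K (rho 1 v)) ->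
  (forall a, G a -> forall v, K v -> K (rho a v) /\ K (rho (star a) v)) ->
  closed_invariant rho K.
Proof.
move=> gen Kc KL K0 K1 KG; split=> // a.
apply: (generated_ind (P := fun a => forall v, K v -> K (rho a v)) gen) => //.
- by move=> b Gb; split=> v Kv; have [] := KG _ Gb _ Kv.
- move=> b c Kb Kc' v Kv; rewrite repD -[rho b v]scale1r.
  by apply: KL; [exact: Kb|exact: Kc'].
- by move=> c b Kb v Kv; rewrite repZ -[_ *: _]addr0; apply: KL => //; exact: Kb.
- by move=> b c Kb Kc' v Kv; rewrite repM; apply/Kb/Kc'.
- move=> s l sK sl v Kv; apply: (closed_cvg _ Kc _ _ (ccvg_rep (v := v) sl)).
  by apply: nearW => n; exact: sK.
Qed.

Lemma rep_comm_generated (G : set B) b : cstar_generates G ->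
  (forall a, G a -> forall v, rho (a * b) v = rho (b * a) v /\
     rho (star a * b) v = rho (b * star a) v) ->
  forall a v, rho a (rho b v) = rho b (rho a v).
Proof.
move=> gen Gb; apply: (generated_ind gen).
- by move=> a Ga; split=> v; rewrite -!repM; have [] := Gb a Ga v.
- by move=> v; rewrite -!repM mul1r mulr1.
- by move=> a c ac cc v; rewrite !repD ac cc linearD.
- by move=> c a ac v; rewrite !repZ ac linearZ.
- by move=> a c ac cc v; rewrite !repM cc ac.
- move=> s l sc sl v; apply: (cvg_unique _ (ccvg_rep (v := rho b v) sl)) => //.
  rewrite (_ : (fun n => _) = fun n => rho b (rho (s n) v)); last exact/funext.
  by apply: continuous_cvg; [exact: rep_continuous|exact: ccvg_rep].
Qed.

End CStarReps.

Lemma rep_intertwined_generated (R : realType) (B : cstarAlgType R)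
    (H1 H2 : hilbertType R) (rho1 : starRep B H1) (rho2 : starRep B H2) (G : set B)
    (V : {linear H1 -> H2}) : cstar_generates G -> continuous V ->
  (forall v, V (rho1 1 v) = rho2 1 (V v)) ->
  (forall a, G a -> forall v, V (rho1 a v) = rho2 a (V v) /\
     V (rho1 (star a) v) = rho2 (star a) (V v)) ->
  forall a v, V (rho1 a v) = rho2 a (V v).
Proof.
move=> gen Vc V1 VG; apply: (generated_ind gen) => //.
- by move=> a Ga; split=> v; have [] := VG a Ga v.
- by move=> a b ae be v; rewrite !repD linearD ae be.
- by move=> c a ae v; rewrite !repZ linearZ ae.
- by move=> a b ae be v; rewrite !repM ae be.
- move=> s l se sl v.
  have c1 : V (rho1 (s n) v) @[n --> \oo] --> V (rho1 l v).
    by apply: continuous_cvg; [exact: Vc|exact: ccvg_rep].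
  exact: (seq_limit_unique _ c1 (ccvg_rep (v := V v) sl)).
Qed.

(** * The C*-algebra of bounded operators *)

Section BoundedOperators.
Variables (R : realType) (H : hilbertType R).
Implicit Types (S T : H -> H) (v w : H).

Definition adjoint_of T S := forall v w, inner (T v) w = inner v (S w).

Definition bounded_by (M : R) T := forall v, `|T v| <= M%:C * `|v|.

(** An everywhere defined adjoint forces linearity, so that an adjoint and a
    bound are all that has to be asked. *)
Definition bounded_op_pred : {pred H -> H} :=
  [pred T | `[< exists S M, adjoint_of T S /\ bounded_by M T >]].

Lemma adjoint_sym T S : adjoint_of T S -> adjoint_of S T.
Proof. by move=> TS v w; rewrite innerC -TS -innerC. Qed.

Lemma adjoint_uniq T S S' : adjoint_of T S -> adjoint_of T S' -> S = S'.
Proof.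
move=> TS TS'; apply/funext => v; apply: inner_inj => w.
by rewrite (adjoint_sym TS) (adjoint_sym TS').
Qed.

Lemma adjoint_linear T S : adjoint_of T S -> linear T.
Proof.
by move=> TS c v w; apply: inner_inj => x; rewrite TS !innerDl !innerZl !TS.
Qed.

Lemma adjoint_bounded T S M : adjoint_of T S -> bounded_by M T -> bounded_by M S.
Proof.
move=> TS TM w; have [->|S0] := eqVneq (S w) 0.
  by rewrite normr0; apply: le_trans (TM w).
have Sp : 0 < `|S w| by rewrite normr_gt0.
rewrite -(ler_pM2r Sp) -expr2 inner_norm -TS mulrAC.
rewrite -[inner _ _]ger0_norm; last by rewrite TS inner_ge0.
by apply: (le_trans (inner_CS _ _)); rewrite ler_wpM2r.
Qed.

Lemma bounded_by_ge0 T M v : bounded_by M T -> v != 0 -> 0 <= M.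
Proof.
move=> TM v0; have := le_trans (normr_ge0 _) (TM v).
by rewrite pmulr_lge0 ?normr_gt0 // ler0c.
Qed.

Lemma bounded_op_closed : submod_closed bounded_op_pred.
Proof.
split=> [|c T T' /asboolP[S [M [TS TM]]] /asboolP[S' [M' [TS' TM']]]].
  apply/asboolP; exists 0, 0; split=> v; first by move=> w; rewrite inner0l inner0r.
  by rewrite normr0 mul0r.
apply/asboolP; exists (fun v => c^* *: S v + S' v), (complex.Re `|c| * M + M').
split=> v; first by move=> w; rewrite innerDl innerZl TS TS' innerDr innerZr conjCK.
apply: (le_trans (ler_normD _ _)); rewrite normrZ rmorphD rmorphM /= mulrDl lerD //.
by rewrite -mulrA ler_wpM2l.
Qed.

HB.instance Definition _ :=
  GRing.isSubmodClosed.Build R[i] (H -> H) bounded_op_pred bounded_op_closed.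

End BoundedOperators.

(** The witness [nt] makes the unit operator nonzero, and bounds from below the
    sets of admissible constants of which the norm is the infimum. *)
Record bounded_op (R : realType) (H : hilbertType R) (nt : exists v : H, v != 0) :=
  BoundedOp { op_val :> H -> H; _ : op_val \in @bounded_op_pred R H }.

Section OperatorAlgebra.
Variables (R : realType) (H : hilbertType R) (nt : exists v : H, v != 0).
Local Notation bounded_op := (bounded_op nt).
Local Notation BoundedOp := (@BoundedOp R H nt).
Implicit Types (S T : H -> H) (v w : H).

HB.instance Definition _ := [isSub for @op_val R H nt].
HB.instance Definition _ := [Choice of bounded_op by <:].
HB.instance Definition _ := [SubChoice_isSubLmodule of bounded_op by <:].

Implicit Types A C : bounded_op.

Lemma bounded_op_eq A C : (forall v, A v = C v) -> A = C.
Proof. by move=> AC; apply/val_inj/funext. Qed.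

Lemma op_adjoint_subproof A : exists S, adjoint_of A S.
Proof. by case: A => T /= /asboolP[S [M [TS _]]]; exists S. Qed.

Definition op_adjoint A : H -> H := projT1 (cid (op_adjoint_subproof A)).

Lemma op_adjointP A : adjoint_of A (op_adjoint A).
Proof. exact: projT2 (cid (op_adjoint_subproof A)). Qed.

Lemma op_linear A : linear A.
Proof. exact: adjoint_linear (op_adjointP A). Qed.

Lemma op0 A : A 0 = 0.
Proof.
by have := op_linear A (-1) 0 0; rewrite scaler0 add0r scaleN1r addNr.
Qed.

Lemma op_bounded A : exists M, bounded_by M A.
Proof. by case: A => T /= /asboolP[S [M [_ TM]]]; exists M. Qed.

Lemma op_starP A : op_adjoint A \in @bounded_op_pred R H.
Proof.
have [M AM] := op_bounded A; apply/asboolP; exists A, M.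
split; first exact/adjoint_sym/op_adjointP.
exact: adjoint_bounded (op_adjointP A) AM.
Qed.

Definition op_star A : bounded_op := BoundedOp (op_starP A).

Lemma op_oneP : (id : H -> H) \in @bounded_op_pred R H.
Proof. by apply/asboolP; exists id, 1; split=> // v; rewrite mul1r. Qed.

Definition op_one : bounded_op := BoundedOp op_oneP.

Lemma op_mulP A C : (A \o C : H -> H) \in @bounded_op_pred R H.
Proof.
have [M AM] := op_bounded A; have [N CN] := op_bounded C.
apply/asboolP; exists (op_adjoint C \o op_adjoint A), (M * N); split=> [v w|v] /=.
  by rewrite (op_adjointP A) (op_adjointP C).
have [->|v0] := eqVneq v 0; last first.
  apply: (le_trans (AM _)); rewrite rmorphM -mulrA ler_wpM2l // ?CN //.
  have [Cv0|Cv0] := eqVneq (C v) 0; last by rewrite ler0c; exact: bounded_by_ge0 AM Cv0.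
  by rewrite ler0c; exact: bounded_by_ge0 AM v0.
by rewrite !op0 normr0 mulr0.
Qed.

Definition op_mul A C : bounded_op := BoundedOp (op_mulP A C).

Lemma op_mulA : associative op_mul.
Proof. by move=> A C E; exact: bounded_op_eq. Qed.
Lemma op_mul1 : left_id op_one op_mul.
Proof. by move=> A; exact: bounded_op_eq. Qed.
Lemma op_mulr1 : right_id op_one op_mul.
Proof. by move=> A; exact: bounded_op_eq. Qed.
Lemma op_mulDl : left_distributive op_mul +%R.
Proof. by move=> A C E; exact: bounded_op_eq. Qed.
Lemma op_mulDr : right_distributive op_mul +%R.
Proof.
move=> A C E; apply: bounded_op_eq => v.
by have := op_linear A 1 (C v) (E v); rewrite !scale1r.
Qed.
Lemma op_1neq0 : op_one != 0.
Proof.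
have [v v0] := nt; apply: contra_neq v0 => e.
by rewrite -[v]/(op_val op_one v) e.
Qed.

HB.instance Definition _ := GRing.Zmodule_isNzRing.Build bounded_op
  op_mulA op_mul1 op_mulr1 op_mulDl op_mulDr op_1neq0.

Lemma op_scaleAl (c : R[i]) A C : c *: (A * C) = (c *: A) * C.
Proof. exact: bounded_op_eq. Qed.
HB.instance Definition _ := GRing.Lmodule_isLalgebra.Build R[i] bounded_op op_scaleAl.
Lemma op_scaleAr (c : R[i]) A C : c *: (A * C) = A * (c *: C).
Proof.
apply: bounded_op_eq => v.
by have := op_linear A c (C v) 0; rewrite op0 !addr0.
Qed.
HB.instance Definition _ := GRing.Lalgebra_isAlgebra.Build R[i] bounded_op op_scaleAr.

Lemma op_star_uniq A (S : bounded_op) : adjoint_of A (op_val S) -> op_star A = S.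
Proof. by move=> AS; apply/val_inj; exact: adjoint_uniq (op_adjointP A) AS. Qed.

Lemma op_starK : involutive op_star.
Proof. by move=> A; apply: op_star_uniq; exact/adjoint_sym/op_adjointP. Qed.
Lemma op_starD A C : op_star (A + C) = op_star A + op_star C.
Proof.
apply: op_star_uniq => v w.
by rewrite [LHS]innerDl !op_adjointP [RHS]innerDr.
Qed.
Lemma op_starZ (c : R[i]) A : op_star (c *: A) = c^* *: op_star A.
Proof.
apply: op_star_uniq => v w.
by rewrite [LHS]innerZl op_adjointP [RHS]innerZr conjCK.
Qed.
Lemma op_starM A C : op_star (A * C) = op_star C * op_star A.
Proof.
apply: op_star_uniq => v w; rewrite -[LHS]/(inner (A (C v)) w).
by rewrite (op_adjointP A) (op_adjointP C).
Qed.

HB.instance Definition _ := isStarAlgebra.Build R bounded_op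
  op_starK op_starD op_starZ op_starM.

Definition op_norm A : R := inf [set M | bounded_by M A].

Lemma op_norm_has_inf A : has_inf [set M | bounded_by M A].
Proof.
split; first by have [M AM] := op_bounded A; exists M.
have [v v0] := nt; exists 0 => M AM; exact: bounded_by_ge0 AM v0.
Qed.

Lemma op_norm_le A M : bounded_by M A -> op_norm A <= M.
Proof. by move=> AM; apply: ge_inf => //; have [] := op_norm_has_inf A. Qed.

Lemma op_normP A : bounded_by (op_norm A) A.
Proof.
move=> v; have [->|v0] := eqVneq v 0.
  by rewrite op0 normr0 mulr0.
have vp : 0 < complex.Re `|v| by rewrite -ltcR Re_normr normr_gt0.
rewrite -(Re_normr v) -(Re_normr (A v)) -rmorphM lecR -ler_pdivrMr //.
apply: lb_le_inf => [|M AM]; first by have [] := op_norm_has_inf A.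
by rewrite ler_pdivrMr // -lecR rmorphM /= !Re_normr.
Qed.

Lemma op_norm_ge0 A : 0 <= op_norm A.
Proof. by have [v v0] := nt; exact: bounded_by_ge0 (op_normP A) v0. Qed.

Lemma op_norm_eq0 A : op_norm A = 0 -> A = 0.
Proof.
move=> A0; apply: bounded_op_eq => v; apply/eqP; rewrite -normr_le0.
by have := op_normP A v; rewrite A0 mul0r.
Qed.

Lemma op_normD A C : op_norm (A + C) <= op_norm A + op_norm C.
Proof.
apply: op_norm_le => v; apply: (le_trans (ler_normD _ _)).
by rewrite rmorphD mulrDl lerD // op_normP.
Qed.

Lemma op_normM A C : op_norm (A * C) <= op_norm A * op_norm C.
Proof.
apply: op_norm_le => v; apply: (le_trans (op_normP A (C v))).
by rewrite rmorphM -mulrA ler_wpM2l ?op_normP // ler0c op_norm_ge0.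
Qed.

Lemma op_normZ_le (c : R[i]) A : op_norm (c *: A) <= complex.Re `|c| * op_norm A.
Proof.
apply: op_norm_le => v; rewrite [X in `|X|](_ : _ = c *: A v) // normrZ Re_normcM -mulrA.
by rewrite ler_wpM2l ?op_normP.
Qed.

Lemma op_normZ (c : R[i]) A : (op_norm (c *: A))%:C = `|c| * (op_norm A)%:C.
Proof.
rewrite -Re_normcM; congr (_%:C); apply/eqP; rewrite eq_le op_normZ_le.
have [->|c0] := eqVneq c 0; first by rewrite normr0 mul0r op_norm_ge0.
have cp : 0 < complex.Re `|c| by rewrite -ltcR Re_normc normr_gt0.
have := op_normZ_le c^-1 (c *: A); rewrite scalerA mulVf // scale1r.
have -> : complex.Re `|c^-1| = (complex.Re `|c|)^-1.
  by apply: complexI; rewrite fmorphV /= !Re_normc normfV.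
by rewrite mulrC ler_pdivlMr // mulrC.
Qed.

(** The squared norm of [A v] is the inner product of [op_star A (A v)] and [v], to
    which the inequality of Cauchy and Schwarz applies. *)
Lemma op_norm_star A : op_norm (op_star A * A) = op_norm A ^+ 2.
Proof.
apply/eqP; rewrite eq_le; apply/andP; split.
  apply: (le_trans (op_normM _ _)); rewrite expr2 ler_wpM2r ?op_norm_ge0 //.
  by apply: op_norm_le; exact: adjoint_bounded (op_adjointP A) (op_normP A).
set N := op_norm (op_star A * A); have N0 : 0 <= N := op_norm_ge0 _.
rewrite -[leRHS]sqr_sqrtr // ler_sqr ?nnegrE ?sqrtr_ge0 ?op_norm_ge0 //.
apply: op_norm_le => v; rewrite -ler_sqr ?nnegrE ?mulr_ge0 ?ler0c ?sqrtr_ge0 //.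
rewrite exprMn -rmorphXn /= sqr_sqrtr // (inner_norm (A v)) op_adjointP.
rewrite -[inner _ _]ger0_norm; last by rewrite -op_adjointP inner_ge0.
apply: (le_trans (inner_CS _ _)); rewrite mulrC expr2 mulrA ler_wpM2r //.
exact: (op_normP (op_star A * A)).
Qed.

(** Limits are pointwise. The adjoints form a Cauchy sequence as well, and their
    pointwise limit is the adjoint of the limit. *)
Lemma op_norm_complete (s : nat -> bounded_op) :
  (forall e, 0 < e -> exists N, forall m n,
     (N <= m)%N -> (N <= n)%N -> op_norm (s m - s n) < e) ->
  exists l, op_norm (s n - l) @[n --> \oo] --> (0 : R).
Proof.
move=> sC.
have op_le A v (e : R) : op_norm A <= e -> `|A v| <= e%:C * `|v|.
  by move=> Ae; apply: (le_trans (op_normP A v)); rewrite ler_wpM2r // lecR.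
have pt_cvg (t : nat -> bounded_op) v :
    (forall e, 0 < e -> exists N, forall m n,
      (N <= m)%N -> (N <= n)%N -> op_norm (t m - t n) < e) -> cvgn (fun n => t n v).
  move=> tC; apply: cauchy_cvg; apply/cauchyP => e /gt0_Re[]; set d := complex.Re e => d0 ->.
  have v1 : 0 < complex.Re `|v| + 1 by rewrite ltr_wpDl // -ler0c Re_normr.
  have [|N Ne] := tC (d / (complex.Re `|v| + 1)); first by rewrite divr_gt0.
  exists (t N v); rewrite -ball_normE.
  exists N => // n /= Nn; apply: (le_lt_trans (op_le (t N - t n) v _ (ltW (Ne _ _ _ Nn)))) => //.
  rewrite -Re_normr -rmorphM ltcR /= mulrAC ltr_pdivrMr // ltr_pM2l //.
  by rewrite ltrDl.
have scvg v := pt_cvg s v sC.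
have dcvg v : cvgn (fun n => op_star (s n) v).
  apply: (pt_cvg (fun n => op_star (s n))) => e /sC[N Ne]; exists N => m n Nm Nn.
  rewrite (_ : _ - _ = op_star (s m - s n)); last exact/esym/starB.
  apply: le_lt_trans (Ne _ _ Nm Nn).
  by apply: op_norm_le; exact: adjoint_bounded (op_adjointP _) (op_normP _).
pose T v := limn (fun n => s n v); pose S v := limn (fun n => op_star (s n) v).
have TS : adjoint_of T S.
  move=> v w.
  have h1 : inner (s n v) w @[n --> \oo] --> (inner (T v) w : R[i]).
    exact/cvg_inner/scvg.
  have h2 : inner (op_star (s n) w) v @[n --> \oo] --> (inner (S w) v : R[i]).
    exact/cvg_inner/dcvg.
  rewrite [RHS]innerC; apply: (seq_limit_unique _ h1 (cvg_conj h2)) => n.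
  by rewrite -innerC op_adjointP.
have T_le (e : R) N : (forall n, (N <= n)%N -> op_norm (s N - s n) <= e) ->
    forall v, `|s N v - T v| <= e%:C * `|v|.
  move=> Ne v.
  have h : `|s N v - s n v| @[n --> \oo] --> `|s N v - T v|.
    by apply: cvg_norm; apply: cvgB; [exact: cvg_cst|exact: scvg].
  apply: (lim_le_complex h); exists N => // n /= /Ne; exact: op_le.
have [N0 N0e] := sC _ ltr01.
have [M NM] := op_bounded (s N0).
have TB : bounded_by (M + 1) T.
  move=> v; rewrite -[T v](subrK (s N0 v)) addrC.
  apply: (le_trans (ler_normD _ _)); rewrite rmorphD mulrDl lerD ?NM //.
  by rewrite distrC; apply: T_le => n Nn; exact/ltW/N0e.
have Tp : T \in @bounded_op_pred R H by apply/asboolP; exists S, (M + 1).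
exists (BoundedOp Tp); apply/cvgrPdist_le => e /sC[N Ne]; exists N => // n /= Nn.
rewrite sub0r normrN ger0_norm ?op_norm_ge0 //; apply: op_norm_le => v.
by apply: T_le => m nm; rewrite ltW // Ne // (leq_trans Nn).
Qed.

HB.instance Definition _ := StarAlgebra_isCStarAlgebra.Build R bounded_op
  op_norm_eq0 op_normD op_normZ op_normM op_norm_star op_norm_complete.

End OperatorAlgebra.

(** * Representations of the crossed product *)

HB.instance Definition _ (R : realType) (H : hilbertType R) (nt : exists v : H, v != 0)
    (A : bounded_op nt) :=
  GRing.isLinear.Build R[i] H H *:%R (op_val A) (op_linear A).

Section RepOfHom.
Variables (R : realType) (B : starAlgType R) (H : hilbertType R).
Variables (nt : exists v : H, v != 0) (Phi : starHom B (bounded_op nt)).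

Lemma op_continuous (A : bounded_op nt) : continuous A.
Proof.
have [M AM] := op_bounded A; apply: (@bounded_continuous _ _ _ _ M) => v w.
by rewrite -raddfB; exact: AM.
Qed.

Lemma rep_of_hom_star a v w : inner (Phi (star a) v) w = inner v (Phi a w).
Proof.
by rewrite star_homS; exact: (adjoint_sym (op_adjointP (Phi a))).
Qed.

Definition rep_of_hom : starRep B H.
Proof.
apply: (@StarRep _ _ _ (fun a => op_val (Phi a) : {linear H -> H})).
- by move=> a; exact: op_continuous.
- by move=> a b v; rewrite rmorphD.
- by move=> c a v; rewrite linearZ.
- by move=> a b v; rewrite rmorphM.
- exact: rep_of_hom_star.
Defined.

End RepOfHom.

Section CovariantPairs.
Variables (R : realType) (phi : homeomorphism (disk R)) (B : cstarAlgType R).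
Variables (iota : starHom (Cdisk R) B) (u : B).
Hypothesis crossed : is_crossed_product phi iota u.
Variables (H : hilbertType R) (t : Cdisk R -> H -> H) (U V : H -> H).
Hypotheses (nt : exists v : H, v != 0)
  (t_bounded : forall f, exists M, bounded_by M (t f))
  (t_star : forall f, adjoint_of (t f) (t (star f)))
  (tD : forall f g v, t (f + g) v = t f v + t g v)
  (tZ : forall (c : R[i]) f v, t (c *: f) v = c *: t f v)
  (tM : forall f g v, t (f * g) v = t f (t g v))
  (t1 : forall v, t 1 v = v)
  (UV : adjoint_of U V) (UK : cancel U V) (VK : cancel V U)
  (UtU : forall (f : Cdisk R) v, V (t f (U v)) = t (f \o phi : Cdisk R) v).

Let t_op f : t f \in @bounded_op_pred R H.
Proof. by have [M tM'] := t_bounded f; apply/asboolP; exists (t (star f)), M. Qed.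

Let tau f : bounded_op nt := BoundedOp nt (t_op f).

Let tau_linear : linear tau.
Proof. by move=> c f g; apply: bounded_op_eq => v; rewrite /= tD tZ. Qed.

Let tau_multiplicative : multiplicative tau.
Proof.
by split=> [f g|]; apply: bounded_op_eq => v /=; [exact: tM|exact: t1].
Qed.

Let tau_hom : {lrmorphism Cdisk R -> bounded_op nt} :=
  HB.pack tau (GRing.isLinear.Build _ _ _ _ tau tau_linear)
    (GRing.isMultiplicative.Build _ _ tau tau_multiplicative).

Let tau_star f : tau_hom (star f) = star (tau_hom f).
Proof. by symmetry; apply: op_star_uniq => v w; exact: t_star. Qed.

Let U_op : U \in @bounded_op_pred R H.
Proof.
apply/asboolP; exists V, 1; split=> // v.
by rewrite mul1r -ler_sqr ?nnegrE // (inner_norm (U v)) (inner_norm v) UV UK.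
Qed.

Let Uop : bounded_op nt := BoundedOp nt U_op.

Let Uop_star v : star Uop v = V v.
Proof.
by rewrite (_ : op_val (star Uop) = V) //; exact: adjoint_uniq (op_adjointP Uop) UV.
Qed.

(** The bounded operators on [H] are a C*-algebra, to which the universal
    property applies. *)
Lemma rep_of_covariant : exists rho : starRep B H,
  (forall f v, rho (iota f) v = t f v) /\ (forall v, rho u v = U v).
Proof.
have [_ _ univ] := crossed.
have [|Phi [Phif Phiu]] := univ (bounded_op nt) (StarHom tau_star) Uop.
  split=> [||f]; apply: bounded_op_eq => v.
  - by rewrite -[LHS]/(star Uop (U v)) Uop_star UK.
  - by rewrite -[LHS]/(U (star Uop v)) Uop_star VK.
  - by rewrite -[LHS]/(star Uop (t f (U v))) Uop_star UtU.
exists (rep_of_hom Phi); split=> [f v|v] /=; first by rewrite Phif.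
by rewrite Phiu.
Qed.

End CovariantPairs.

Section Generators.
Variables (R : realType) (phi : homeomorphism (disk R)) (B : cstarAlgType R).
Variables (iota : starHom (Cdisk R) B) (u : B).
Hypothesis crossed : is_crossed_product phi iota u.

Lemma crossed_uu : star u * u = 1.
Proof. by case: crossed => -[]. Qed.
Lemma crossed_uus : u * star u = 1.
Proof. by case: crossed => -[]. Qed.
Lemma crossed_shift (f : Cdisk R) : iota f * u = u * iota (f \o phi : Cdisk R).
Proof.
by case: crossed => -[_ _ <-] _ _; rewrite !mulrA crossed_uus mul1r.
Qed.

Variables (H : hilbertType R).
Implicit Types (rho : starRep B H).

Lemma crossed_invariant rho (K : set H) :
  closed K -> (forall (c : R[i]) v w, K v -> K w -> K (c *: v + w)) -> K 0 ->
  (forall f v, K v -> K (rho (iota f) v)) ->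
  (forall v, K v -> K (rho u v) /\ K (rho (star u) v)) ->
  closed_invariant rho K.
Proof.
move=> Kc KL K0 Kf Ku.
have [_ gen _] := crossed.
apply: (rep_invariant_generated gen) => // [v Kv|a].
  by rewrite -(rmorph1 iota); exact: Kf.
case=> [[f _ <-]|->] v Kv; last exact: Ku.
by rewrite -star_homS; split; exact: Kf.
Qed.

Lemma crossed_commute rho b :
  (forall f v, rho (iota f * b) v = rho (b * iota f) v) ->
  u * b = b * u -> star u * b = b * star u ->
  forall a v, rho a (rho b v) = rho b (rho a v).
Proof.
move=> bf bu bs; have [_ gen _] := crossed.
apply: (rep_comm_generated gen) => a [[f _ <-]|->] v; last by rewrite bu bs.
by rewrite -star_homS.
Qed.

End Generators.

Lemma crossed_intertwined (R : realType) (phi : homeomorphism (disk R)) (B : cstarAlgType R)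
    (iota : starHom (Cdisk R) B) (u : B) (H1 H2 : hilbertType R)
    (rho1 : starRep B H1) (rho2 : starRep B H2) (V : {linear H1 -> H2}) :
  is_crossed_product phi iota u -> continuous V ->
  (forall f v, V (rho1 (iota f) v) = rho2 (iota f) (V v)) ->
  (forall v, V (rho1 u v) = rho2 u (V v)) ->
  (forall v, V (rho1 (star u) v) = rho2 (star u) (V v)) ->
  forall a v, V (rho1 a v) = rho2 a (V v).
Proof.
move=> [_ gen _] Vc Vf Vu Vs; apply: (rep_intertwined_generated gen) => // [v|a].
  by rewrite -(rmorph1 iota) Vf.
by case=> [[f _ <-]|->] v; rewrite -?star_homS.
Qed.

Lemma crossed_rep_eq (R : realType) (phi : homeomorphism (disk R)) (B : cstarAlgType R)
    (iota : starHom (Cdisk R) B) (u : B) (H : hilbertType R) (rho rho' : starRep B H) :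
  is_crossed_product phi iota u ->
  (forall f v, rho (iota f) v = rho' (iota f) v) ->
  (forall v, rho u v = rho' u v) -> forall a v, rho a v = rho' a v.
Proof.
move=> crossed ef eu; apply: (crossed_intertwined (V := idfun : {linear H -> H}) crossed) => //.
  by move=> v; exact: cvg_id.
by move=> v; apply: inner_inj => w; rewrite !rep_star eu.
Qed.

(** * Continuous functions on the disk *)

Section DiskTopology.
Variable R : realType.
Implicit Types (z p : disk R) (f g : Cdisk R).

Lemma nbhs_diskP p (N : set (disk R)) : nbhs p N ->
  exists C : set R[i], [/\ open C, C (set_val p) & forall z, C (set_val z) -> N z].
Proof.
rewrite nbhsE; case=> O [[C Co CO] Op] ON; exists C; split=> //.
  by rewrite -[C _]/((set_val @^-1` C) p) CO.
by move=> z Cz; apply: ON; rewrite -CO.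
Qed.

Lemma Cdisk_near f p (e : R) : 0 < e -> exists2 d : R, 0 < d &
  forall z, `|set_val z - set_val p| < d%:C -> `|f z - f p| < e%:C.
Proof.
move=> e0; have ec : 0 < e%:C :> R[i] by rewrite ltcR.
have /nbhs_diskP[C [Co Cp CN]] : nbhs p [set z | `|f p - f z| < e%:C].
  have fc : f z @[z --> p] --> f p := @cts_fun _ _ f p.
  exact: (@cvgr_dist_lt _ _ _ (nbhs p) (nbhs_filter p) f (f p) fc _ ec).
have /nbhs_ballP[d /gt0_Re[d0 dE] dC] : nbhs (set_val p : R[i]) C by exact: open_nbhs_nbhs.
exists (complex.Re d) => // z; rewrite -dE distrC => zp.
by rewrite distrC; apply: CN; apply: dC.
Qed.

Lemma Re_norm_continuous : continuous (fun z : R[i] => complex.Re `|z| : R).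
Proof.
move=> z; have /cvg_complexP[] // : `|w| @[w --> z] --> `|z|.
exact: (@norm_continuous _ R[i]).
Qed.

Lemma Re_continuous : continuous (fun z : R[i] => complex.Re z : R).
Proof. by move=> z; have /cvg_complexP[] := @cvg_id _ (nbhs z). Qed.

Lemma fmap_ultra (T U : Type) (h : T -> U) (F : set_system T) :
  UltraFilter F -> UltraFilter (h @ F).
Proof.
move=> FU; split; first exact: fmap_proper_filter.
move=> G GF FG; apply/seteqP; split=> [A GA|]; last exact: FG.
have [//|FA] := in_ultra_setVsetC (h @^-1` A) FU.
have [x []] // := filter_ex (filterI GA (FG (~` A) FA)).
Qed.

(** The two coordinates push an ultrafilter on the disk to ultrafilters on a
    compact segment, and the limits of these are the coordinates of its limit. *)
Lemma disk_compact : compact [set: disk R].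
Proof.
rewrite compact_ultra => F FU _.
have part (g : R[i] -> R) : (forall w, `|g w|%:C <= `|w|) ->
    exists a : R, g (set_val z) @[z --> F] --> a.
  move=> gz; have := @segment_compact R (-1) 1; rewrite compact_ultra.
  move=> /(_ ((fun z : disk R => g (set_val z)) @ F) (fmap_ultra _ FU)) [|a [_ ?]];
    last by exists a.
  apply: (@filterS _ F _ setT); last exact: filterT.
  move=> z _ /=; rewrite in_itv /= -ler_norml -lecR.
  apply: (le_trans (gz _)); have := valP z; rewrite inE; exact.
have [a Fa] := part (fun w => complex.Re w) (@normr_Re R).
have [b Fb] := part (fun w => complex.Im w) (@normr_Im R).
have Fab : set_val z @[z --> F] --> (a +i* b : R[i]) by apply/cvg_complexP.
have ab : a +i* b \in disk R.
  rewrite inE /disk /=; rewrite -Re_normc lecR.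
  have Fn : complex.Re `|set_val z : R[i]| @[z --> F] --> complex.Re `|a +i* b|.
    exact: (continuous_cvg _ (@Re_norm_continuous _) Fab).
  apply: (closed_cvg _ (@closed_le R 1) _ _ Fn).
  apply: nearW => z /=; rewrite -lecR Re_normc.
  by have := valP z; rewrite inE; exact.
exists (exist _ (a +i* b) ab : disk R); split=> // N /nbhs_diskP[C [Co Cp CN]].
have : F (set_val @^-1` C) by apply: Fab; exact: open_nbhs_nbhs.
by apply: filterS => z /CN.
Qed.

Lemma Cdisk_bounded f : exists M : R, forall z, `|f z| <= M%:C.
Proof.
have gc : continuous (fun z => complex.Re `|f z|).
  move=> z; exact: continuous_comp (@cts_fun _ _ f z) (@Re_norm_continuous (f z)).
have [|c _ fc] := compact_EVT_max _ disk_compact (continuous_subspaceT gc).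
  by exists (disk1 R).
by exists (complex.Re `|f c|) => z; rewrite -Re_normc lecR fc ?inE.
Qed.

Definition Cdisk_real (r : R -> R) (rc : continuous r) f : Cdisk R.
Proof.
apply: (@mkcts _ _ (fun z => (r (complex.Re (f z)))%:C)) => z.
have h : r (complex.Re (f w)) @[w --> z] --> r (complex.Re (f z)).
  have h := continuous_comp (@cts_fun _ _ f z) (@Re_continuous (f z)).
  exact: continuous_comp h (rc _).
apply/(@cvg_complexP _ _ (nbhs z) _); split; first exact: h.
exact: (@cvg_cst _ (0 : R) _ (nbhs z) _).
Defined.

Lemma Cdisk_realE r (rc : continuous r) f z :
  Cdisk_real rc f z = (r (complex.Re (f z)))%:C.
Proof. by []. Qed.

Lemma pos_part_continuous (k c : R) : continuous (fun y : R => Num.max 0 (k * y + c)).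
Proof.
apply: max_fun_continuous => y; first exact: cvg_cst.
by apply: cvgD; [apply: cvgM; [exact: cvg_cst|exact: cvg_id]|exact: cvg_cst].
Qed.

Definition offset p : Cdisk R := Cdisk_id R - set_val p *: 1.

Lemma offsetE p z : offset p z = set_val z - set_val p.
Proof. by rewrite -[LHS]/(set_val z - set_val p * 1) mulr1. Qed.

Lemma Cdisk_sqrt f : (forall z, 0 <= f z) -> exists g, star g * g = f.
Proof.
move=> f0; exists (Cdisk_real (@sqrt_continuous R) f); apply: Cdisk_eq => z.
rewrite -[LHS]/(Num.conj (Cdisk_real (@sqrt_continuous R) f z) *
   (Cdisk_real (@sqrt_continuous R) f z)) Cdisk_realE.
have := f0 z; case: (f z) => a b; rewrite lecE /= => /andP[/eqP b0 a0].
rewrite -[RHS]/(a +i* b); rewrite b0 /=; apply/eqP; rewrite eq_complex /=.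
by rewrite oppr0 !mul0r !mulr0 subr0 addr0 -expr2 sqr_sqrtr ?eqxx.
Qed.

Lemma normr_sqr_le (w : R[i]) (k : R) : `|w| <= k%:C -> `|w| ^+ 2 <= (k ^+ 2)%:C.
Proof. by move=> wk; rewrite rmorphXn !expr2 ler_pM. Qed.

(** Near [p] this is continuity; away from [p] the factor [z - p] is bounded below
    and [f] is bounded. Combined with positivity, this quadratic estimate does the
    work of approximation by polynomials in [z] and its conjugate. *)
Lemma Cdisk_gram_le f p (e : R) : 0 < e -> exists C : R, 0 <= C /\ forall z,
  `|f z - f p| ^+ 2 <= e%:C + C%:C * `|set_val z - set_val p| ^+ 2.
Proof.
move=> e0; have [|d d0 dP] := Cdisk_near f p (e := Num.sqrt e); first by rewrite sqrtr_gt0.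
have [M fM] := Cdisk_bounded f.
have M0 : 0 <= M by rewrite -ler0c; apply: le_trans (fM p).
have K0 : 0 <= (M + M) ^+ 2 / d ^+ 2.
  by apply: divr_ge0; [rewrite exprn_ge0 // addr_ge0|rewrite exprn_ge0 // ltW].
exists ((M + M) ^+ 2 / d ^+ 2); split=> //.
move=> z; have [zp|zp] := boolP (`|set_val z - set_val p| < d%:C).
  apply: (@le_trans _ _ e%:C); last by rewrite lerDl mulr_ge0 ?exprn_ge0 // ler0c.
  by rewrite -[e in leRHS](sqr_sqrtr (ltW e0)); apply: normr_sqr_le; exact/ltW/dP.
apply: (@le_trans _ _ ((M + M) ^+ 2)%:C).
  apply: normr_sqr_le; rewrite rmorphD.
  by apply: (le_trans (ler_normB _ _)); rewrite lerD.
apply: (@le_trans _ _ (((M + M) ^+ 2 / d ^+ 2)%:C * (d ^+ 2)%:C)).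
  by rewrite -rmorphM /= mulfVK // expf_neq0 // gt_eqF.
apply: (@le_trans _ _ (((M + M) ^+ 2 / d ^+ 2)%:C * `|set_val z - set_val p| ^+ 2)).
  rewrite ler_wpM2l ?ler0c // rmorphXn !expr2 ler_pM ?ler0c ?(ltW d0) //.
    by move: zp; rewrite -Re_normc ltcR lecR -leNgt.
  by move: zp; rewrite -Re_normc ltcR lecR -leNgt.
by rewrite lerDr ler0c ltW.
Qed.

End DiskTopology.

(** * Iterates and functions as operators *)

Section Iterates.
Variables (X : topologicalType) (phi : homeomorphism X).

Lemma homeo_iterS n x : homeo_iter phi (n + 1) x = phi (homeo_iter phi n x).
Proof.
case: n => [n|[|n]]; first by rewrite -PoszD addn1.
  by rewrite NegzE addNr /= homeo_invK.
rewrite (_ : Negz n.+1 + 1 = Negz n) /= ?homeo_invK //.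
by rewrite !NegzE -[X in - X%:Z + 1]addn1 PoszD opprD addrNK.
Qed.

Lemma homeo_iterB n x : homeo_iter phi (n - 1) x = homeo_inv phi (homeo_iter phi n x).
Proof. by rewrite -{2}[n](subrK 1) homeo_iterS homeo_funK. Qed.

Lemma homeo_iterD m n x :
  homeo_iter phi (m + n) x = homeo_iter phi m (homeo_iter phi n x).
Proof.
elim/int_ind: m => [|m IH|m IH]; first by rewrite add0r.
  by rewrite -addn1 PoszD addrAC homeo_iterS IH homeo_iterS.
by rewrite -addn1 PoszD opprD addrAC homeo_iterB IH homeo_iterB.
Qed.

Lemma homeo_iter_continuous n : continuous (homeo_iter phi n).
Proof.
elim/int_ind: n => [|n IH|n IH] x.
- exact: cvg_id.
- rewrite (_ : homeo_iter phi _ = phi \o homeo_iter phi n) //.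
  exact: continuous_comp (IH x) (@cts_fun _ _ phi _).
- rewrite (_ : homeo_iter phi _ = homeo_inv phi \o homeo_iter phi (- n%:Z)).
    exact: continuous_comp (IH x) (@cts_fun _ _ (homeo_inv phi) _).
  by apply/funext => y; rewrite -addn1 PoszD opprD homeo_iterB.
Qed.

Lemma orbit_of_eq x y : orbit_of phi x = orbit_of phi y ->
  exists n, x = homeo_iter phi n y.
Proof.
move=> xy; have : orbit_of phi x x by exists 0.
by rewrite xy => -[n _ <-]; exists n.
Qed.

Lemma orbit_of_iter n x : orbit_of phi (homeo_iter phi n x) = orbit_of phi x.
Proof.
apply/seteqP; split=> _ [m _ <-]; first by exists (m + n); rewrite // homeo_iterD.
by exists (m - n); rewrite // -homeo_iterD subrK.
Qed.

End Iterates.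

Section ShiftedFunctions.
Variables (R : realType) (phi : homeomorphism (disk R)).

Lemma Cdisk_iterP (f : Cdisk R) n : continuous (fun z => f (homeo_iter phi n z)).
Proof.
by move=> z; exact: continuous_comp (@homeo_iter_continuous _ phi n z) (@cts_fun _ _ f _).
Qed.

Definition Cdisk_iter (f : Cdisk R) n : Cdisk R := mkcts (@Cdisk_iterP f n).

End ShiftedFunctions.

Section UnitaryPowers.
Variables (R : realType) (phi : homeomorphism (disk R)) (B : cstarAlgType R).
Variables (iota : starHom (Cdisk R) B) (u : B).
Hypothesis crossed : is_crossed_product phi iota u.

Definition unitary_pow (n : int) : B :=
  match n with Posz k => u ^+ k | Negz k => star u ^+ k.+1 end.

Lemma unitary_powS n : u * unitary_pow n = unitary_pow (n + 1).
Proof.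
case: n => [n|[|n]]; first by rewrite -PoszD addn1 /= exprS.
  by rewrite NegzE addNr /= expr1 (crossed_uus crossed).
rewrite (_ : Negz n.+1 + 1 = Negz n) /=.
  by rewrite [star u ^+ n.+2]exprS mulrA (crossed_uus crossed) mul1r.
by rewrite !NegzE -[X in - X%:Z + 1]addn1 PoszD opprD addrNK.
Qed.

Lemma unitary_powB n : star u * unitary_pow n = unitary_pow (n - 1).
Proof.
by rewrite -{1}[n](subrK 1) -unitary_powS mulrA (crossed_uu crossed) mul1r.
Qed.

Lemma unitary_pow_shift f n :
  iota f * unitary_pow n = unitary_pow n * iota (Cdisk_iter phi f n).
Proof.
elim/int_ind: n f => [|n IH|n IH] f.
- by rewrite mulr1 mul1r; congr (iota _); exact: Cdisk_eq.
- rewrite -addn1 PoszD -unitary_powS [LHS]mulrA (crossed_shift crossed) -[LHS]mulrA IH mulrA.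
  congr (_ * iota _); apply: Cdisk_eq => z.
  by rewrite -[RHS]/(f (homeo_iter phi (n%:Z + 1) z)) homeo_iterS.
- rewrite -addn1 PoszD opprD -unitary_powB [LHS]mulrA.
  have -> : iota f * star u = star u * iota (f \o homeo_inv phi : Cdisk R).
    have e : (f \o homeo_inv phi) \o phi = f :> (disk R -> R[i]).
      by apply/funext => z /=; rewrite homeo_funK.
    have := crossed_shift crossed (f \o homeo_inv phi : Cdisk R).
    have -> : ((f \o homeo_inv phi : Cdisk R) \o phi : Cdisk R) = f.
      by apply: Cdisk_eq => z /=; rewrite homeo_funK.
    move=> h; rewrite -[LHS]mul1r -{1}(crossed_uu crossed) -!mulrA.
    rewrite [u * (_ * _)]mulrA -h -mulrA (crossed_uus crossed) mulr1 //.
  rewrite -[LHS]mulrA IH mulrA.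
  congr (_ * iota _); apply: Cdisk_eq => z.
  by rewrite -[RHS]/(f (homeo_iter phi (- n%:Z - 1) z)) homeo_iterB.
Qed.

Lemma unitary_pow_unit n : star (unitary_pow n) * unitary_pow n = 1.
Proof.
elim/int_ind: n => [|n IH|n IH]; first by rewrite star1 mulr1.
  rewrite -addn1 PoszD -unitary_powS starM mulrA -[_ * star u * u]mulrA.
  by rewrite (crossed_uu crossed) mulr1.
rewrite -addn1 PoszD opprD -unitary_powB starM starK mulrA -[_ * u * star u]mulrA.
by rewrite (crossed_uus crossed) mulr1.
Qed.

End UnitaryPowers.

Section FunctionOperators.
Variables (R : realType) (B : cstarAlgType R) (iota : starHom (Cdisk R) B).
Variables (H : hilbertType R) (rho : starRep B H).
Implicit Types (f g : Cdisk R) (v w : H).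
Local Notation T f := (rho (iota f)).

Lemma funD f g v : T (f + g) v = T f v + T g v.
Proof. by rewrite rmorphD repD. Qed.
Lemma funB f g v : T (f - g) v = T f v - T g v.
Proof. by rewrite rmorphB repB. Qed.
Lemma funZ (c : R[i]) f v : T (c *: f) v = c *: T f v.
Proof. by rewrite linearZ repZ. Qed.
Lemma funM f g v : T (f * g) v = T f (T g v).
Proof. by rewrite rmorphM repM. Qed.
Lemma fun_star f v w : inner (T (star f) v) w = inner v (T f w).
Proof. by rewrite star_homS rep_star. Qed.

Lemma fun_gram f v : inner (T f v) (T f v) = inner (T (star f * f) v) v.
Proof. by rewrite funM fun_star. Qed.

Lemma fun_ge0 f v : (forall z, 0 <= f z) -> 0 <= inner (T f v) v.
Proof. by move=> /Cdisk_sqrt[g <-]; rewrite -fun_gram inner_ge0. Qed.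

Lemma fun_le f g v : (forall z, f z <= g z) -> inner (T f v) v <= inner (T g v) v.
Proof.
move=> fg; rewrite -subr_ge0 -innerBl -funB; apply: fun_ge0 => z.
by rewrite -[(g - f) z]/(g z - f z) subr_ge0.
Qed.

Lemma Cdisk_gramE f z : (star f * f) z = `|f z| ^+ 2.
Proof. by rewrite normCK mulrC. Qed.

Lemma le_eps_eq0 (x y : R[i]) : 0 <= x -> 0 <= y ->
  (forall e : R, 0 < e -> x <= e%:C * y) -> x = 0.
Proof.
move=> x0 y0 xy; apply/eqP; rewrite eq_le x0 andbT.
case: x y x0 y0 xy => [a b] [c d]; rewrite !lecE /= => /andP[/eqP-> a0] /andP[/eqP-> c0] h.
rewrite eqxx /=; apply/ler_addgt0Pr => e e0; rewrite add0r.
have c1 : 0 < c + 1 by rewrite ltr_wpDl.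
have := h (e / (c + 1)); rewrite divr_gt0 // => /(_ isT).
rewrite lecE /= => /andP[_]; rewrite mul0r subr0 => /le_trans; apply.
by rewrite mulrAC ler_pdivrMr // ler_pM2l // lerDl.
Qed.

(** By [Cdisk_gram_le], the norm of [T (f - f p) v] is controlled by that of
    [T (offset p) v], up to [e]. *)
Lemma fun_eigenvector (p : disk R) v : rho 1 v = v ->
  T (Cdisk_id R) v = set_val p *: v -> forall f, T f v = f p *: v.
Proof.
move=> v1 zv f.
have T1 : T 1 v = v by rewrite rmorph1.
have Tsub g c : T (g - c *: 1) v = T g v - c *: v by rewrite funB funZ T1.
apply/eqP; rewrite -subr_eq0 -Tsub; apply/eqP/inner_eq0.
apply: (@le_eps_eq0 _ (inner v v)); rewrite ?inner_ge0 // => e e0.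
have [C [C0 fC]] := Cdisk_gram_le f p e0.
pose k := offset p.
have k0 : T k v = 0 by rewrite /k /offset Tsub zv subrr.
rewrite fun_gram.
apply: (@le_trans _ _ (inner (T (e%:C *: 1 + C%:C *: (star k * k)) v) v)).
  apply: fun_le => z; rewrite Cdisk_gramE.
  rewrite -[X in _ <= X]/(e%:C * 1 + C%:C * (star k * k) z) Cdisk_gramE mulr1.
  rewrite offsetE.
  by rewrite -[(f - _) z]/(f z - f p * 1) mulr1.
by rewrite funD !funZ T1 innerDl !innerZl -fun_gram k0 inner0l mulr0 addr0.
Qed.

End FunctionOperators.

(** * Dynamics of a parabolic automorphism *)

Section ParabolicDynamics.
Variable R : realType.
Implicit Types (z p x : disk R) (t : R).

Lemma expi_norm t : `|expi t| = 1.
Proof. by rewrite normc_def /= cos2Dsin2 sqrtr1. Qed.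

Lemma disk_eq z p : set_val z = set_val p -> z = p.
Proof. exact: val_inj. Qed.

Lemma disk1E : set_val (disk1 R) = 1 :> R[i].
Proof. by []. Qed.

Lemma disk_norm z : `|set_val z| <= 1.
Proof. by have := valP z; rewrite inE; exact. Qed.

Lemma subr1_neq0 z : z <> disk1 R -> 1 - set_val z != 0.
Proof.
move=> z1; rewrite subr_eq0; apply/eqP => e; apply: z1; apply: disk_eq.
by rewrite -e.
Qed.

Variable phi : homeomorphism (disk R).
Hypothesis parabolic : parabolic_with_fixed_point phi (disk1 R).

Lemma fix_disk1 : phi (disk1 R) = disk1 R.
Proof. by case: parabolic => _ _ /(_ (disk1 R))[_]; exact. Qed.

Lemma iter_disk1 n : homeo_iter phi n (disk1 R) = disk1 R.
Proof.
elim/int_ind: n => [//|n IH|n IH].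
  by rewrite -addn1 PoszD homeo_iterS IH fix_disk1.
by rewrite -addn1 PoszD opprD homeo_iterB IH -{1}fix_disk1 homeo_funK.
Qed.

Lemma iter_neq1 n z : z <> disk1 R -> homeo_iter phi n z <> disk1 R.
Proof.
move=> z1 e; apply: z1; have := iter_disk1 (- n); rewrite -e -homeo_iterD addNr.
by [].
Qed.

(** The other fixed point of the Moebius map is [- c * z0 / z0^*], a point of
    the unit circle; parabolicity makes it coincide with 1, which determines
    the rotation [c]. *)
Lemma parabolic_normal_form : exists w : R[i], [/\ w != 0, 1 - w != 0 &
  forall z, 1 - w * set_val z != 0 /\
    1 - set_val (phi z) = (1 - w) * (1 - set_val z) / (1 - w * set_val z)].
Proof.
have [[t [z0 [z01 phiE]]] _ fixP] := parabolic.
set c := expi t in phiE.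
have c1 : `|c| = 1 := expi_norm t.
have den z : 1 - z0^* * set_val z != 0.
  rewrite subr_eq0; apply/eqP => e; have : `|z0^* * set_val z| < 1.
    rewrite normrM norm_conjC; apply: (le_lt_trans _ z01).
    by rewrite ler_piMr // disk_norm.
  by rewrite -e normr1 ltxx.
have f1 : c * (1 - z0) = 1 - z0^*.
  have := congr1 set_val fix_disk1; rewrite phiE !disk1E mulr1 => h.
  have d1 := den (disk1 R); rewrite disk1E mulr1 in d1.
  by have := congr1 ( *%R^~ (1 - z0^*)) h; rewrite /= mul1r -mulrA divfK.
have z00 : z0 != 0.
  apply/eqP => z0E.
  have zero_in : (0 : R[i]) \in disk R by rewrite inE /disk /= normr0 ler01.
  have /fixP /(congr1 set_val) /= /eqP : phi (exist _ 0 zero_in : disk R) = exist _ 0 zero_in.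
    by apply: disk_eq; rewrite phiE /= z0E subrr mul0r mulr0.
  by rewrite eq_sym oner_eq0.
have zc0 : z0^* != 0 by rewrite conjC_eq0.
have w_in : - c * z0 / z0^* \in disk R.
  rewrite inE /disk /= normrM normfV norm_conjC normrM normrN c1 mul1r divff //.
  by rewrite normr_eq0.
pose w : disk R := exist _ (- c * z0 / z0^*) w_in.
have wE : set_val w = - c * z0 / z0^* by [].
have w1 : w = disk1 R.
  apply/fixP; apply: disk_eq; rewrite phiE; apply: (mulIf (den w)).
  rewrite -mulrA divfK //.
  apply/eqP; rewrite -subr_eq0.
  have -> : c * (set_val w - z0) - set_val w * (1 - z0^* * set_val w) =
     (set_val w - 1) * (z0^* * set_val w + c * z0) +
     set_val w * (1 * c * (1 - z0) - (1 - z0^*)) by ring.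
  have -> : z0^* * set_val w + c * z0 = 0 by rewrite wE; field.
  by rewrite mul1r f1 subrr !mulr0 addr0.
have cz0 : c * z0 = - z0^*.
  have := congr1 set_val w1; rewrite wE disk1E => h.
  by rewrite -[RHS]mulN1r -h !mulNr opprK divfK.
have cE : c = 1 - z0^* - z0^* by rewrite -f1 mulrBr mulr1 cz0 opprK addrK.
exists z0^*; split=> // [|z].
  by have := den (disk1 R); rewrite disk1E mulr1.
split; first exact: den.
rewrite phiE mulrA mulrBr cz0 cE; field; exact: den.
Qed.

Definition zeta z : R[i] := (1 - set_val z)^-1.

(** Taking inverses in the normal form gives [zeta (phi z) = zeta z + w / (1 - w)]. *)
Lemma parabolic_translation : exists2 k : R[i], k != 0 &
  forall n z, z <> disk1 R -> zeta (homeo_iter phi n z) = zeta z + n%:~R * k.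
Proof.
have [w [w0 w1 phiE]] := parabolic_normal_form.
exists (w / (1 - w)); first by rewrite mulf_neq0 // invr_neq0.
have step z : z <> disk1 R -> zeta (phi z) = zeta z + w / (1 - w).
  move=> /subr1_neq0 z1; have [d e] := phiE z; rewrite /zeta e.
  by field; rewrite z1 w1 d.
move=> n z z1; elim/int_ind: n => [|n IH|n IH]; first by rewrite mul0r addr0.
  rewrite -addn1 PoszD homeo_iterS step ?IH; last exact: iter_neq1.
  by rewrite rmorphD mulrDl mul1r addrA.
rewrite -addn1 PoszD opprD homeo_iterB.
have := step (homeo_iter phi (- n%:Z - 1) z) (iter_neq1 z1).
rewrite homeo_iterB homeo_invK IH => e.
by rewrite -[LHS](addrK (w / (1 - w))) -e rmorphB mulrBl mul1r addrA.
Qed.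

Lemma parabolic_free n z : z <> disk1 R -> homeo_iter phi n z = z -> n = 0.
Proof.
move=> z1 nz; have [k k0 /(_ n z z1)] := parabolic_translation.
rewrite nz => /eqP; rewrite -subr_eq0 opprD addrA subrr add0r oppr_eq0 mulf_eq0.
by rewrite (negbTE k0) orbF intr_eq0 => /eqP.
Qed.

Lemma parabolic_free2 m n z : z <> disk1 R ->
  homeo_iter phi m z = homeo_iter phi n z -> m = n.
Proof.
move=> z1 mn; apply/eqP; rewrite -subr_eq0; apply/eqP.
apply: (@parabolic_free _ z) => //; rewrite addrC homeo_iterD mn -homeo_iterD.
by rewrite addNr.
Qed.

(** The coordinate [zeta] is bounded near [x] and [zeta (phi^n z)] is a translate of
    [zeta z] by [n * k], so it tends to infinity, that is, [phi^n z] tends to 1,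
    uniformly near [x] and in both directions. *)
Lemma parabolic_attracts x (e : R) : x <> disk1 R -> 0 < e ->
  exists2 d : R, 0 < d & exists N, forall n : int, (N <= `|n|)%N ->
    forall z, `|set_val z - set_val x| < d%:C ->
      `|set_val (homeo_iter phi n z) - 1| < e%:C.
Proof.
move=> x1 e0; have [k k0 zetaE] := parabolic_translation.
pose d : R := complex.Re `|1 - set_val x| / 2.
have dE : `|1 - set_val x| = d%:C + d%:C by rewrite -rmorphD /= -splitr Re_normc.
have d0 : 0 < d.
  by rewrite divr_gt0 // -ltcR Re_normc normr_gt0; exact: subr1_neq0.
pose r := complex.Re `|k|; have r0 : 0 < r by rewrite -ltcR Re_normc normr_gt0.
pose M := d^-1 + e^-1.
exists d => //; exists (Num.bound (M / r)) => n Nn z zx.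
have dz : d%:C < `|1 - set_val z|.
  rewrite -(ltrD2r d%:C) -dE.
  apply: (@le_lt_trans _ _ (`|1 - set_val z| + `|set_val z - set_val x|)).
    by rewrite -(subrKA (set_val z)) ler_normD.
  by rewrite ltrD2l.
have z1 : z <> disk1 R.
  by move=> z1; move: dz; rewrite z1 disk1E subrr normr0 ltcR ltNge ltW.
have inv_le (a : R) (b : R[i]) : 0 < a -> a%:C <= `|b| -> `|b^-1| <= (a^-1)%:C.
  move=> a0 ab; have aC : 0 < a%:C :> R[i] by rewrite ltcR.
  have b0 : 0 < `|b| by exact: lt_le_trans ab.
  by rewrite normfV fmorphV /= lef_pV2.
have zetaz : `|zeta z| <= (d^-1)%:C by apply: inv_le => //; exact: ltW.
rewrite distrC -[X in X < _]Re_normc ltcR ltNge; apply/negP => ew.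
have zetaw : `|zeta (homeo_iter phi n z)| <= (e^-1)%:C.
  by apply: inv_le => //; rewrite -Re_normc lecR.
have : `|n%:~R * k| <= M%:C.
  have -> : n%:~R * k = zeta (homeo_iter phi n z) - zeta z by rewrite zetaE // addrC addKr.
  by apply: (le_trans (ler_normB _ _)); rewrite /M rmorphD [leRHS]addrC lerD.
rewrite normrM -(Re_normc k) -/r.
have -> : `|n%:~R : R[i]| = ((absz n)%:R : R)%:C.
  by rewrite -intr_norm -abszE -pmulrn rmorph_nat.
rewrite -rmorphM lecR /= -ler_pdivlMr // leNgt => /negP; apply.
apply: (@lt_le_trans _ _ (Num.bound (M / r))%:R); last by rewrite ler_nat.
by apply: archi_boundP; rewrite divr_ge0 ?addr_ge0 ?invr_ge0 // ltW.
Qed.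

End ParabolicDynamics.

(** * Orthonormal bases indexed by the integers *)

Lemma zseriesS (R : realType) (f : int -> R[i]) N :
  zseries f N.+1 = zseries f N + (f (Posz N) + f (Negz N)).
Proof. by rewrite /zseries seriesSr. Qed.

Section OrthonormalBases.
Variables (R : realType) (H : hilbertType R) (e : int -> H).
Hypothesis orthonormal : forall m n, inner (e m) (e n) = (m == n)%:R.
Implicit Types (x y : int -> R[i]) (v w : H).

(** Summed over the ranges that define [zseries], so that the inner products of
    these sums are values of [zseries]. *)
Definition partial_sum x N : H :=
  \sum_(0 <= k < N) (x (Posz k) *: e (Posz k) + x (Negz k) *: e (Negz k)).

Lemma inner_partial_sum x N w :
  inner (partial_sum x N) w = zseries (fun n => x n * inner (e n) w) N.
Proof.
rewrite inner_suml; apply: eq_bigr => k _.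
by rewrite innerDl !innerZl.
Qed.

Definition in_range (n : int) N := (match n with Posz k => k | Negz k => k end < N)%N.

Lemma zseries_delta x n N :
  zseries (fun m => x m * (m == n)%:R) N = if in_range n N then x n else 0.
Proof.
elim: N => [|N IH]; first by rewrite /zseries /series /= big_geq // /in_range ltn0.
rewrite zseriesS IH.
case: n {IH} => n; rewrite /in_range ltnS [(n <= N)%N]leq_eqVlt.
  rewrite eqz_nat [(Negz N == _)]/= mulr0 addr0 [n == N]eq_sym; case: eqP => [->|_] /=.
    by rewrite ltnn mulr1 add0r.
  by rewrite mulr0 addr0.
rewrite [(Posz N == _)]/= mulr0 add0r [n == N]eq_sym (_ : (Negz N == Negz n) = (N == n)) //.
case: eqP => [->|_] /=; first by rewrite ltnn mulr1 add0r.
by rewrite mulr0 addr0.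
Qed.

Lemma inner_partial_sum_basis x N n :
  inner (partial_sum x N) (e n) = if in_range n N then x n else 0.
Proof.
rewrite inner_partial_sum -zseries_delta; congr (zseries _ N).
by apply/funext => m; rewrite orthonormal.
Qed.

Lemma inner_partial_sums x y M N : (M <= N)%N ->
  inner (partial_sum x M) (partial_sum y N) = zseries (fun n => x n * (y n)^*) M.
Proof.
move=> MN; rewrite inner_partial_sum; apply: eq_big_nat => k /andP[_ kM].
have kN : (k < N)%N := leq_trans kM MN.
rewrite ![inner (e _) _]innerC !inner_partial_sum_basis /in_range kN //.
Qed.

(** The theorem of Riesz and Fischer: the squared distance of two partial sums is
    the difference of the corresponding partial sums of [zseries]. *)
Lemma partial_sum_cvg (x : l2Z R) : cvgn (partial_sum x).
Proof.
pose s := zseries (fun n => x n * (x n)^*).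
have sE m n : (m <= n)%N ->
    `|partial_sum x n - partial_sum x m| ^+ 2 = s n - s m.
  move=> mn; rewrite (inner_norm (_ : H)) innerBl !innerBr.
  rewrite [inner (partial_sum x n) (partial_sum x m)]innerC !inner_partial_sums //.
  rewrite -/s -/(s n) -/(s m).
  have -> : Num.conj (s m) = s m.
    rewrite /s /zseries /series /= rmorph_sum; apply: eq_bigr => k _.
    by rewrite rmorphD !rmorphM /= !conjCK ![_^* * _]mulrC.
  by rewrite subrr subr0.
have s_cvg : cvgn s by exact: l2_inner_cvg.
apply: cauchy_cvg; apply/cauchyP => d /gt0_Re[]; set c := complex.Re d => c0 ->.
have /cvgrPdist_lt sl := s_cvg.
have [|N _ NP] := sl ((c ^+ 2) / 2)%:C; first by rewrite ltcR divr_gt0 // exprn_gt0.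
exists (partial_sum x N); rewrite -ball_normE; exists N => // n /= Nn.
rewrite distrC -ltr_sqr ?nnegrE ?ler0c ?(ltW c0) // sE //.
have r0 : 0 <= s n - s N by rewrite -sE // exprn_ge0.
rewrite -[s n - s N]ger0_norm // -(subrKA (limn s)).
apply: (le_lt_trans (ler_normD _ _)); rewrite -rmorphXn [c ^+ 2]splitr rmorphD ltrD //.
  by rewrite distrC; apply: NP.
by apply: NP => /=.
Qed.

Definition basis_sum (x : l2Z R) : H := limn (partial_sum x).

Definition basis_coef v : int -> R[i] := fun n => inner v (e n).

(** The inequality of Bessel: [v - p] has a nonnegative square, for [p] the partial
    sum of the expansion of [v]. *)
Lemma basis_coef_summable v : basis_coef v \in @square_summable_pred R.
Proof.
apply/asboolP/square_summableP; exists (complex.Re (inner v v)) => N.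
pose x := basis_coef v; pose p := partial_sum x N.
have pv : inner p v = zseries (fun n => `|x n| ^+ 2) N.
  rewrite inner_partial_sum; congr (zseries _ N); apply/funext => n.
  by rewrite normCK [inner (e n) v]innerC.
have s0 : 0 <= zseries (fun n => `|x n| ^+ 2) N.
  by rewrite sumr_ge0 // => k _; rewrite addr_ge0 // exprn_ge0.
have pp : inner p p = zseries (fun n => `|x n| ^+ 2) N.
  rewrite inner_partial_sums //; congr (zseries _ N); apply/funext => n.
  by rewrite normCK.
have vr : (complex.Re (inner v v))%:C = inner v v.
  by apply: RRe_real; rewrite ger0_real // inner_ge0.
have := inner_ge0 (v - p); rewrite innerBl !innerBr pp [inner v p]innerC pv.
have -> : Num.conj (zseries (fun n => `|x n| ^+ 2) N) = zseries (fun n => `|x n| ^+ 2) N.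
  by apply: CrealP; rewrite ger0_real.
by rewrite subrr subr0 subr_ge0 vr.
Qed.

Definition basis_map v : l2Z R := L2Z (basis_coef_summable v).

Lemma basis_map_linear : linear basis_map.
Proof.
by move=> c v w; apply/val_inj/funext => n; rewrite /= /basis_coef innerDl innerZl.
Qed.

HB.instance Definition _ := GRing.isLinear.Build R[i] H (l2Z R) *:%R basis_map basis_map_linear.

(** Since the two maps are adjoint to each other, it is enough to know that they
    are mutually inverse in order to conclude that they are unitary. *)
Lemma basis_map_adjoint (x : l2Z R) w : inner (basis_sum x) w = inner x (basis_map w).
Proof.
have c1 := cvg_inner (w := w) (@partial_sum_cvg x).
apply: (seq_limit_unique _ c1 (@l2_inner_cvg _ x (basis_map w))) => N.
rewrite inner_partial_sum; apply: eq_bigr => k _.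
by rewrite ![inner (e _) w]innerC.
Qed.

Lemma basis_sumK : cancel basis_sum basis_map.
Proof.
move=> x; apply/val_inj/funext => n /=.
have c1 := cvg_inner (w := e n) (@partial_sum_cvg x).
suff c2 : inner (partial_sum x N) (e n) @[N --> \oo] --> x n.
  exact: (seq_limit_unique _ c1 c2).
apply: cvg_near_cst; exists (`|n|.+1)%N => // N /= nN; rewrite inner_partial_sum_basis.
case: ifP => //; rewrite /in_range; case: n {c1} nN => n /=; first by move=> ->.
by move=> /ltnW ->.
Qed.

Hypothesis total : forall v, (forall n, inner v (e n) = 0) -> v = 0.

Lemma basis_mapK : cancel basis_map basis_sum.
Proof.
move=> v; apply/eqP; rewrite -subr_eq0; apply/eqP/total => n.
have := congr1 (fun x : l2Z R => x n) (basis_sumK (basis_map v)).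
by rewrite innerBl /= /basis_coef => ->; rewrite subrr.
Qed.

Lemma basis_map_bijective : bijective basis_map.
Proof. by exists basis_sum; [exact: basis_mapK|exact: basis_sumK]. Qed.

Lemma basis_map_inner v w : inner (basis_map v) (basis_map w) = inner v w.
Proof. by rewrite -basis_map_adjoint basis_mapK. Qed.

End OrthonormalBases.

Lemma isometry_continuous (R : realType) (H1 H2 : hilbertType R) (V : {linear H1 -> H2}) :
  (forall v w, inner (V v) (V w) = inner v w) -> continuous V.
Proof.
move=> Vi; apply: (@bounded_continuous _ _ _ _ 1) => v w; rewrite mul1r.
rewrite -raddfB -ler_sqr ?nnegrE // (inner_norm (V (v - w))) (inner_norm (v - w)).
by rewrite Vi.
Qed.

(** * The representations attached to points and angles *)

Section SequenceSpace.
Variable R : realType.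
Local Notation l2Z := (l2Z R).
Implicit Types (w : l2Z) (n : int).

Lemma l2Z_eq (v w : l2Z) : (forall n, v n = w n) -> v = w.
Proof. by move=> vw; apply/val_inj/funext. Qed.

Lemma delta_summable n : (fun m => (m == n)%:R) \in @square_summable_pred R.
Proof.
apply/asboolP/square_summableP; exists 1 => N.
rewrite (_ : (fun m => _) = fun m => 1 * (m == n)%:R); last first.
  by apply/funext => m; rewrite mul1r; case: eqP => _; rewrite ?normr1 ?normr0 ?expr1n ?expr0n.
by rewrite (@zseries_delta R (fun=> 1)); case: ifP => _; rewrite ?ler01.
Qed.

Definition delta n : l2Z := L2Z (delta_summable n).

Lemma inner_delta w n : inner w (delta n) = w n.
Proof.
have c1 := @l2_inner_cvg _ w (delta n).
suff c2 : zseries (fun m => w m * (delta n m)^*) N @[N --> \oo] --> w n.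
  exact: (seq_limit_unique _ c1 c2).
rewrite (_ : (fun m => _) = (fun m => w m * (m == n)%:R)); last first.
  by apply/funext => m; rewrite /= conjC_nat.
apply: cvg_near_cst; exists (`|n|.+1)%N => // N /= nN; rewrite zseries_delta.
case: ifP => //; rewrite /in_range; case: n {c1} nN => n /=; first by move=> ->.
by move=> /ltnW ->.
Qed.

Lemma delta_neq0 n : delta n != 0.
Proof.
apply/eqP => /(congr1 (fun x : l2Z => x n)) /eqP; rewrite /= eqxx.
by rewrite (oner_eq0 R[i]).
Qed.

Lemma l2Z_nontrivial : exists w, w != 0.
Proof. by exists (delta 0); exact: delta_neq0. Qed.

Lemma delta_shift_orthonormal k m n : inner (delta (m + k)) (delta (n + k)) = (m == n)%:R.
Proof. by rewrite inner_delta /= (inj_eq (addIr k)) eq_sym. Qed.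

Lemma delta_shift_total k w : (forall n, inner w (delta (n + k)) = 0) -> w = 0.
Proof.
move=> w0; apply: l2Z_eq => n /=.
by have := w0 (n - k); rewrite subrK inner_delta.
Qed.

(** The translations of [l2Z] are coordinate maps with respect to translated bases,
    and inherit their unitarity from [basis_map]. *)
Definition shift k : l2Z -> l2Z := basis_map (delta_shift_orthonormal k).

Lemma shiftE k w n : shift k w n = w (n + k).
Proof. exact: inner_delta. Qed.

Lemma shiftK k : cancel (shift k) (shift (- k)).
Proof. by move=> w; apply: l2Z_eq => n; rewrite !shiftE addrNK. Qed.

Lemma shift_adjoint k : adjoint_of (shift k) (shift (- k)).
Proof.
move=> v w; rewrite -{1}[w](shiftK (- k)) opprK.
exact: basis_map_inner (@delta_shift_total k) _ _.
Qed.

Lemma l2Z_sum_delta w : partial_sum delta w N @[N --> \oo] --> w.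
Proof.
have on m n : inner (delta m) (delta n) = (m == n)%:R by rewrite inner_delta /= eq_sym.
have tot v : (forall n, inner v (delta n) = 0) -> v = 0.
  by move=> v0; apply: l2Z_eq => n /=; rewrite -inner_delta.
have e : basis_sum delta w = w.
  rewrite -[RHS](basis_mapK on tot); congr (basis_sum _ _).
  by apply: l2Z_eq => n; rewrite /= /basis_coef inner_delta.
rewrite -[X in _ --> X]e; exact: partial_sum_cvg.
Qed.

Section Multiplication.
Variables (a : int -> R[i]) (M : R).
Hypothesis aM : forall n, `|a n| <= M%:C.

Lemma mult_summable w : (fun n => a n * w n) \in @square_summable_pred R.
Proof.
have /square_summableP[K wK] := @l2Z_summable _ w.
have M0 : 0 <= M by rewrite -ler0c; apply: le_trans (aM 0).
apply/asboolP/square_summableP; exists (M ^+ 2 * K) => N.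
apply: (@le_trans _ _ (zseries (fun n => (M ^+ 2)%:C * `|w n| ^+ 2) N)).
  apply: zseries_le => n; rewrite normrM exprMn ler_wpM2r ?exprn_ge0 //.
  exact: normr_sqr_le.
by rewrite zseriesZ /= [leRHS]rmorphM ler_wpM2l // ler0c exprn_ge0.
Qed.

Definition mult w : l2Z := L2Z (mult_summable w).

Lemma mult_bounded : bounded_by M mult.
Proof.
have M0 : 0 <= M by rewrite -ler0c; apply: le_trans (aM 0).
move=> w; rewrite -ler_sqr ?nnegrE ?mulr_ge0 ?ler0c // exprMn (l2_norm (mult w)).
apply: l2_inner_le => N.
apply: (@le_trans _ _ (zseries (fun n => (M ^+ 2)%:C * `|w n| ^+ 2) N)).
  apply: zseries_le => n; rewrite normrM exprMn ler_wpM2r ?exprn_ge0 //.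
  exact: normr_sqr_le.
rewrite zseriesZ rmorphXn ler_wpM2l ?exprn_ge0 ?ler0c //.
by rewrite (l2_norm w) l2_inner_ge.
Qed.

End Multiplication.

End SequenceSpace.

Section Representations.
Variables (R : realType) (phi : homeomorphism (disk R)) (B : cstarAlgType R).
Variables (iota : starHom (Cdisk R) B) (u : B).
Hypothesis crossed : is_crossed_product phi iota u.

Section PiPoint.
Variable x : disk R.

Let M (f : Cdisk R) : R := projT1 (cid (Cdisk_bounded f)).
Let fM (f : Cdisk R) n : `|f (homeo_iter phi n x)| <= (M f)%:C.
Proof. exact: (projT2 (cid (Cdisk_bounded f))). Qed.

Let t f : l2Z R -> l2Z R := mult (fM f).

Lemma pi_point_exists : exists rho : starRep B (l2Z R), is_pi_point phi iota u x rho.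
Proof.
have [||||||||||rho [rf ru]] := @rep_of_covariant _ _ _ _ _ crossed _ t
    (shift (-1)) (shift 1) (@l2Z_nontrivial R).
- by move=> f; exists (M f); exact: mult_bounded.
- move=> f v w.
  have term n : t f v n * (w n)^* = v n * (t (star f) w n)^*.
    rewrite /= -[(star f) _]/(Num.conj (f (homeo_iter phi n x))) rmorphM /= conjCK.
    by rewrite mulrCA mulrA.
  apply: (seq_limit_unique _ (@l2_inner_cvg _ (t f v) w)
    (@l2_inner_cvg _ v (t (star f) w))) => N.
  by apply: eq_bigr => k _; rewrite !term.
- by move=> f g v; apply: l2Z_eq => n; exact: mulrDl.
- by move=> c f v; apply: l2Z_eq => n; rewrite /= -mulrA.
- by move=> f g v; apply: l2Z_eq => n; rewrite /= -mulrA.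
- by move=> v; apply: l2Z_eq => n; exact: mul1r.
- by rewrite -{2}[1]opprK; exact: shift_adjoint.
- by rewrite -{2}[1]opprK; exact: shiftK.
- exact: shiftK.
- move=> f v; apply: l2Z_eq => n; rewrite shiftE.
  rewrite -[LHS]/(f (homeo_iter phi (n + 1) x) * shift (-1) v (n + 1)).
  by rewrite shiftE addrK homeo_iterS.
by exists rho => xi n; rewrite rf ru shiftE.
Qed.

End PiPoint.

Lemma expi_conj t : (expi t)^* * expi t = 1 :> R[i].
Proof. by rewrite mulrC -normCK expi_norm expr1n. Qed.

Lemma C_nontrivial : exists z : R[i], z != 0.
Proof. by exists 1; exact: oner_neq0. Qed.

Lemma pi_theta_exists t : phi (disk1 R) = disk1 R ->
  exists rho : starRep B R[i], is_pi_theta iota u t rho.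
Proof.
move=> fix1; have bnd (c : R[i]) : exists M, bounded_by M (fun z : R[i] => c * z).
  by exists (complex.Re `|c|) => z; rewrite normrM.
have adj (c : R[i]) : adjoint_of (fun z : R[i] => c * z) (fun z => c^* * z).
  move=> v w; rewrite -[LHS]/(c * v * w^*) -[RHS]/(v * (c^* * w)^*).
  by rewrite rmorphM /= conjCK mulrCA mulrA.
have [||||||||||rho [rf ru]] := @rep_of_covariant _ _ _ _ _ crossed R[i]
    (fun f z => f (disk1 R) * z) (fun z => expi t * z) (fun z => (expi t)^* * z) C_nontrivial.
- by move=> f; exact: bnd.
- by move=> f; exact: adj.
- by move=> f g v; exact: mulrDl.
- by move=> c f v; rewrite -[RHS]/(c * _) mulrA.
- by move=> f g v; rewrite mulrA.
- by move=> v; exact: mul1r.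
- exact: adj.
- by move=> v /=; rewrite mulrA expi_conj mul1r.
- by move=> v /=; rewrite mulrA [expi t * _]mulrC expi_conj mul1r.
- move=> f v /=; rewrite mulrCA [X in f _ * X]mulrA expi_conj mul1r.
  by rewrite fix1.
by exists rho => z; rewrite rf ru mul1r.
Qed.

Lemma rep1_of_surjective (H : hilbertType R) (rho : starRep B H) (a : B) (V : H -> H) :
  (forall v, rho a (V v) = v) -> forall v, rho 1 v = v.
Proof. by move=> aV v; rewrite -{1}[v]aV -repM mul1r aV. Qed.

Lemma pi_point_rep1 x (rho : starRep B (l2Z R)) : is_pi_point phi iota u x rho ->
  forall v, rho 1 v = v.
Proof.
move=> rP; apply: (rep1_of_surjective (a := u) (V := shift 1)) => v.
by apply: l2Z_eq => n; have [_ ->] := rP (shift 1 v) n; rewrite shiftE subrK.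
Qed.

Lemma pi_theta_rep1 t (rho : starRep B R[i]) : is_pi_theta iota u t rho ->
  forall v, rho 1 v = v.
Proof.
move=> rP; apply: (rep1_of_surjective (a := u) (V := fun z => (expi t)^* * z)) => v.
by have [_ ->] := rP ((expi t)^* * v); rewrite mulrA [expi t * _]mulrC expi_conj mul1r.
Qed.

(** The basis vectors are eigenvectors of the coordinate function, hence of all of
    C(D); coordinates are inner products with them. *)
Lemma pi_point_fun x (rho : starRep B (l2Z R)) : is_pi_point phi iota u x rho ->
  forall f xi n, rho (iota f) xi n = f (homeo_iter phi n x) * xi n.
Proof.
move=> rP f xi n; rewrite -inner_delta rep_starr -star_homS.
rewrite (@fun_eigenvector _ _ iota _ rho (homeo_iter phi n x)) ?(pi_point_rep1 rP) //.
  rewrite innerZr inner_delta -[(star f) _]/(Num.conj (f (homeo_iter phi n x))).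
  by rewrite conjCK.
apply: l2Z_eq => m; have [-> _] := rP (delta R n) m.
rewrite -[RHS]/(set_val (homeo_iter phi n x) * delta R n m) /=.
by case: eqP => [->|_] //; rewrite !mulr0.
Qed.

Lemma pi_theta_fun t (rho : starRep B R[i]) : is_pi_theta iota u t rho ->
  forall f z, rho (iota f) z = f (disk1 R) * z.
Proof.
move=> rP f z; apply: (fun_eigenvector (p := disk1 R)); first exact: pi_theta_rep1 rP _.
by have [-> _] := rP z; rewrite -[RHS]/(1 * z) mul1r.
Qed.

Lemma pi_point_star x (rho : starRep B (l2Z R)) : is_pi_point phi iota u x rho ->
  forall xi n, rho (star u) xi n = xi (n + 1).
Proof.
move=> rP xi n; rewrite -inner_delta rep_star (_ : rho u _ = delta R (n + 1)).
  exact: inner_delta.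
apply: l2Z_eq => m; have [_ ->] := rP (delta R n) m.
by rewrite /= subr_eq.
Qed.

(** Uniqueness holds because the coordinate function determines the action of C(D),
    and C(D) and [u] generate the crossed product. *)
Lemma pi_point_unique x (rho rho' : starRep B (l2Z R)) :
  is_pi_point phi iota u x rho -> is_pi_point phi iota u x rho' ->
  forall a v, rho a v = rho' a v.
Proof.
move=> rP rP'; apply: (crossed_rep_eq crossed) => [f v|v]; apply: l2Z_eq => n.
  by rewrite (pi_point_fun rP) (pi_point_fun rP').
by have [_ ->] := rP v n; have [_ ->] := rP' v n.
Qed.

Lemma pi_theta_unique t (rho rho' : starRep B R[i]) :
  is_pi_theta iota u t rho -> is_pi_theta iota u t rho' ->
  forall a v, rho a v = rho' a v.
Proof.
move=> rP rP'; apply: (crossed_rep_eq crossed) => [f v|v].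
  by rewrite (pi_theta_fun rP) (pi_theta_fun rP').
by have [_ ->] := rP v; have [_ ->] := rP' v.
Qed.

Lemma pi_theta_irreducible t (rho : starRep B R[i]) :
  is_pi_theta iota u t rho -> irreducible rho.
Proof.
move=> rP; split; first by exists 1, 1; rewrite (pi_theta_rep1 rP); exact/eqP/oner_neq0.
move=> K [_ K0 KL _]; have [[z [Kz z0]]|nK] := pselect (exists z, K z /\ z != 0).
  right; apply/seteqP; split=> // w _.
  by rewrite -[w](divfK z0) -[_ * z]addr0; exact: KL Kz K0.
left; apply/seteqP; split=> [z Kz /=|_ ->//].
by apply/eqP/negPn/negP => z0; apply: nK; exists z.
Qed.

End Representations.

(** * Tent functions isolating a point of an orbit *)

Section Bumps.
Variable R : realType.
Implicit Types (z p : disk R) (d : R).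

(** A tent over the disk of center [p] and radius [d], written as a real function of
    the squared distance to [p] because the latter is an algebraic expression. *)
Definition tent p d : Cdisk R :=
  Cdisk_real (@pos_part_continuous R (- (d ^+ 2)^-1) 1)
    (star (offset p) * offset p).

Lemma tentE p d z : tent p d z =
  (Num.max 0 (1 - complex.Re (`|set_val z - set_val p| ^+ 2) / d ^+ 2))%:C.
Proof.
rewrite Cdisk_realE Cdisk_gramE offsetE.
by rewrite mulNr addrC mulrC.
Qed.

Lemma tent_center p d : tent p d p = 1.
Proof. by rewrite tentE subrr normr0 expr0n /= mul0r subr0 max_r. Qed.

Lemma tent_support p d z : 0 < d -> d%:C <= `|set_val z - set_val p| -> tent p d z = 0.
Proof.
move=> d0 dz; rewrite tentE max_l // subr_le0 ler_pdivlMr ?exprn_gt0 // mul1r.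
rewrite -(Re_normc (set_val z - set_val p)) in dz *; rewrite lecR in dz.
by rewrite -rmorphXn /= !expr2 ler_pM // ltW.
Qed.

End Bumps.

Section FiniteMinimum.
Variable R : realType.

Lemma common_radius (P : int -> R -> Prop) N :
  (forall n d d', P n d -> 0 < d' -> d' <= d -> P n d') ->
  (forall n, exists2 d, 0 < d & P n d) ->
  exists2 d, 0 < d & forall n, (`|n| < N)%N -> P n d.
Proof.
move=> Pmon Pex; elim: N => [|N [d d0 dP]]; first by exists 1.
have [d1 d10 P1] := Pex (Posz N); have [d2 d20 P2] := Pex (- Posz N).
have m0 : 0 < Num.min d (Num.min d1 d2) by rewrite !lt_min d0 d10 d20.
exists (Num.min d (Num.min d1 d2)) => // n; rewrite ltnS leq_eqVlt => /predU1P[nN|nN].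
  have [->|->] : n = N :> int \/ n = - N%:Z by lia.
    by apply: Pmon P1 _ _; rewrite // !ge_min lexx orbT.
  by apply: Pmon P2 _ _; rewrite // !ge_min lexx !orbT.
by apply: Pmon (dP n nN) _ _; rewrite // ge_min lexx.
Qed.

End FiniteMinimum.

Section OrbitBumps.
Variables (R : realType) (phi : homeomorphism (disk R)).
Hypothesis parabolic : parabolic_with_fixed_point phi (disk1 R).
Implicit Types (x z : disk R).

(** Iterates of large order are closer to 1 than half the distance of [x] to 1, and
    the finitely many others differ from [x] because orbits are free. *)
Lemma orbit_isolated x : x <> disk1 R -> exists2 d : R, 0 < d &
  d%:C <= `|1 - set_val x| /\
  forall n, n != 0 -> d%:C <= `|set_val (homeo_iter phi n x) - set_val x|.
Proof.
move=> x1; pose e : R := complex.Re `|1 - set_val x| / 2.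
have eE : `|1 - set_val x| = e%:C + e%:C by rewrite -rmorphD /= -splitr Re_normc.
have e0 : 0 < e.
  by rewrite divr_gt0 // -ltcR Re_normc normr_gt0; exact: subr1_neq0.
have [d0 d00 [N Nfar]] := parabolic_attracts parabolic x1 e0.
have [||d1 d10 d1P] := @common_radius R (fun n d => n != 0 ->
    d%:C <= `|set_val (homeo_iter phi n x) - set_val x|) N.
- by move=> n d d' dP _ d'd n0; apply: le_trans (dP n0); rewrite lecR.
- move=> n; have [->|n0] := eqVneq n 0; first by exists 1; rewrite ?eqxx.
  exists (complex.Re `|set_val (homeo_iter phi n x) - set_val x|) => [|_].
    rewrite -ltcR Re_normc normr_gt0 subr_eq0; apply/eqP => /disk_eq h.
    by move/eqP: n0; apply; exact: parabolic_free h.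
  by rewrite Re_normc.
exists (Num.min e d1); first by rewrite lt_min e0 d10.
split=> [|n n0].
  by rewrite eE; apply: (@le_trans _ _ e%:C); rewrite ?lecR ?ge_min ?lexx // lerDl ler0c ltW.
have [nN|Nn] := ltnP `|n| N.
  by apply: le_trans (d1P n nN n0); rewrite lecR ge_min lexx orbT.
have nf : `|set_val (homeo_iter phi n x) - 1| < e%:C.
  by apply: Nfar => //; rewrite subrr normr0 ltcR.
apply: (@le_trans _ _ e%:C); first by rewrite lecR ge_min lexx.
rewrite -(lerD2r e%:C) -eE.
apply: (@le_trans _ _ (`|set_val (homeo_iter phi n x) - set_val x| +
                       `|set_val (homeo_iter phi n x) - 1|)); last by rewrite lerD2l ltW.
by rewrite [`|_ - 1|]distrC [leRHS]addrC ler_distD.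
Qed.

Lemma orbit_bump x : x <> disk1 R -> exists q : Cdisk R,
  q (disk1 R) = 0 /\ forall n, q (homeo_iter phi n x) = (n == 0)%:R.
Proof.
move=> x1; have [d d0 [d1 dn]] := orbit_isolated x1.
exists (tent x d); split; first by rewrite tent_support.
move=> n; have [->|n0] := eqVneq n 0; first exact: tent_center.
by rewrite tent_support // dn.
Qed.

End OrbitBumps.

(** * Localization of an irreducible representation *)

Lemma disk_finite_cover (R : realType) (I : choiceType) (D : set I)
    (O : I -> set (disk R)) :
  (forall i, D i -> open (O i)) -> (forall z, exists2 i, D i & O i z) ->
  exists s : seq I, (forall i, i \in s -> D i) /\ forall z, exists2 i, i \in s & O i z.
Proof.
move=> Oopen Ocov.
pose P : ptopologicalType := HB.pack (set_type (disk R))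
  (isPointed.Build (set_type (disk R)) (disk1 R)).
have : @cover_compact P [set: P] by rewrite -(@compact_cover P); exact: disk_compact.
move=> /(_ I D O Oopen)[z _|s sD scov]; first exact: Ocov.
exists (finmap.enum_fset s); split=> [i /sD/set_mem //|z].
by have [i si Oz] := scov z Logic.I; exists i.
Qed.

Section Localization.
Variables (R : realType) (phi : homeomorphism (disk R)) (B : cstarAlgType R).
Variables (iota : starHom (Cdisk R) B) (u : B).
Hypothesis crossed : is_crossed_product phi iota u.
Variables (H : hilbertType R) (rho : starRep B H).
Hypothesis irr : irreducible rho.
Implicit Types (f g h : Cdisk R) (v w : H).
Local Notation T f := (rho (iota f)).
Local Notation U n := (rho (unitary_pow u n)).

Lemma fun_one v : T 1 v = v.
Proof. by rewrite rmorph1 irreducible_rep1. Qed.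

Lemma Cdisk_iterK f n : Cdisk_iter phi (Cdisk_iter phi f (- n)) n = f.
Proof.
apply: Cdisk_eq => z; rewrite -[LHS]/(f (homeo_iter phi (- n) (homeo_iter phi n z))).
by rewrite -homeo_iterD addNr.
Qed.

Lemma fun_translate f n v : T f (U n v) = U n (T (Cdisk_iter phi f n) v).
Proof. by rewrite -!repM (unitary_pow_shift crossed). Qed.

Lemma translate_fun f n v : U n (T f v) = T (Cdisk_iter phi f (- n)) (U n v).
Proof. by rewrite fun_translate Cdisk_iterK. Qed.

Lemma unitary_translate n v : rho u (U n v) = U (n + 1) v.
Proof. by rewrite -repM (unitary_powS crossed). Qed.

Lemma unitary_adj_translate n v : rho (star u) (U n v) = U (n - 1) v.
Proof. by rewrite -repM (unitary_powB crossed). Qed.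

Lemma translate_unitary n v : U n (rho u v) = U (n + 1) v.
Proof.
rewrite -unitary_translate -!repM; congr (rho _ v); case: n => n; apply/esym/commrX => //.
by rewrite /GRing.comm (crossed_uu crossed) (crossed_uus crossed).
Qed.

Lemma translate_unitary_adj n v : U n (rho (star u) v) = U (n - 1) v.
Proof.
rewrite -{1}[n](subrK 1) -translate_unitary -[rho u _]repM (crossed_uus crossed).
by rewrite (irreducible_rep1 irr).
Qed.

Lemma translate_isometry n v w : inner (U n v) (U n w) = inner v w.
Proof.
by rewrite -rep_star -repM (unitary_pow_unit crossed) irreducible_rep1.
Qed.

(** The vectors all of whose translates are killed by [T f] form an invariant
    subspace, which contains the range of [T g]. *)
Lemma disjoint_orbits f g : (forall n z, f z * g (homeo_iter phi n z) = 0) ->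
  (exists v, T g v <> 0) -> forall v, T f v = 0.
Proof.
move=> fg [v gv] w.
pose K := [set v | forall n, T f (U n v) = 0].
have [|K0|KT] := irreducible_cases irr (K := K).
- apply: (crossed_invariant crossed).
  + rewrite (_ : K = \bigcap_n [set v | rho (iota f * unitary_pow u n) v = 0]).
      by apply: closed_bigI => n _; exact: rep_kernel_closed.
    apply/seteqP; split=> [x Kx n _ /=|x Kx n]; first by rewrite repM; exact: Kx.
    by rewrite -repM; exact: Kx.
  + by move=> c x y Kx Ky n; rewrite !linearP Kx Ky scaler0 addr0.
  + by move=> n; rewrite !linear0.
  + by move=> h x Kx n; rewrite translate_fun -repM -rmorphM mulrC rmorphM repM Kx linear0.
  + by move=> x Kx; split=> n; rewrite ?translate_unitary ?translate_unitary_adj; exact: Kx.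
- have : K (T g v).
    move=> n; rewrite translate_fun -repM -rmorphM (_ : f * _ = 0) ?rmorph0 ?rep0 //.
    by apply: Cdisk_eq => z; exact: fg.
  by rewrite K0 /= => /gv.
- have /(_ 0) : K w by rewrite KT.
  by rewrite irreducible_rep1.
Qed.

(** By positivity the hypothesis bounds the squared norm of [T g v] by [e] times
    that of [v]. *)
Lemma fun_eq0_of_le g : (forall e : R, 0 < e -> exists2 h : Cdisk R,
    forall z, `|g z| ^+ 2 <= e%:C + h z & forall v, T h v = 0) ->
  forall v, T g v = 0.
Proof.
move=> gh v; apply: inner_eq0.
apply: (@le_eps_eq0 _ _ (inner v v)); rewrite ?inner_ge0 // => e /gh[h hg h0].
rewrite fun_gram; apply: (@le_trans _ _ (inner (T (e%:C *: 1 + h) v) v)).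
  apply: fun_le => z; rewrite Cdisk_gramE.
  by rewrite -[X in _ <= X]/(e%:C * 1 + h z) mulr1.
by rewrite funD funZ fun_one innerDl innerZl h0 inner0l addr0.
Qed.

(** Otherwise each point other than 1 has a function that [T] kills and that does
    not vanish there. By compactness, finitely many of these dominate, up to [e],
    the squared modulus of [offset (disk1 R)], so that [T] kills the latter too. *)
Lemma support_exists : (exists v, T (Cdisk_id R) v <> v) ->
  exists x, x <> disk1 R /\ forall f, f x != 0 -> exists v, T f v <> 0.
Proof.
move=> [v idv]; apply: contrapT => nex; apply: idv.
have loc x : x <> disk1 R -> exists f, f x != 0 /\ forall v, T f v = 0.
  move=> x1; apply: contrapT => nf; apply: nex; exists x; split=> // f fx.
  by apply: contrapT => nv; apply: nf; exists f; split=> // w;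
     apply: contrapT => fw; apply: nv; exists w.
pose k := offset (disk1 R).
suff k0 : T k v = 0.
  apply/eqP; rewrite -subr_eq0; apply/eqP.
  by rewrite -[RHS]k0 /k /offset funB funZ fun_one scale1r.
move: v; apply: fun_eq0_of_le => e e0.
pose D : set (Cdisk R) := [set F : Cdisk R | (forall z, 0 <= F z) /\ forall v, T F v = 0].
pose O (F : Cdisk R) := [set z | complex.Re (`|k z| ^+ 2) < e + complex.Re (F z)].
have Oopen F : D F -> open (O F).
  move=> _; pose G := F - star k * k.
  rewrite (_ : O F = (fun z => complex.Re (G z)) @^-1` [set y | - e < y]).
    apply: open_comp => [z _|]; last exact: open_gt.
    exact: continuous_comp (@cts_fun _ _ G z) (@Re_continuous _ (G z)).
  apply/seteqP; split=> z; rewrite /O /= -[G z]/(F z - (star k * k) z) Cdisk_gramE raddfB /=;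
    by move=> h; lra.
have cov z : exists2 F, D F & O F z.
  have [->|z1] := pselect (z = disk1 R).
    exists 0; first by split=> [w|v]; [exact: lexx|rewrite rmorph0 rep0].
    by rewrite /O /mkset /k offsetE subrr normr0 expr0n /= addr0.
  have [f [fz f0]] := loc z z1.
  pose c : R := complex.Re (`|k z| ^+ 2) / complex.Re (`|f z| ^+ 2).
  have ReE (y : R[i]) : (complex.Re (`|y| ^+ 2))%:C = `|y| ^+ 2.
    by apply: RRe_real; rewrite ger0_real // exprn_ge0.
  have Re_ge0 (y : R[i]) : 0 <= complex.Re (`|y| ^+ 2) by rewrite -ler0c ReE exprn_ge0.
  have fz0 : complex.Re (`|f z| ^+ 2) != 0.
    apply: contra_neq fz => h; apply/normr0_eq0/eqP.
    by rewrite -sqrf_eq0 -ReE h.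
  exists (c%:C *: (star f * f)).
    split=> [w|w]; last by rewrite funZ funM f0 linear0 scaler0.
    rewrite -[X in _ <= X]/(c%:C * (star f * f) w) Cdisk_gramE.
    by rewrite mulr_ge0 ?exprn_ge0 // ler0c divr_ge0.
  rewrite /O /mkset -[(c%:C *: (star f * f)) z]/(c%:C * (star f * f) z) Cdisk_gramE.
  have -> : complex.Re (c%:C * `|f z| ^+ 2) = c * complex.Re (`|f z| ^+ 2).
    by case: (_ ^+ 2) => a b; rewrite /= mul0r subr0.
  by rewrite /c divfK // ltrDr.
have [s [sD scov]] := disk_finite_cover Oopen cov.
exists (\sum_(F <- s) F) => [z|w]; last first.
  rewrite big_seq; elim/big_rec: _ => [|F G /sD[_ F0] G0]; first by rewrite rmorph0 rep0.
  by rewrite funD F0 G0 addr0.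
have sumE (r : seq (Cdisk R)) : (\sum_(F <- r) F) z = \sum_(F <- r) F z.
  elim: r => [|F r IH]; rewrite ?big_nil // !big_cons -IH //.
have [F Fs kF] := scov z.
apply: (@le_trans _ _ (e%:C + F z)).
  have [F0 _] := sD F Fs; have := F0 z; move: kF; rewrite /O /mkset.
  have : 0 <= `|k z| ^+ 2 by rewrite exprn_ge0.
  case: (_ ^+ 2) => a b; case: (F z) => c d; rewrite !lecE /= => /andP[/eqP -> _] h.
  by move=> /andP[/eqP -> _]; rewrite addr0 eqxx ltW.
rewrite lerD2l sumE (big_rem F) //= lerDl big_seq sumr_ge0 // => G Gs.
by have [G0 _] := sD G (mem_rem Gs); exact: G0.
Qed.

(** The support of [T] on C(D) is the closure of the orbit of any of its points
    other than 1: a function that vanishes on this orbit and at 1 is within [e]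
    of one that vanishes on a neighbourhood of the orbit and of 1, and the
    latter lives on orbits disjoint from those near [x]. *)
Lemma vanish_on_orbit x g : parabolic_with_fixed_point phi (disk1 R) -> x <> disk1 R ->
  (forall f, f x != 0 -> exists v, T f v <> 0) ->
  g (disk1 R) = 0 -> (forall n, g (homeo_iter phi n x) = 0) -> forall v, T g v = 0.
Proof.
move=> par x1 xsupp g1 gx; apply: fun_eq0_of_le => e e0.
pose h : Cdisk R := Cdisk_real (@pos_part_continuous R 1 (- e)) (star g * g).
have hE z : h z = (Num.max 0 (complex.Re (`|g z| ^+ 2) - e))%:C.
  by rewrite Cdisk_realE Cdisk_gramE mul1r.
have h0 z : `|g z| < (Num.sqrt e)%:C -> h z = 0.
  move=> gz; rewrite hE max_l // subr_le0 -lecR.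
  rewrite (_ : (complex.Re (`|g z| ^+ 2))%:C = `|g z| ^+ 2); last first.
    by apply: RRe_real; rewrite ger0_real // exprn_ge0.
  by rewrite -[e](sqr_sqrtr (ltW e0)); apply/normr_sqr_le/ltW.
have se0 : 0 < Num.sqrt e by rewrite sqrtr_gt0.
exists h => [z|].
  rewrite hE; have : 0 <= `|g z| ^+ 2 by rewrite exprn_ge0.
  case: (_ ^+ 2) => a b; rewrite !lecE /= => /andP[/eqP -> _]; rewrite addr0 eqxx /=.
  by rewrite -lerBlDl le_max lexx orbT.
have [r r0 rP] := Cdisk_near g (disk1 R) se0.
have [d0 d00 [N Nfar]] := parabolic_attracts par x1 r0.
have [||d1 d10 d1P] := @common_radius R (fun n d => forall z,
    `|set_val z - set_val x| < d%:C -> h (homeo_iter phi n z) = 0) N.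
- by move=> n d d' dP _ d'd z zx; apply: dP; apply: (lt_le_trans zx); rewrite lecR.
- move=> n; have [d dp dP] := Cdisk_near (Cdisk_iter phi g n) x se0.
  exists d => // z /dP; rewrite -[Cdisk_iter phi g n z]/(g (homeo_iter phi n z)).
  by rewrite -[Cdisk_iter phi g n x]/(g (homeo_iter phi n x)) gx subr0 => /h0.
pose d := Num.min d0 d1; have dp : 0 < d by rewrite lt_min d00 d10.
have hb n z : `|set_val z - set_val x| < d%:C -> h (homeo_iter phi n z) = 0.
  move=> zx; have [nN|Nn] := ltnP `|n| N.
    by apply: d1P => //; apply: (lt_le_trans zx); rewrite lecR ge_min lexx orbT.
  apply: h0; have := rP (homeo_iter phi n z); rewrite g1 subr0; apply; apply: Nfar => //.
  by apply: (lt_le_trans zx); rewrite lecR ge_min lexx.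
move=> v; apply: (disjoint_orbits (g := tent x d)); last first.
  by apply: xsupp; rewrite tent_center oner_neq0.
move=> n z; have [zx|] := boolP (`|set_val (homeo_iter phi n z) - set_val x| < d%:C).
  have -> : z = homeo_iter phi (- n) (homeo_iter phi n z).
    by rewrite -homeo_iterD addNr.
  by rewrite hb // mul0r.
rewrite -(Re_normc (_ - set_val x)) ltcR -leNgt -lecR Re_normc => dx.
by rewrite tent_support // mulr0.
Qed.

(** With [q] as in [orbit_bump], the function [(z - x) * q] vanishes on the orbit and at
    1, so that the range of [T q] consists of eigenvectors. *)
Lemma support_eigenvector x : parabolic_with_fixed_point phi (disk1 R) -> x <> disk1 R ->
  (forall f, f x != 0 -> exists v, T f v <> 0) ->
  exists v, v != 0 /\ T (Cdisk_id R) v = set_val x *: v.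
Proof.
move=> par x1 xsupp; have [q [q1 qx]] := orbit_bump par x1.
have [|v qv] := xsupp q; first by rewrite (qx 0) oner_neq0.
exists (T q v); split; first exact/eqP.
apply/eqP; rewrite -subr_eq0 -funM -funZ -funB; apply/eqP.
apply: (vanish_on_orbit par x1 xsupp).
  rewrite -[LHS]/(1 * q (disk1 R) - set_val x * q (disk1 R)).
  by rewrite q1 !mulr0 subrr.
move=> n; rewrite -[LHS]/(set_val (homeo_iter phi n x) * q (homeo_iter phi n x)
   - set_val x * q (homeo_iter phi n x)) qx.
by case: eqP => [->|_]; rewrite ?mulr0 subrr.
Qed.

End Localization.

(** * Orbit representations and scalar representations *)

Section OrbitRepresentations.
Variables (R : realType) (phi : homeomorphism (disk R)) (B : cstarAlgType R).
Variables (iota : starHom (Cdisk R) B) (u : B).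
Hypotheses (crossed : is_crossed_product phi iota u)
  (parabolic : parabolic_with_fixed_point phi (disk1 R)).

Lemma eigenvector_translate (H : hilbertType R) (rho : starRep B H) (x : disk R) v :
  irreducible rho -> rho (iota (Cdisk_id R)) v = set_val x *: v ->
  forall f n, rho (iota f) (rho (unitary_pow u n) v) =
    f (homeo_iter phi n x) *: rho (unitary_pow u n) v.
Proof.
move=> irr xv f n; rewrite (fun_translate crossed).
by rewrite (fun_eigenvector (irreducible_rep1 irr v) xv) linearZ.
Qed.

(** The translates of [v] are eigenvectors for the distinct points of the orbit
    of [x], so they are orthogonal; the orthogonal complement of their span is
    invariant and does not contain [v]. *)
Lemma equivalent_pi_point (H : hilbertType R) (rho : starRep B H) (x : disk R) v
    (pi_x : starRep B (l2Z R)) :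
  irreducible rho -> x <> disk1 R -> v != 0 ->
  rho (iota (Cdisk_id R)) v = set_val x *: v ->
  is_pi_point phi iota u x pi_x -> unitarily_equivalent rho pi_x.
Proof.
move=> irr x1 v0 xv pP.
have nv : inner v v != 0 by apply: contra_neq v0 => /inner_eq0.
pose c := sqrtC (inner v v).
have cc : c * c^* = inner v v.
  rewrite (_ : c^* = c) -?expr2 ?sqrtCK //.
  by apply: CrealP; rewrite ger0_real // sqrtC_ge0 inner_ge0.
have c0 : c != 0 by rewrite sqrtC_eq0.
pose v1 := c^-1 *: v.
have v1v1 : inner v1 v1 = 1.
  by rewrite innerZl innerZr rmorphV ?unitfE //= mulrA -invfM cc mulVf.
have xv1 : rho (iota (Cdisk_id R)) v1 = set_val x *: v1.
  by rewrite linearZ /= xv !scalerA mulrC.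
pose e n := rho (unitary_pow u n) v1.
have Te := eigenvector_translate irr xv1.
have on m n : inner (e m) (e n) = (m == n)%:R.
  have [->|mn] := eqVneq m n; first by rewrite (translate_isometry crossed).
  have h : set_val (homeo_iter phi m x) * inner (e m) (e n) =
           set_val (homeo_iter phi n x) * inner (e m) (e n).
    rewrite -innerZl -(Te (Cdisk_id R)) rep_starr -star_homS Te innerZr.
    by rewrite -[(star (Cdisk_id R)) _]/(Num.conj (set_val (homeo_iter phi n x))) conjCK.
  apply/eqP; move/eqP: h; rewrite -subr_eq0 -mulrBl mulf_eq0 subr_eq0 => /orP[|//].
  by move=> /eqP/disk_eq/(parabolic_free2 parabolic x1)/eqP; rewrite (negbTE mn).
have tot w : (forall n, inner w (e n) = 0) -> w = 0.
  move=> we; pose K := [set w | forall n, inner w (e n) = 0].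
  have [|K0|KT] := irreducible_cases irr (K := K).
  - apply: (crossed_invariant crossed).
    + rewrite (_ : K = \bigcap_n [set w | inner w (e n) = 0 :> R[i]]).
        by apply: closed_bigI => n _; exact: closed_zero (@inner_continuous _ _ _).
      by apply/seteqP; split=> [y Ky n _ /=|y Ky n]; exact: Ky.
    + by move=> k y z Ky Kz n; rewrite innerDl innerZl Ky Kz mulr0 addr0.
    + by move=> n; rewrite inner0l.
    + by move=> f y Ky n; rewrite rep_starr -star_homS Te innerZr Ky mulr0.
    + move=> y Ky; split=> n; last by rewrite rep_star (unitary_translate crossed); exact: Ky.
      by rewrite rep_starr (unitary_adj_translate crossed); exact: Ky.
  - by have : K w by []; rewrite K0.
  - have : K v1 by rewrite KT.
    by move=> /(_ 0); rewrite -[v1 in inner v1]/(v1) -{1}(irreducible_rep1 irr v1)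
      -/(e 0) on eqxx => /eqP; rewrite oner_eq0.
pose V : {linear H -> l2Z R} := basis_map on.
have VE w n : V w n = inner w (e n) by [].
have Vi w w' : inner (V w) (V w') = inner w w' by exact: basis_map_inner.
exists V; split=> //; first exact: basis_map_bijective.
apply: (crossed_intertwined crossed) => [|f w|w|w].
- exact: isometry_continuous.
- apply: l2Z_eq => n; rewrite (pi_point_fun pP) !VE rep_starr -star_homS Te innerZr.
  by rewrite -[(star f) _]/(Num.conj (f (homeo_iter phi n x))) conjCK.
- apply: l2Z_eq => n; have [_ ->] := pP (V w) n.
  by rewrite !VE rep_starr (unitary_adj_translate crossed).
- by apply: l2Z_eq => n; rewrite (pi_point_star pP) !VE rep_star (unitary_translate crossed).
Qed.

(** The function of [orbit_bump] extracts a basis vector from any vector with a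
    nonzero coordinate; the translations then reach the other basis vectors. *)
Lemma pi_point_irreducible x (rho : starRep B (l2Z R)) : x <> disk1 R ->
  is_pi_point phi iota u x rho -> irreducible rho.
Proof.
move=> x1 rP; split.
  exists 1, (delta R 0); rewrite (pi_point_rep1 rP); apply/eqP; exact: delta_neq0.
move=> K [Kc K0 KL Ka].
have [[xi [Kxi xi0]]|nK] := pselect (exists xi, K xi /\ xi != 0); last first.
  left; apply/seteqP; split=> [xi Kxi /=|_ ->//].
  by apply/eqP/negPn/negP => xi0; apply: nK; exists xi.
right; have KZ c w : K w -> K (c *: w) by move=> Kw; rewrite -[_ *: _]addr0; exact: KL.
have KD w w' : K w -> K w' -> K (w + w').
  by move=> Kw Kw'; rewrite -[w]scale1r; exact: KL.
have [m xim] : exists m, xi m != 0.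
  apply: contrapT => nm; case/eqP: xi0; apply: l2Z_eq => n /=.
  by apply/eqP/negPn/negP => h; apply: nm; exists n.
have [q [_ qx]] := orbit_bump parabolic (iter_neq1 parabolic (n := m) x1).
have Km : K (delta R m).
  rewrite (_ : delta R m = (xi m)^-1 *: rho (iota q) xi); first exact/KZ/Ka.
  apply: l2Z_eq => n; rewrite -[RHS]/((xi m)^-1 * rho (iota q) xi n) (pi_point_fun rP).
  rewrite -[n in homeo_iter phi n x](subrK m) homeo_iterD qx /= subr_eq0.
  by case: eqP => [->|_]; rewrite ?mul1r ?mulVf // mul0r mulr0.
have Kdelta n : K (delta R n).
  rewrite -[n](subrK m); move: (n - m) => k; elim/int_ind: k => [|k IH|k IH].
  - by rewrite add0r.
  - rewrite (_ : delta _ _ = rho u (delta R (k%:Z + m))); first exact: Ka.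
    apply: l2Z_eq => j; have [_ ->] := rP (delta R (k%:Z + m)) j.
    by rewrite /= -addn1 PoszD subr_eq addrAC.
  - rewrite (_ : delta _ _ = rho (star u) (delta R (- k%:Z + m))); first exact: Ka.
    apply: l2Z_eq => j; rewrite (pi_point_star rP) /= -addn1 PoszD opprD.
    by rewrite [_ - 1 + m]addrAC eq_sym subr_eq eq_sym.
apply/seteqP; split=> // w _.
apply: (closed_cvg _ Kc _ _ (@l2Z_sum_delta _ w)); apply: nearW => N.
rewrite /partial_sum; elim/big_rec: _ => // k y _ Ky.
by apply: (KD _ _ _ Ky); apply: KD; apply: KZ.
Qed.

End OrbitRepresentations.

Section ScalarCase.
Variables (R : realType) (phi : homeomorphism (disk R)) (B : cstarAlgType R).
Variables (iota : starHom (Cdisk R) B) (u : B).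
Hypothesis crossed : is_crossed_product phi iota u.
Variables (H : hilbertType R) (rho : starRep B H).
Hypotheses (irr : irreducible rho)
  (scalar_fun : forall f v, rho (iota f) v = f (disk1 R) *: v).

Lemma irreducible_nonzero : exists v : H, v != 0.
Proof.
have [[a [v av]] _] := irr; exists (rho a v); exact/eqP.
Qed.

Lemma commute_with_u b : u * b = b * u -> star u * b = b * star u ->
  forall a v, rho a (rho b v) = rho b (rho a v).
Proof.
move=> bu bs; apply: (crossed_commute crossed) => // f v.
by rewrite !repM !scalar_fun linearZ.
Qed.

(** Write [|a|] for the positive square root of [a * a].  From
    [(a - |a|) * (a + |a|) = 0] and the triviality of kernels, [rho a] is
    [rho |a|] or its opposite; if moreover its quadratic form vanishes at some
    vector, then [rho a] kills this vector and is therefore zero. *)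
Lemma selfadjoint_zero a v0 : star a = a -> u * a = a * u -> v0 != 0 ->
  cnorm a <= 1 -> inner (rho a v0) v0 = 0 -> forall v, rho a v = 0.
Proof.
move=> as_ ua v00 a1 av0.
have sua : star u * a = a * star u.
  by rewrite -{1}as_ -starM -ua starM as_.
have [s [ss sE sC]] := cstar_abs as_ a1.
have us : u * s = s * u by exact: sC.
have sus : star u * s = s * star u by exact: sC.
have comm_sq x : x * s = s * x -> x * (s * s) = s * s * x.
  by move=> h; rewrite [LHS]mulrA h -[LHS]mulrA h mulrA.
have as2 : a * (s * s) = s * s * a by apply/comm_sq/sC.
have prod0 : (a - s * s) * (a + s * s) = 0.
  by rewrite mulrDr !mulrBl -sE as2 addrA subrK subrr.
have comm_sub : forall b v, rho b (rho (a - s * s) v) = rho (a - s * s) (rho b v).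
  by apply: commute_with_u; rewrite mulrBr mulrBl ?ua ?sua comm_sq.
have signs : (forall v, rho a v = rho (s * s) v) \/ (forall v, rho a v = - rho (s * s) v).
  have [h|nh] := pselect (forall v, rho (a - s * s) v = 0).
    by left=> v; apply/eqP; rewrite -subr_eq0 -repB h.
  right=> v; apply/eqP; rewrite -addr_eq0 -repD; apply/negPn/negP => h.
  apply: nh; apply: (irreducible_kernel irr comm_sub).
  by exists (rho (a + s * s) v); rewrite // -repM prod0 rep0.
have sv0 : rho s v0 = 0.
  apply: inner_eq0; rewrite -rep_gram ss.
  case: signs => h; rewrite h in av0; first by [].
  by move: av0; rewrite -scaleN1r innerZl mulN1r => /eqP; rewrite oppr_eq0 => /eqP.
apply: (irreducible_kernel irr); first exact: commute_with_u.
exists v0 => //; have cv0 : rho (s * s) v0 = 0 by rewrite repM sv0 linear0.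
by case: signs => h; rewrite h cv0 ?oppr0.
Qed.

(** Subtracting from [a] the mean value of [rho a] at a vector, and normalizing,
    leads to the situation of [selfadjoint_zero]. *)
Lemma selfadjoint_scalar a : star a = a -> u * a = a * u ->
  exists m : R[i], forall v, rho a v = m *: v.
Proof.
move=> as_ ua; have [v0 v00] := irreducible_nonzero.
have n0 : inner v0 v0 != 0 by apply: contra_neq v00 => /inner_eq0.
pose m := inner (rho a v0) v0 / inner v0 v0.
have mr : m^* = m.
  rewrite rmorphM /= fmorphV /= -!innerC; congr (_ / _).
  by rewrite rep_starr as_.
exists m => v; pose b := a - m *: 1.
pose k : R := (1 + cnorm b)^-1.
have b1 : 0 < 1 + cnorm b by rewrite ltr_wpDr ?cnorm_ge0.
have k0 : k%:C != 0 :> R[i] by rewrite gt_eqF // ltcR invr_gt0.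
have kb : forall v, rho (k%:C *: b) v = 0.
  apply: (selfadjoint_zero (v0 := v0)) => //.
  - by rewrite starZ starB starZ star1 as_ mr /Num.conj /= oppr0.
  - by rewrite -scalerAr -scalerAl mulrBr mulrBl ua -scalerAr -scalerAl mulr1 mul1r.
  - rewrite cnormZr ger0_norm ?invr_ge0 ?(ltW b1) // mulrC ler_pdivrMr // mul1r.
    by rewrite lerDr.
  - rewrite repZ repB repZ innerZl innerBl irreducible_rep1 // innerZl /m divfK //.
    by rewrite subrr mulr0.
have : rho b v = 0.
  by have := kb v; rewrite repZ => /eqP; rewrite scaler_eq0 (negbTE k0) => /eqP.
by rewrite repB repZ irreducible_rep1 // => /eqP; rewrite subr_eq0 => /eqP.
Qed.

(** Twice [u] is the sum of the self-adjoint [u + star u] and of [- i] times the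
    self-adjoint [i (u - star u)]. *)
Lemma unitary_scalar : exists m : R[i], `|m| = 1 /\ forall v, rho u v = m *: v.
Proof.
have uu := crossed_uu crossed; have uus := crossed_uus crossed.
have [||m1 m1P] := @selfadjoint_scalar (u + star u).
- by rewrite starD starK addrC.
- by rewrite mulrDl mulrDr uu uus.
have ic : ('i%C : R[i])^* = - 'i%C by apply/eqP; rewrite eq_complex /= oppr0 !eqxx.
have [||m2 m2P] := @selfadjoint_scalar ('i%C *: (u - star u)).
- by rewrite starZ starB starK ic scaleNr -scalerN opprB.
- by rewrite -scalerAr -scalerAl mulrBl mulrBr uu uus.
have uE v : rho u v = ((m1 - 'i%C * m2) / 2) *: v.
  apply: (scalerI (_ : (2 : R[i]) != 0)); first by rewrite pnatr_eq0.
  rewrite scalerA mulrCA mulfV ?pnatr_eq0 // mulr1 scalerBl -m1P -scalerA -m2P.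
  rewrite repZ scalerA -expr2 sqr_i scaleN1r opprK -repD addrACA subrr addr0.
  by rewrite repD scaler_nat mulr2n.
exists ((m1 - 'i%C * m2) / 2); split=> //; set m := _ / 2 in uE *.
have [v0 v00] := irreducible_nonzero.
have n0 : inner v0 v0 != 0 by apply: contra_neq v00 => /inner_eq0.
have := rep_gram rho u v0; rewrite uu irreducible_rep1 // uE innerZl innerZr mulrA -normCK.
move=> e; apply/eqP; rewrite -(@eqrXn2 _ 2) // expr1n; apply/eqP.
by apply: (mulIf n0); rewrite mul1r -e.
Qed.

End ScalarCase.

Section Circle.
Variable R : realType.

Lemma cos_eq1 (x : R) : 0 <= x < pi *+ 2 -> cos x = 1 -> x = 0.
Proof.
move=> /andP[x0 x2]; rewrite [x in cos x]splitr cosD => c1.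
have := cos2Dsin2 (x / 2); rewrite !expr2 => cs.
have s0 : sin (x / 2) = 0 by apply/eqP; rewrite -sqrf_eq0 expr2; apply/eqP; lra.
apply/eqP/negPn/negP => xn0; have xp : 0 < x by rewrite lt_neqAle eq_sym xn0.
have := @sin_gt0_pi R (x / 2); rewrite s0 ltxx => h.
have/h // : 0 < x / 2 < pi.
by rewrite divr_gt0 //= ltr_pdivrMr // mulr_natr.
Qed.

Lemma expi_inj (s t : R) : 0 <= s < 1 -> 0 <= t < 1 -> expi s = expi t -> s = t.
Proof.
wlog st : s t / s <= t.
  move=> h hs ht e; case: (leP s t) => [|/ltW] ts; first exact: h.
  by symmetry; exact: h.
move=> /andP[s0 s1] /andP[t0 t1] [ec es].
have p0 := @pi_gt0 R.
have : 2 * pi * t - 2 * pi * s = 0.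
  apply: cos_eq1; first by rewrite mulr2n; apply/andP; split; nra.
  by rewrite cosB ec es -!expr2 cos2Dsin2.
rewrite -mulrBr => /eqP; rewrite mulf_eq0 subr_eq0 mulf_eq0 pnatr_eq0 (gt_eqF p0) /=.
by move=> /eqP.
Qed.

Lemma expi_surj (z : R[i]) : `|z| = 1 -> exists t : R, 0 <= t < 1 /\ expi t = z.
Proof.
case: z => a b z1.
have ab : a ^+ 2 + b ^+ 2 = 1.
  have := congr1 (fun y => y ^+ 2) z1; rewrite normc_def /= expr1n -rmorphXn /=.
  by rewrite sqr_sqrtr ?addr_ge0 ?sqr_ge0 // => -[].
have p0 := @pi_gt0 R; have pn : (pi : R) != 0 by rewrite gt_eqF.
have a1 : -1 <= a <= 1 by apply/andP; split; nra.
have ba : b ^+ 2 = 1 - a ^+ 2 by rewrite -ab addrAC subrr add0r.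
have r0 := acos_ge0 a1; have rp := acos_lepi a1.
have frac_lt (x : R) : 0 <= x -> x < 2 * pi -> 0 <= x / (2 * pi) < 1.
  move=> x0 x1; have p2 : 0 < 2 * pi :> R by rewrite mulr_gt0.
  by apply/andP; split; [rewrite divr_ge0 // ltW|rewrite ltr_pdivrMr // mul1r].
have frac_val (x : R) : 2 * pi * (x / (2 * pi)) = x :> R.
  by rewrite mulrCA mulfV ?mulr1 // mulf_neq0 // pnatr_eq0.
have [b0|b0] := leP 0 b.
  exists (acos a / (2 * pi)); split; first by apply: frac_lt => //; lra.
  by rewrite /expi frac_val acosK ?in_itv //= sin_acos // -ba sqrtr_sqr ger0_norm.
have a_lt : -1 <= a < 1 by apply/andP; split; nra.
have rp0 := acos_gt0 a_lt.
exists ((2 * pi - acos a) / (2 * pi)); split; first by apply: frac_lt; lra.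
rewrite /expi frac_val addrC mulr_natl cosD2pi sinD2pi cosN sinN acosK ?in_itv //=.
by rewrite sin_acos // -ba sqrtr_sqr ltr0_norm // opprK.
Qed.

End Circle.

(** * Equivalence and classification *)

Section Equivalence.
Variables (R : realType) (phi : homeomorphism (disk R)) (B : cstarAlgType R).
Variables (iota : starHom (Cdisk R) B) (u : B).
Hypotheses (crossed : is_crossed_product phi iota u)
  (parabolic : parabolic_with_fixed_point phi (disk1 R)).

(** When the coordinate function acts as the identity, the functions and the unitary
    act by scalars, so that the line spanned by any vector is invariant. *)
Lemma equivalent_pi_theta (H : hilbertType R) (rho : starRep B H) : irreducible rho ->
  (forall v, rho (iota (Cdisk_id R)) v = v) ->
  exists t : R, 0 <= t < 1 /\ forall pi_t : starRep B R[i],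
    is_pi_theta iota u t pi_t -> unitarily_equivalent rho pi_t.
Proof.
move=> irr idv.
have fv f v : rho (iota f) v = f (disk1 R) *: v.
  apply: (fun_eigenvector (p := disk1 R)); first exact: irreducible_rep1.
  by rewrite idv disk1E scale1r.
have [m [m1 uv]] := unitary_scalar crossed irr fv.
have [t [t01 tm]] := expi_surj m1.
exists t; split=> // pi_t tP.
have [v v0] := irreducible_nonzero irr.
have mm : m^* * m = 1 by rewrite mulrC -normCK m1 expr1n.
have usv w : rho (star u) w = m^* *: w.
  by apply: inner_inj => x; rewrite rep_star uv innerZr innerZl.
have nv : inner v v != 0 by apply: contra_neq v0 => /inner_eq0.
have line w : inner v v *: w = inner w v *: v.
  pose K := [set w | inner v v *: w - inner w v *: v = 0].
  have Ks c x : K x -> K (c *: x).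
    move=> Kx; rewrite /K /= innerZl -scalerA scalerA mulrC -scalerA -scalerBr.
    by rewrite [X in _ *: X]Kx scaler0.
  have [|K0|KT] := irreducible_cases irr (K := K).
  - apply: (crossed_invariant crossed).
    + apply: (@closed_zero _ _ _ (fun w => inner v v *: w - inner w v *: v)) => x.
      apply: cvgB; first by apply: cvgZr; exact: cvg_id.
      by apply: cvgZl; exact: inner_continuous.
    + move=> c x y Kx Ky; rewrite /K /= scalerDr innerDl scalerDl opprD addrACA.
      by rewrite -/(K y) [X in _ + X]Ky addr0; exact: Ks.
    + by rewrite /K /= inner0l scaler0 scale0r subrr.
    + by move=> f x Kx; rewrite fv; exact: Ks.
    + by move=> x Kx; rewrite uv usv; split; exact: Ks.
  - have : K v by rewrite /K /= subrr.
    by rewrite K0 => /= v00; rewrite v00 eqxx in v0.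
  - have : K w by rewrite KT.
    by move=> /eqP; rewrite subr_eq0 => /eqP.
pose c := sqrtC (inner v v).
have cr : c^* = c by apply: CrealP; rewrite ger0_real // sqrtC_ge0 inner_ge0.
have cc : c * c = inner v v by rewrite -expr2 sqrtCK.
have c0 : c != 0 by rewrite sqrtC_eq0.
pose V (w : H) : R[i] := inner w v / c.
have V_linear : linear V.
  by move=> k x y; rewrite /V innerDl innerZl mulrDl -mulrA.
pose Vl : {linear H -> R[i]} := HB.pack V (GRing.isLinear.Build _ _ _ _ V V_linear).
have VE w : Vl w = inner w v / c by [].
have Vi x y : inner (Vl x) (Vl y) = inner x y.
  rewrite -[LHS]/(Vl x * (Vl y)^*) !VE rmorphM fmorphV /= cr.
  apply: (mulfI nv); rewrite -innerZl line innerZl [inner v y]innerC -cc.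
  by field.
exists Vl; split=> //.
  exists (fun z => (z / c) *: v) => [w|z].
    rewrite VE -mulrA -invfM cc mulrC -scalerA -line scalerA mulVf // scale1r.
    by [].
  by rewrite VE innerZl -cc mulrA divfK // mulfK.
apply: (crossed_intertwined crossed) => [|f w|w|w].
- exact: isometry_continuous.
- by rewrite fv linearZ (pi_theta_fun tP).
- by rewrite uv linearZ; have [_ ->] := tP (Vl w); rewrite tm.
- rewrite usv linearZ /=; apply: (mulfI (_ : m != 0)).
    by rewrite -normr_gt0 m1 ltr01.
  rewrite mulrA [m * _]mulrC mm mul1r -tm.
  have [_ <-] := tP (pi_t (star u) (Vl w)).
  by rewrite -repM (crossed_uus crossed) (pi_theta_rep1 tP).
Qed.

Lemma pi_theta_inequivalent s t (rho1 rho2 : starRep B R[i]) :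
  0 <= s < 1 -> 0 <= t < 1 -> is_pi_theta iota u s rho1 -> is_pi_theta iota u t rho2 ->
  unitarily_equivalent rho1 rho2 -> s = t.
Proof.
move=> s01 t01 sP tP [V [Vb _ Va]]; apply: expi_inj => //.
have V1 : V 1 != 0.
  by apply/eqP => h; have := bij_inj Vb (etrans h (esym (linear0 V))); apply/eqP/oner_neq0.
have := Va u 1; have [_ ->] := sP 1; have [_ ->] := tP (V 1).
by rewrite -[expi s * 1]/(expi s *: (1 : R[i])) linearZ => /(mulIf V1).
Qed.

(** The image of [delta R 0] is an eigenvector, with eigenvalue [x], of a diagonal
    operator whose entries are the points of the orbit of [y]. *)
Lemma pi_point_equivalent_orbit x y (rho1 rho2 : starRep B (l2Z R)) :
  is_pi_point phi iota u x rho1 -> is_pi_point phi iota u y rho2 ->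
  unitarily_equivalent rho1 rho2 -> orbit_of phi x = orbit_of phi y.
Proof.
move=> xP yP [V [Vb _ Va]].
have V0 : V (delta R 0) != 0.
  apply/eqP => h; have /eqP := bij_inj Vb (etrans h (esym (linear0 V))).
  exact/negP/delta_neq0.
have [n Vn] : exists n, V (delta R 0) n != 0.
  apply: contrapT => nn; case/eqP: V0; apply: l2Z_eq => n /=.
  by apply/eqP/negPn/negP => h; apply: nn; exists n.
have e : set_val x * V (delta R 0) n = set_val (homeo_iter phi n y) * V (delta R 0) n.
  have [<- _] := yP (V (delta R 0)) n.
  rewrite -Va (_ : rho1 _ _ = set_val x *: delta R 0) ?linearZ //.
  apply: l2Z_eq => m; have [-> _] := xP (delta R 0) m.
  rewrite -[RHS]/(set_val x * delta R 0 m) /=.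
  by case: eqP => [->|_] //; rewrite !mulr0.
by rewrite (disk_eq (mulIf Vn e)) orbit_of_iter.
Qed.

Lemma pi_theta_point_inequivalent t x (rho1 : starRep B R[i]) (rho2 : starRep B (l2Z R)) :
  x <> disk1 R -> is_pi_theta iota u t rho1 -> is_pi_point phi iota u x rho2 ->
  ~ unitarily_equivalent rho1 rho2.
Proof.
move=> x1 tP xP [V [Vb _ Va]].
have V1 : V 1 != 0.
  by apply/eqP => h; have := bij_inj Vb (etrans h (esym (linear0 V))); apply/eqP/oner_neq0.
have [n Vn] : exists n, V 1 n != 0.
  apply: contrapT => nn; case/eqP: V1; apply: l2Z_eq => n /=.
  by apply/eqP/negPn/negP => h; apply: nn; exists n.
have e : 1 * V 1 n = set_val (homeo_iter phi n x) * V 1 n.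
  by have [<- _] := xP (V 1) n; rewrite -Va; have [-> _] := tP 1; rewrite mul1r.
by apply: (iter_neq1 parabolic (n := n) x1); apply: disk_eq; rewrite -(mulIf Vn e).
Qed.

End Equivalence.

Theorem theorem4p2 (R : realType) (phi : homeomorphism (disk R))
    (D : set (disk R)) (B : cstarAlgType R)
    (iota : starHom (Cdisk R) B) (u : B) :
  parabolic_with_fixed_point phi (disk1 R) ->
  orbit_transversal phi D ->
  is_crossed_product phi iota u ->
  exists (pi_theta : R -> starRep B R[i])
         (pi_point : disk R -> starRep B (l2Z R)),
    (* pi_theta and pi_point are the representations of the statement *)
    (forall t, 0 <= t < 1 ->
      is_pi_theta iota u t (pi_theta t) /\
      forall rho, is_pi_theta iota u t rho ->
        forall a v, rho a v = pi_theta t a v) /\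
    (forall x, x <> disk1 R ->
      is_pi_point phi iota u x (pi_point x) /\
      forall rho, is_pi_point phi iota u x rho ->
        forall a v, rho a v = pi_point x a v) /\
    (* irreducibility *)
    (forall t, 0 <= t < 1 -> irreducible (pi_theta t)) /\
    (forall x, D x -> irreducible (pi_point x)) /\
    (* pairwise inequivalence *)
    (forall s t, 0 <= s < 1 -> 0 <= t < 1 -> s <> t ->
      ~ unitarily_equivalent (pi_theta s) (pi_theta t)) /\
    (forall x y, D x -> D y -> x <> y ->
      ~ unitarily_equivalent (pi_point x) (pi_point y)) /\
    (forall t x, 0 <= t < 1 -> D x ->
      ~ unitarily_equivalent (pi_theta t) (pi_point x)) /\
    (* every irreducible representation is in the list *)
    (forall (H : hilbertType R) (rho : starRep B H), irreducible rho ->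
      (exists t, 0 <= t < 1 /\ unitarily_equivalent rho (pi_theta t)) \/
      (exists x, D x /\ unitarily_equivalent rho (pi_point x))).
Proof.
move=> parabolic [D1 transversal] crossed.
have fix1 := fix_disk1 parabolic.
pose pi_theta t := projT1 (cid (pi_theta_exists crossed t fix1)).
have thetaP t : is_pi_theta iota u t (pi_theta t).
  exact: (projT2 (cid (pi_theta_exists crossed t fix1))).
pose pi_point x := projT1 (cid (pi_point_exists crossed x)).
have pointP x : is_pi_point phi iota u x (pi_point x).
  exact: (projT2 (cid (pi_point_exists crossed x))).
have D_neq1 x : D x -> x <> disk1 R by move=> Dx x1; apply: D1; rewrite -x1.
exists pi_theta, pi_point; split=> [t _|].
  by split=> // rho rhoP; exact: (pi_theta_unique crossed rhoP (thetaP t)).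
split=> [x _|]; first by split=> // rho rhoP; exact: (pi_point_unique crossed rhoP (pointP x)).
split=> [t _|]; first exact: (pi_theta_irreducible (thetaP t)).
split=> [x /D_neq1 x1|]; first exact: (pi_point_irreducible parabolic x1 (pointP x)).
split=> [s t s01 t01 st eq_st|].
  exact: (st (pi_theta_inequivalent s01 t01 (thetaP s) (thetaP t) eq_st)).
split=> [x y Dx Dy xy eq_xy|].
  have orb := pi_point_equivalent_orbit (pointP x) (pointP y) eq_xy.
  have [z [_ zuniq]] := transversal x (D_neq1 x Dx).
  exact: (xy (etrans (esym (zuniq x (conj Dx erefl))) (zuniq y (conj Dy orb)))).
split=> [t x _ /D_neq1 x1|H rho irr].
  exact: (pi_theta_point_inequivalent parabolic x1 (thetaP t) (pointP x)).
have [idv|nid] := pselect (forall v, rho (iota (Cdisk_id R)) v = v).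
  have [t [t01 eq_t]] := equivalent_pi_theta crossed irr idv.
  by left; exists t; split=> //; exact: eq_t.
right; have [|x [x1 xsupp]] := support_exists irr (iota := iota).
  by apply: contrapT => nv; apply: nid => v; apply: contrapT => vn; apply: nv; exists v.
have [v [v0 xv]] := support_eigenvector crossed irr parabolic x1 xsupp.
have [y [[Dy xy] _]] := transversal x x1.
have [n yx] := orbit_of_eq (esym xy).
exists y; split=> //; have y1 := D_neq1 y Dy.
apply: (equivalent_pi_point crossed parabolic irr y1 (v := rho (unitary_pow u n) v)) => //.
  apply: contra_neq v0 => h; apply: inner_eq0.
  by rewrite -(translate_isometry crossed irr n) h inner0l.
by rewrite (eigenvector_translate crossed irr xv) yx.
Qed.
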